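(* Let $\Omega\subset\mathbb{R}^2$ be a simply connected bounded domain with Lipschitz boundary, and let $\epsilon\in L^2(\mathcal{S}^2;\Omega)$ be a two-dimensional residual elastic strain field on $\Omega$, under either plane-strain or plane-stress conditions, satisfying equilibrium and existing in the absence of boundary traction. (The support of $\epsilon$ itself is not assumed to be simply connected, only contained in the simply connected set $\Omega$.) Let $\sigma=C:\epsilon$ be the corresponding stress, and extend $\epsilon$ and $\sigma$ by zero to $\mathbb{R}^2$. Then the extension of $\epsilon$ to all of $\mathbb{R}^2$ has a unique Helmholtz decomposition of the form $$\epsilon=d\omega+{}^s\epsilon$$ where ${}^s\epsilon$ and $d\omega$ are compactly supported within $\Omega$. Moreover, this decomposition can be written in terms of the Airy stress potential $\psi$, that is, the unique $\psi\in\dot H^2_0(\mathbb{R}^2)$ with $\mathrm{supp}(\psi)\subset\Omega$ and $\sigma=(d^\perp)^2\psi$ on $\mathbb{R}^2$, as $$\omega=-\frac{\nu(1+\nu)}{E}\,d\psi,\qquad {}^s\epsilon=\frac{1-\nu^2}{E}(d^\perp)^2\psi$$ in the case of plane-strain, or $$\omega=-\frac{\nu}{E}\,d\psi,\qquad {}^s\epsilon=\frac1E(d^\perp)^2\psi$$ in the case of plane-stress. In particular, in each case ${}^s\epsilon$ is proportional to $\sigma$.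
   Context: All indices run over $\{1,2\}$; repeated indices are summed. $L^2(\mathcal{S}^2;U)$ is the space of square-integrable symmetric $2$-tensor fields on $U$. The material is homogeneous and isotropic, with constant Young's modulus $E$ and Poisson's ratio $\nu$. Hooke's law is $\sigma=C:\epsilon$, i.e. $\sigma_{ij}=C_{ijkl}\epsilon_{kl}$, where $$C_{ijkl}=\frac{E}{1+\nu}\Big(\frac{\nu}{1-2\nu}\delta_{ij}\delta_{kl}+\tfrac12(\delta_{ik}\delta_{jl}+\delta_{il}\delta_{jk})\Big)\ \text{(plane-strain)},$$ $$C_{ijkl}=\frac{E}{1+\nu}\Big(\frac{\nu}{1-\nu}\delta_{ij}\delta_{kl}+\tfrac12(\delta_{ik}\delta_{jl}+\delta_{il}\delta_{jk})\Big)\ \text{(plane-stress)}.$$ Equilibrium means $\mathrm{Div}(\sigma)=0$ in $\Omega$, with $(\mathrm{Div}\,\sigma)_i=\partial_j\sigma_{ij}$, and absence of boundary traction means $\sigma\cdot n=0$ on $\partial\Omega$, $n$ being the outward normal; for $L^2$ fields the two conditions together are understood to mean that $\sigma$ extended by zero is divergence-free in the distributional sense on $\mathbb{R}^2$. Helmholtz decomposition on $\mathbb{R}^2$: every $f\in L^2(\mathcal{S}^2;\mathbb{R}^2)$ can be written uniquely as $f=du+{}^sf$ with $(du)_{ij}=\tfrac12(\partial_ju_i+\partial_iu_j)$, $u\in\dot H^1_0(\mathcal{S}^1;\mathbb{R}^2)$ (the closure of the smooth compactly supported vector fields in the norm $\|du\|_{L^2}$), and ${}^sf\in L^2(\mathcal{S}^2;\mathbb{R}^2)$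 divergence-free in the distributional sense. For scalar $\psi$, $d\psi=\nabla\psi$ and $$(d^\perp)^2\psi=\begin{pmatrix}\partial_2^2\psi&-\partial_1\partial_2\psi\\-\partial_1\partial_2\psi&\partial_1^2\psi\end{pmatrix}.$$ $\dot H^2_0(\mathbb{R}^2)$ is the closure of $\mathcal{C}_c^\infty(\mathbb{R}^2)$ in the norm $\|\Delta\psi\|_{L^2(\mathbb{R}^2)}$.
   Formalization: ''Compactly supported within Ω'' and ''supp(ψ) ⊂ Ω'' are read with the closure of Ω, since a field nonzero up to the boundary (e.g. ψ=(1−|x|²)² on the unit disk) has closed support equal to the closure of Ω. *)

(* Defs.v *)
From HB Require Import structures.
From mathcomp Require Import all_boot all_order all_algebra.
From mathcomp Require Import all_classical all_reals all_analysis.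

Set Implicit Arguments.
Unset Strict Implicit.
Unset Printing Implicit Defensive.

Import Order.TTheory GRing.Theory Num.Theory.
Import numFieldNormedType.Exports.

Local Open Scope classical_set_scope.
Local Open Scope ring_scope.

(* Indices 1, 2 of the text are ord0, ord_max : 'I_2, so [rev_ord] swaps them.
   Fields are families of component functions. *)
Definition scalar_field (R : realType) := R * R -> R.
Definition vector_field (R : realType) := 'I_2 -> scalar_field R.
Definition tensor_field (R : realType) := 'I_2 -> 'I_2 -> scalar_field R.

Definition mu2 (R : realType) :
    {measure set (measurableTypeR R * measurableTypeR R) -> \bar R} :=
  (@lebesgue_measure R \x @lebesgue_measure R)%E.

(** * Domains *)

Definition unit_interval (R : realType) : set R := `[0, 1]%classic.

Definition is_domain (R : realType) (O : set (R * R)) : Prop :=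
  [/\ open O, connected O & O !=set0].

Definition path_connected (R : realType) (O : set (R * R)) : Prop :=
  forall a b, O a -> O b ->
  exists g : R -> R * R,
    [/\ {within @unit_interval R, continuous g},
        forall t, unit_interval t -> O (g t), g 0 = a & g 1 = b].

(* Every loop contracts to its base point, the base point being kept fixed;
   in [H (t, s)], t runs along the loop and s is the homotopy parameter. *)
Definition loops_contract (R : realType) (O : set (R * R)) : Prop :=
  forall g : R -> R * R,
    {within @unit_interval R, continuous g} ->
    (forall t, unit_interval t -> O (g t)) ->
    g 0 = g 1 ->
  exists H : R * R -> R * R,
    [/\ {within @unit_interval R `*` @unit_interval R, continuous H},
        forall t s, unit_interval t -> unit_interval s -> O (H (t, s)),
        forall t, unit_interval t -> H (t, 0) = g t,
        forall t, unit_interval t -> H (t, 1) = g 0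
      & forall s, unit_interval s -> H (0, s) = g 0 /\ H (1, s) = g 0].

Definition simply_connected (R : realType) (O : set (R * R)) : Prop :=
  path_connected O /\ loops_contract O.

(* Near each boundary point p, O is the strict epigraph of a Lipschitz
   function, in coordinates centred at p along the orthonormal frame
   (c, s), (- s, c). *)
Definition lipschitz_boundary (R : realType) (O : set (R * R)) : Prop :=
  forall p, (closure O `\` interior O) p ->
  exists c s r k : R, exists g : R -> R,
    [/\ c ^+ 2 + s ^+ 2 = 1, 0 < r, k.-lipschitz_setT g &
        forall x, ball p r x ->
          let y1 := c * (x.1 - p.1) + s * (x.2 - p.2) in
          let y2 := - s * (x.1 - p.1) + c * (x.2 - p.2) in
          O x <-> g y1 < y2].

(** * Test functions *)

Definition basis_vec (R : realType) (i : 'I_2) : R * R :=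
  if i == ord0 then (1, 0) else (0, 1).

Definition partial (R : realType) (i : 'I_2) (f : scalar_field R) :
    scalar_field R :=
  fun x => 'D_(basis_vec R i) f x.

Definition smooth (R : realType) (f : scalar_field R) : Prop :=
  forall (s : seq 'I_2) x, differentiable (foldr (@partial R) f s) x.

Definition supp (R : realType) (f : scalar_field R) : set (R * R) :=
  closure [set x | f x != 0].

Definition test_fun (R : realType) (phi : scalar_field R) : Prop :=
  smooth phi /\ compact (supp phi).

Definition laplacian (R : realType) (phi : scalar_field R) : scalar_field R :=
  fun x => \sum_i partial i (partial i phi) x.

Definition sym_grad (R : realType) (u : vector_field R) : tensor_field R :=
  fun i j x => 2^-1 * (partial j (u i) x + partial i (u j) x).

(** * Distributions *)

(* Only the values on test functions matter: compare with [dist_eq]. All the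
   functionals used below are built from locally integrable functions. *)
Definition functional (R : realType) := scalar_field R -> R.

Definition dist_eq (R : realType) (T S : functional R) : Prop :=
  forall phi, test_fun phi -> T phi = S phi.

Definition loc_integrable (R : realType) (f : scalar_field R) : Prop :=
  forall K : set (R * R), compact K -> (mu2 R).-integrable K (EFin \o f).

Definition dist_of (R : realType) (f : scalar_field R) : functional R :=
  fun phi => \int[mu2 R]_x (f x * phi x).

Definition dist_zero (R : realType) : functional R := fun=> 0.

Definition dist_add (R : realType) (T S : functional R) : functional R :=
  fun phi => T phi + S phi.

Definition dist_scale (R : realType) (a : R) (T : functional R) :
    functional R :=
  fun phi => a * T phi.

Definition dist_partial (R : realType) (i : 'I_2) (T : functional R) :
    functional R :=
  fun phi => - T (partial i phi).

Definition dist_supp (R : realType) (T : functional R) : set (R * R) :=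
  [set x | forall U : set (R * R), open U -> U x ->
     exists phi, [/\ test_fun phi, supp phi `<=` U & T phi != 0]].

(* An L^2 field on O may be nonzero up to the boundary of O, and its closed
   support then meets that boundary: "supported within O" refers to the
   closure of O. *)
Definition supported_within (R : realType) (O : set (R * R))
    (T : functional R) : Prop :=
  dist_supp T `<=` closure O.

Definition compactly_supported_within (R : realType) (O : set (R * R))
    (T : functional R) : Prop :=
  compact (dist_supp T) /\ supported_within O T.

Definition dist_grad (R : realType) (psi : scalar_field R) (i : 'I_2) :
    functional R :=
  dist_partial i (dist_of psi).

Definition dist_sym_grad (R : realType) (u : vector_field R) (i j : 'I_2) :
    functional R :=
  dist_scale 2^-1 (dist_add (dist_partial j (dist_of (u i)))
                            (dist_partial i (dist_of (u j)))).

Definition dist_div (R : realType) (f : tensor_field R) (i : 'I_2) :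
    functional R :=
  fun phi => \sum_j dist_partial j (dist_of (f i j)) phi.

Definition div_free (R : realType) (f : tensor_field R) : Prop :=
  forall i, dist_eq (dist_div f i) (@dist_zero R).

(* (d^perp)^2: the diagonal entries are d_2 d_2 and d_1 d_1, the off-diagonal
   ones - d_1 d_2. *)
Definition dist_perp2 (R : realType) (psi : scalar_field R) (i j : 'I_2) :
    functional R :=
  dist_scale ((-1) ^+ (i + j))
    (dist_partial (rev_ord i) (dist_partial (rev_ord j) (dist_of psi))).

(** * Function spaces *)

Definition L2 (R : realType) (f : scalar_field R) : Prop :=
  f \in Lfun (mu2 R) 2%:E.

Definition zero_ext (R : realType) (O : set (R * R)) (f : tensor_field R) :
    tensor_field R :=
  fun i j => f i j \_ O.

Definition L2sym (R : realType) (O : set (R * R)) (f : tensor_field R) : Prop :=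
  (forall i j, L2 (zero_ext O f i j)) /\
  {ae mu2 R, forall x, O x -> forall i j, f i j x = f j i x}.

Definition tensor_ae_eq (R : realType) (f g : tensor_field R) : Prop :=
  {ae mu2 R, forall x, forall i j, f i j x = g i j x}.

(* Closure of the test fields in the norm |du|_{L^2}. The elements of this space
   are classes: u and v are the same element when d(u - v) = 0. *)
Definition Hdot1_0 (R : realType) (u : vector_field R) : Prop :=
  (forall i, loc_integrable (u i)) /\
  exists du : tensor_field R,
    [/\ forall i j, L2 (du i j),
        forall i j, dist_eq (dist_of (du i j)) (dist_sym_grad u i j) &
        exists2 phi : nat -> vector_field R,
          forall n i, test_fun (phi n i) &
          (\int[mu2 R]_x
             (\sum_i \sum_j (sym_grad (phi n) i j x - du i j x) ^+ 2)%:E)%E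
            @[n --> \oo] --> 0%E].

Definition Hdot1_eq (R : realType) (u v : vector_field R) : Prop :=
  forall i j, dist_eq (dist_sym_grad u i j) (dist_sym_grad v i j).

(* Closure of the test functions in the norm |Lap psi|_{L^2}. On test functions
   this norm is the L^2 norm of the full Hessian, so the limits have their
   Hessian in L^2; requiring this keeps harmonic functions other than affine
   ones from counting as limits of 0. *)
Definition Hdot2_0 (R : realType) (psi : scalar_field R) : Prop :=
  loc_integrable psi /\
  exists h : tensor_field R,
    [/\ forall i j, L2 (h i j),
        forall i j, dist_eq (dist_of (h i j))
                            (dist_partial i (dist_partial j (dist_of psi))) &
        exists2 phi : nat -> scalar_field R,
          forall n, test_fun (phi n) &
          (\int[mu2 R]_x ((laplacian (phi n) x - \sum_i h i i x) ^+ 2)%:E)%E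
            @[n --> \oo] --> 0%E].

(** * Elasticity *)

Inductive plane_condition := PlaneStrain | PlaneStress.

Definition bulk_ratio (R : realType) (pc : plane_condition) (nu : R) : R :=
  match pc with
  | PlaneStrain => nu / (1 - 2 * nu)
  | PlaneStress => nu / (1 - nu)
  end.

Definition elasticity_tensor (R : realType) (pc : plane_condition) (E nu : R)
    (i j k l : 'I_2) : R :=
  E / (1 + nu) *
    (bulk_ratio pc nu * ((i == j)%:R * (k == l)%:R) +
     2^-1 * ((i == k)%:R * (j == l)%:R + (i == l)%:R * (j == k)%:R)).

(* The constants for which the elasticity tensor and 1 / E are defined; this
   contains the physical range 0 < E, - 1 < nu < 1 / 2. *)
Definition admissible_constants (R : realType) (pc : plane_condition)
    (E nu : R) : Prop :=
  [/\ E != 0, 1 + nu != 0 &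
      match pc with
      | PlaneStrain => 1 - 2 * nu != 0
      | PlaneStress => 1 - nu != 0
      end].

Definition stress (R : realType) (pc : plane_condition) (E nu : R)
    (eps : tensor_field R) : tensor_field R :=
  fun i j x => \sum_k \sum_l elasticity_tensor pc E nu i j k l * eps k l x.

(* Equilibrium in O together with absence of traction on its boundary. *)
Definition traction_free_equilibrium (R : realType) (O : set (R * R))
    (sigma : tensor_field R) : Prop :=
  div_free (zero_ext O sigma).

(* f = dw + sf; w is determined as an element of Hdot1_0 only. *)
Definition helmholtz (R : realType) (f : tensor_field R) (w : vector_field R)
    (sf : tensor_field R) : Prop :=
  [/\ Hdot1_0 w, L2sym setT sf, div_free sf &
      forall i j,
        dist_eq (dist_of (f i j))
                (dist_add (dist_sym_grad w i j) (dist_of (sf i j)))].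

Definition airy_potential (R : realType) (O : set (R * R))
    (sigma : tensor_field R) (psi : scalar_field R) : Prop :=
  [/\ Hdot2_0 psi, supported_within O (dist_of psi) &
      forall i j, dist_eq (dist_of (sigma i j)) (dist_perp2 psi i j)].

(* Main.v *)
Require Import Defs.
From HB Require Import structures.
From mathcomp Require Import all_boot all_order all_algebra.
From mathcomp Require Import all_classical all_reals all_analysis.
Import Order.TTheory GRing.Theory Num.Theory.
Import numFieldNormedType.Exports.
Local Open Scope classical_set_scope.
Local Open Scope ring_scope.
From mathcomp Require Import measurable_realfun ring lra.
Set Implicit Arguments.
Unset Strict Implicit.
Unset Printing Implicit Defensive.

(** Airy's function psi must have the Hessian [h = tr(sigma) I - sigma].
    Integrating sigma_22 twice, and sigma_22 and sigma_12 once, from the left along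
    horizontal lines gives psi, g_1, g_2 with [d psi = g] and [d g = h], weakly, to the left
    of a vertical line lying beyond Omega.

    The point is that psi vanishes outside the closure of Omega. The value of psi, smoothed
    at a point z0 off that closure, is the integral of sigma_22 against a function [d_2 u_2], where
    the field u is a rigid rotation about z0 to one side of the horizontal ray issued from z0
    to the left, zero to the other side, and bends across that ray only. Were u smooth on
    Omega, its symmetric gradient would have vanishing components 11 and 12, and the integral
    would be zero by equilibrium. But u jumps across the opposite ray, by the rotation about
    z0. As Omega is simply connected and avoids z0, counting the crossings of that ray
    defines a function n on Omega, regular up to the Lipschitz boundary, such that
    adding n times the rotation removes the jump.

    Mollification then puts psi and g in the homogeneous spaces; Hooke's law reads
    [eps = c h + k sigma], with constants c and k, whence omega = c d psi and seps = k sigma.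
    Symmetric gradients in the closure of the test fields are orthogonal to the symmetric
    divergence-free fields, whence uniqueness. *)

(** [sigma] is merely square-integrable and the boundary merely Lipschitz, so path integrals of
    [sigma] and boundary traces make no sense. Identities are therefore moved by Fubini to test
    functions: the transpose of integrating [sigma] from the left is integrating a test function to
    the right. Absence of traction means that equilibrium, extended by zero, holds against every
    test field, whatever its boundary values. A field is thus admissible once it coincides on Omega
    with a test field; hence the need for n to be regular up to the boundary.

    The mollifier is adapted to this: a product of two copies of eta, the second derivative of a
    smoothed positive part. Two integrations along the first axis restore that positive part, and
    the product becomes exactly d_2 u_2 for a field glued from fields (f(x_2), (z0_1 - x_1)
    f'(x_2)). Such a field has no strain component 11 or 12, whatever f is, and f = k (x_2 - z0_2)
    gives the rotations about z0.

    Integrating over a finite length keeps the kernels integrable; the region on the right where the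
    equations then fail is discarded by restricting the result to the closure of Omega. *)

Lemma ballE (R : realType) (p x : R * R) r :
  ball p r x <-> `|p.1 - x.1| < r /\ `|p.2 - x.2| < r.
Proof. by split; case. Qed.

Lemma open_ballP (R : realType) (O : set (R * R)) p :
  open O -> O p -> exists2 r, 0 < r & ball p r `<=` O.
Proof.
rewrite openE => oO /oO /nbhs_ballP[r /= r0 rO]; by exists r.
Qed.

(** * Locally additive functions on pairs of points *)

Section chains.
Context {R : realType}.
Implicit Types (O : set (R * R)) (c : R * R -> R * R -> R).

(** The discrete counterpart of a closed 1-form. Values on pairs of points that share no ball inside
    [O] are arbitrary, so only sums over short steps are meaningful. *)
Definition local_cocycle O c := forall p r, ball p r `<=` O ->
  forall x y z, ball p r x -> ball p r y -> ball p r z -> c x y + c y z = c x z.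

Definition adjacent O : rel (R * R) := fun x y =>
  `[< exists p r, [/\ ball p r `<=` O, ball p r x & ball p r y] >].

Fixpoint chain_sum c (a : R * R) (s : seq (R * R)) : R :=
  if s is b :: s' then c a b + chain_sum c b s' else 0.

Lemma chain_sum_cat c a s t :
  chain_sum c a (s ++ t) = chain_sum c a s + chain_sum c (last a s) t.
Proof. by elim: s a => [|b s IH] a /=; rewrite ?add0r// IH addrA. Qed.

Lemma chain_sumE c a s : chain_sum c a s =
  \sum_(0 <= k < size s) c (nth a (a :: s) k) (nth a (a :: s) k.+1).
Proof.
elim: s a => [|b s IH] a /=; first by rewrite big_geq.
rewrite big_nat_recl//= IH; congr (_ + _).
apply: eq_big_nat => k /andP[_ ks]; congr (c _ _); apply: set_nth_default => //=.
exact: ltnW.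
Qed.

Lemma adjacent_sym O : symmetric (adjacent O).
Proof. by move=> x y; apply/asboolP/asboolP => -[p [r [? ? ?]]]; exists p, r. Qed.

Variables (O : set (R * R)) (c : R * R -> R * R -> R).
Hypothesis cO : local_cocycle O c.

Lemma cocycle_refl x p r : ball p r `<=` O -> ball p r x -> c x x = 0.
Proof. by move=> BO Bx; have := cO BO Bx Bx Bx => /eqP; rewrite -subr_eq0 addrK => /eqP. Qed.

Lemma cocycle_anti x y : adjacent O x y -> c y x = - c x y.
Proof.
move=> /asboolP[p [r [BO Bx By]]]; apply/eqP; rewrite -addr_eq0 (cO BO By Bx By).
exact/eqP/(cocycle_refl BO).
Qed.

Lemma chain_sum_rev a s : path (adjacent O) a s ->
  chain_sum c (last a s) (rev (belast a s)) = - chain_sum c a s.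
Proof.
elim: s a => [|b s IH] a /=; first by rewrite oppr0.
move=> /andP[ab bs]; rewrite rev_cons -cats1 chain_sum_cat IH// opprD addrC.
congr (_ + _); rewrite /= addr0 -(cocycle_anti ab); congr c.
case: s {IH bs} => [|d s] //=; by rewrite rev_cons last_rcons.
Qed.

Definition clamp (u : R) : R := Num.min 1 (Num.max 0 u).

Lemma clamp_id u : 0 <= u <= 1 -> clamp u = u.
Proof. by move=> /andP[u0 u1]; rewrite /clamp max_r// min_r. Qed.

Lemma clamp_le0 u : u <= 0 -> clamp u = 0.
Proof. by move=> u0; rewrite /clamp max_l// min_r. Qed.

Lemma clamp_ge1 u : 1 <= u -> clamp u = 1.
Proof. by move=> u1; rewrite /clamp max_r ?min_l// (le_trans _ u1). Qed.

Lemma continuous_clamp : continuous clamp.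
Proof.
move=> u; apply: continuous_min; first exact: cst_continuous.
by apply: continuous_max; [exact: cst_continuous|].
Qed.

(** Each increment is clamped separately, so continuity is that of a finite sum, without gluing of
    pieces; the vertex [x k] is reached at time [k / N]. *)
Definition polyline (x : nat -> R * R) (N : nat) (t : R) : R * R :=
  x 0%N + \sum_(0 <= k < N) clamp (N%:R * t - k%:R) *: (x k.+1 - x k).

Lemma continuous_polyline x N : continuous (polyline x N).
Proof.
move=> t; apply: continuousD; first exact: cst_continuous.
apply: cvg_big => [|k _]; first by move=> /= z; exact: add_continuous.
have cl : continuous (fun u : R => clamp (N%:R * u - k%:R)).
  move=> u; apply: (@cvg_comp _ _ _ (fun u : R => N%:R * u - k%:R) clamp).
    by apply: cvgB; [exact: mulrl_continuous|exact: cvg_cst].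
  exact: continuous_clamp.
by apply: cvgZr_tmp; exact: cl.
Qed.

Lemma polylineE x N k t : (k < N)%N -> k%:R <= N%:R * t <= k.+1%:R ->
  polyline x N t = x k + (N%:R * t - k%:R) *: (x k.+1 - x k).
Proof.
move=> kN /andP[kt tk]; rewrite /polyline (big_cat_nat (n := k.+1))//=.
rewrite big_nat_recr//= [X in _ + (_ + _ + X)]big1_seq ?addr0; last first.
  move=> j; rewrite mem_index_iota => /andP[_ /andP[kj _]].
  rewrite clamp_le0 ?scale0r// subr_le0 (le_trans tk)// ler_nat//.
rewrite clamp_id ?subr_ge0 ?kt//=; last first.
  by rewrite lerBlDr (le_trans tk)// -natr1 addrC.
rewrite addrA; congr (_ + _).
rewrite (eq_big_nat _ _ (F2 := fun j => x j.+1 - x j)).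
  by rewrite telescope_sumr// addrCA subrr addr0.
move=> j /andP[_ jk]; rewrite clamp_ge1 ?scale1r//.
by rewrite lerBrDr (le_trans _ kt)// addrC natr1 ler_nat.
Qed.

Lemma ball_segment (p x y : R * R) r (t : R) : 0 <= t <= 1 ->
  ball p r x -> ball p r y -> ball p r (x + t *: (y - x)).
Proof.
have seg1 (a b d : R) : 0 <= t <= 1 -> `|a - b| < r -> `|a - d| < r ->
    `|a - (b + t * (d - b))| < r.
  move=> t01 ab ad.
  have -> : a - (b + t * (d - b)) = (1 - t) * (a - b) + t * (a - d) by ring.
  move: ab ad; set A := a - b; set B := a - d => Ar Br.
  have [->|t1] := eqVneq t 1; first by rewrite subrr mul0r mul1r add0r.
  have {t01} [t0 {}t1] : 0 <= t /\ 0 < 1 - t.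
    by case/andP: t01 => -> ?; rewrite subr_gt0 lt_neqAle t1.
  have := mulr_ge0 t0 (ltW (etrans (subr_gt0 _ _) Br)).
  have := mulr_gt0 t1 (etrans (subr_gt0 _ _) Ar).
  have := ler_normD ((1 - t) * A) (t * B).
  rewrite !normrM (ger0_norm t0) (gtr0_norm t1); nra.
by move=> t01 /ballE[x1 x2] /ballE[y1 y2]; apply/ballE; split; apply: seg1.
Qed.

Lemma telescope_cocycle (g : nat -> R * R) p r l : ball p r `<=` O ->
  (forall i, (i <= l)%N -> ball p r (g i)) ->
  \sum_(0 <= i < l) c (g i) (g i.+1) = c (g 0%N) (g l).
Proof.
move=> BO; elim: l => [|l IH] Bg.
  by rewrite big_geq// (cocycle_refl BO)//; exact: Bg.
rewrite big_nat_recr//= IH; last by move=> i il; apply: Bg; exact: leqW.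
by rewrite (cO BO)//; apply: Bg.
Qed.

(** In the near-covering form of compactness, a continuity radius [e] at [z] serves all centres
    within [e / 2] of [z] and all [d <= e / 2]. *)
Lemma lebesgue_number (K : set (R * R)) (f : R * R -> R * R) :
  compact K -> {within K, continuous f} -> open O -> (forall z, K z -> O (f z)) ->
  exists2 d : R, 0 < d & forall z, K z -> exists p r, ball p r `<=` O /\
    forall z', K z' -> ball z d z' -> ball p r (f z').
Proof.
move=> /compact_near_coveringP cK cf oO fO.
pose P (d : R) z := exists p r, ball p r `<=` O /\
    forall z', K z' -> ball z d z' -> ball p r (f z').
have : \forall d \near 0^'+, K `<=` P d.
  apply: cK => z Kz.
  have [r r0 rO] := open_ballP oO (fO _ Kz).
  move/subspace_continuousP : cf => /(_ z Kz) /cvg_ballP /(_ _ r0).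
  rewrite near_withinE => /nbhs_ballP[e /= e0 eB].
  have e20 : 0 < e / 2 by rewrite divr_gt0.
  near=> z' d => /=.
  exists (f z), r; split => // z'' Kz'' zz''; apply: eB => //.
  rewrite (splitr e); apply: (@ball_triangle _ _ z').
    by near: z'; exact: nbhsx_ballx.
  apply: le_ball zz''; near: d; exact: nbhs_right_le.
move=> PK; near (0:R)^'+ => d; exists d; first by near: d; exact: nbhs_right_gt.
by near: d.
Unshelve. all: by end_near. Qed.

Hypotheses (oO : open O) (lO : loops_contract O).

(** A discrete Stokes formula. The chain becomes a polygonal loop, which contracts in [O]. On a grid
    finer than a Lebesgue number of the contraction, additivity of [c] in each cell gives all rows
    the same sum, and the last row is constant. *)
Lemma chain_sum_closed a s : path (adjacent O) a s -> last a s = a ->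
  chain_sum c a s = 0.
Proof.
case: s => [//|b s0]; set s := b :: s0 => pas las.
pose N := size s; pose x := nth a (a :: s).
have N0 : (0 < N)%N by [].
have NR : 0 < N%:R :> R by rewrite ltr0n.
have adj k : (k < N)%N -> adjacent O (x k) (x k.+1).
  by move=> kN; move/(pathP a) : pas => /(_ k kN).
have xN : x N = a by rewrite /x /N -last_nth las.
pose g := polyline x N.
have gE k (t : R) : (k < N)%N -> k%:R <= N%:R * t <= k.+1%:R ->
    forall p r, ball p r (x k) -> ball p r (x k.+1) -> ball p r (g t).
  move=> kN kt p r xk xk1; rewrite /g (polylineE _ kN kt); apply: ball_segment => //.
  by move: kt; rewrite subr_ge0 lerBlDr -natr1 addrC.
have gx k : (k <= N)%N -> g (k%:R / N%:R) = x k.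
  move=> kN; have NkN : N%:R * (k%:R / N%:R) = k%:R :> R.
    by rewrite mulrC divfK// gt_eqF.
  case: k kN NkN => [_ NkN|k kN NkN].
    by rewrite /g (polylineE _ N0) NkN ?lexx ?ler01// subrr scale0r addr0.
  rewrite /g (polylineE _ kN) NkN ?lexx ?andbT ?ler_nat//.
  by rewrite -natr1 addrAC subrr add0r scale1r addrC subrK.
have itvk (t : R) : unit_interval t -> exists2 k, (k < N)%N & k%:R <= N%:R * t <= k.+1%:R.
  rewrite /unit_interval/= in_itv/= => /andP[t0 t1].
  have [->|tn1] := eqVneq t 1.
    by exists N.-1; rewrite ?prednK// mulr1 ler_nat leq_pred lexx.
  have Nt0 : 0 <= N%:R * t by rewrite mulr_ge0// ltW.
  exists (Num.truncn (N%:R * t)).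
    rewrite -(@ltr_nat R) (@le_lt_trans _ _ (N%:R * t)) ?truncn_le//.
    by rewrite -[ltRHS]mulr1 ltr_pM2l// lt_neqAle tn1.
  by have /andP[-> /ltW] := truncn_itv Nt0.
have gO (t : R) : unit_interval t -> O (g t).
  move=> /itvk[k kN kt].
  have /asboolP[p [r [BO xk xk1]]] := adj k kN.
  exact/BO/(gE k).
have g01 : g 0 = g 1.
  rewrite -[0](mul0r N%:R^-1) (gx 0%N)// -[1](@divff _ N%:R) ?lt0r_neq0//.
  by rewrite (gx N)// xN.
have cg : {within @unit_interval R, continuous g}.
  exact/continuous_subspaceT/continuous_polyline.
have [H [cH HO H0 H1 Hs]] := lO cg gO g01.
have [||d d0 leb] := lebesgue_number _ cH oO.
- by apply: compact_setX; exact: segment_compact.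
- by move=> [z1 z2] [/= I1 I2]; exact: HO.
(* The mesh [1 / M] is below [d], and [M] is a multiple of [N] so that the vertices of the loop are
   grid points. *)
pose m := (Num.truncn d^-1).+1.
pose M := (N * m)%N.
have M0 : 0 < M%:R :> R by rewrite ltr0n muln_gt0.
have Md : M%:R^-1 < d.
  rewrite invf_plt ?posrE// (lt_le_trans (truncnS_gt _))// ler_nat.
  by rewrite leq_pmull.
have IM i : (i <= M)%N -> @unit_interval R (i%:R / M%:R).
  by move=> iM; rewrite /unit_interval/= in_itv/= divr_ge0//= ler_pdivrMr// mul1r ler_nat.
pose h i j := H (i%:R / M%:R, j%:R / M%:R).
have cell i j : (i < M)%N -> (j < M)%N -> exists p r, [/\ ball p r `<=` O,
    ball p r (h i j), ball p r (h i.+1 j), ball p r (h i j.+1) & ball p r (h i.+1 j.+1)].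
  move=> iM jM; have [|p [r [BO Br]]] := leb (i%:R / M%:R, j%:R / M%:R).
    by split; apply: IM; exact: ltnW.
  have near1 k : `|k%:R / M%:R - k.+1%:R / M%:R| < d :> R.
    by rewrite -mulrBl -natr1 opprD addNKr mulN1r normrN gtr0_norm// invr_gt0.
  exists p, r; split => //; apply: Br; do ?[by split; apply: IM => //; exact: ltnW];
    by apply/ballE; rewrite /= ?subrr ?normr0.
pose T j := \sum_(0 <= i < M) c (h i j) (h i.+1 j).
(* The difference of two rows telescopes to the vertical edges at both ends, which coincide since
   [H] keeps the base point fixed. *)
have TS j : (j < M)%N -> T j = T j.+1.
  move=> jM; apply/eqP; rewrite -subr_eq0 -sumrB.
  rewrite (eq_big_nat _ _ (F2 := fun i => - c (h i.+1 j) (h i.+1 j.+1) - - c (h i j) (h i j.+1))).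
    rewrite (telescope_sumr (fun i => - c (h i j) (h i j.+1)))// /h !mul0r divff ?lt0r_neq0//.
    have [-> ->] := Hs _ (IM _ (ltnW jM)); have [-> ->] := Hs _ (IM _ jM).
    by rewrite subrr.
  move=> i /andP[_ iM]; have [p [r [BO B1 B2 B3 B4]]] := cell i j iM jM.
  have := cO BO B1 B2 B4; have := cO BO B1 B3 B4; lra.
have TM : T M = 0.
  rewrite /T big_nat_cond big1// => i; rewrite andbT => /andP[_ iM].
  rewrite /h divff ?lt0r_neq0// !H1; [|exact: IM..|exact: IM (ltnW _)].
  have /asboolP[p [r [BO x0 _]]] := adj 0%N N0.
  apply: (cocycle_refl BO (p := p)).
  by rewrite -[0](mul0r N%:R^-1) (gx 0%N).
have T0 : T 0%N = 0.
  have : forall j, (j <= M)%N -> T 0%N = T j.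
    by elim=> // j IH jM; rewrite IH ?(ltnW jM)// TS.
  by move=> /(_ _ (leqnn M)) ->.
rewrite chain_sumE; apply: etrans T0; rewrite /T -/N -/x.
(* Row 0 is compared with the chain one edge at a time: the grid points on an edge lie in a ball of
   [O] that contains both ends of that edge. *)
suff key k : (k <= N)%N -> \sum_(0 <= i < k) c (x i) (x i.+1) =
    \sum_(0 <= i < k * m) c (h i 0%N) (h i.+1 0%N).
  exact: (key N (leqnn _)).
elim: k => [_|k IH kN]; first by rewrite !big_geq.
rewrite big_nat_recr//= IH ?(ltnW kN)// mulSnr [in RHS](big_cat_nat (n := (k * m)%N))//= ?leq_addr//.
congr (_ + _).
have hg i : (i <= M)%N -> h i 0%N = g (i%:R / M%:R).
  by move=> iM; rewrite /h mul0r H0//; exact: IM.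
have /asboolP[p [r [BO xk xk1]]] := adj k kN.
have kmM l : (l <= m)%N -> (k * m + l <= M)%N.
  move=> lm; rewrite (@leq_trans (k.+1 * m))// ?mulSnr ?leq_add2l//.
  by rewrite -mulSnr leq_mul2r kN orbT.
have NM (l : nat) : N%:R * (l%:R / M%:R) = l%:R / m%:R :> R.
  rewrite /M natrM; field; by rewrite ?lt0r_neq0// pnatr_eq0.
rewrite -[X in _ = \big[_/_]_(X <= _ < _) _](add0n (k * m)%N) big_addn addKn.
rewrite (eq_big_nat _ _ (F2 := fun i => c (h (k * m + i)%N 0%N) (h (k * m + i.+1)%N 0%N))).
  rewrite (telescope_cocycle (g := fun i => h (k * m + i)%N 0%N) BO).
    rewrite addn0 -mulSnr !hg; last 2 first.
      by rewrite mulSnr kmM.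
      by have := kmM 0%N isT; rewrite addn0.
    have mM j : (j * m)%:R / M%:R = j%:R / N%:R :> R.
      rewrite /M !natrM; field; by rewrite ?lt0r_neq0// pnatr_eq0.
    by rewrite !mM !gx// ltnW.
  move=> i im; rewrite hg ?kmM//; apply: (gE k) => //.
  rewrite NM natrD natrM mulrDl mulfK ?pnatr_eq0// lerDl divr_ge0//=.
  by rewrite -natr1 lerD2l ler_pdivrMr ?ltr0n// mul1r ler_nat.
by move=> i _; rewrite addnC addnS.
Qed.

Lemma open_adjacent x y r : ball x r `<=` O -> 0 < r -> ball x r y -> adjacent O x y.
Proof. by move=> BO r0 xy; apply/asboolP; exists x, r; split => //; exact: ballxx. Qed.

Lemma chain_connected a x : connected O -> O a -> O x ->
  exists s, path (adjacent O) a s /\ last a s = x.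
Proof.
move=> cnO Oa Ox; pose S x := exists s, path (adjacent O) a s /\ last a s = x.
have Sadj u v : S u -> adjacent O u v -> S v.
  move=> [s [ps ls]] uv; exists (rcons s v).
  by rewrite rcons_path last_rcons ps ls.
have ballS u : O u -> exists2 r, 0 < r & forall v, ball u r v -> O v /\ adjacent O u v.
  move=> Ou; have [r r0 BO] := open_ballP oO Ou; exists r => // v uv.
  by split; [exact: BO|exact: open_adjacent BO r0 uv].
suff OS : O `&` S = O by have [] : (O `&` S) x by rewrite OS.
apply: cnO.
- by exists a; split => //; exists [::].
- exists (O `&` S); last by rewrite setIA setIid.
  rewrite openE => u [Ou Su]; have [r r0 Br] := ballS u Ou.
  by apply/nbhs_ballP; exists r => // v /Br[Ov /(Sadj _ _ Su)].
- exists (~` (O `&` ~` S)).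
    apply: open_closedC; rewrite openE => u [Ou Su]; have [r r0 Br] := ballS u Ou.
    apply/nbhs_ballP; exists r => // v /Br[Ov uv]; split => // Sv.
    by apply: Su; apply: (Sadj v) => //; rewrite adjacent_sym.
  by apply/seteqP; split=> u [Ou Su]; split => //; [case|apply: contrapT => nSu; exact: Su].
Qed.

(** [n] is the sum of [c] along a chosen chain from a base point. For [x] and [y] in one ball, the
    chain to [x], the step to [y] and the reversed chain to [y] form a closed chain. *)
Lemma local_cocycle_primitive : connected O -> O !=set0 -> exists n : R * R -> R,
  forall p r, ball p r `<=` O -> forall x y, ball p r x -> ball p r y ->
  n y - n x = c x y.
Proof.
move=> cnO [a Oa].
pose ch x := if pselect (O x) is left Ox then sval (cid (chain_connected cnO Oa Ox)) else [::].
have chP x : O x -> path (adjacent O) a (ch x) /\ last a (ch x) = x.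
  by rewrite /ch; case: pselect => // Ox _; case: cid.
exists (fun x => chain_sum c a (ch x)) => p r BO x y Bx By.
have [px lx] := chP x (BO _ Bx); have [py ly] := chP y (BO _ By).
have xy : adjacent O x y by apply/asboolP; exists p, r.
have := @chain_sum_closed a (ch x ++ y :: rev (belast a (ch y))).
rewrite cat_path px lx/= xy chain_sum_cat lx/= last_cat/=.
have -> : path (adjacent O) y (rev (belast a (ch y))).
  by rewrite -{1}ly rev_path (eq_path (e' := adjacent O))// => u v; rewrite adjacent_sym.
have -> : last y (rev (belast a (ch y))) = a.
  case: (ch y) ly => [|b s] //=; by rewrite rev_cons last_rcons.
have -> : chain_sum c y (rev (belast a (ch y))) = - chain_sum c a (ch y).
  by rewrite -{1}ly chain_sum_rev.
by move=> /(_ isT erefl); lra.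
Qed.

End chains.

Lemma connected_locally_constant {R : realType} (T : Type) (A : set R) (F : R -> T) :
  connected A ->
  (forall t, A t -> exists2 r, 0 < r & forall s, A s -> `|t - s| < r -> F s = F t) ->
  forall s t, A s -> A t -> F s = F t.
Proof.
move=> cA lF s t As At.
pose rad (u : R) : R := if pselect (A u) is left Au then sval (cid2 (lF u Au)) else 1.
have radP u : A u -> 0 < rad u /\ forall v, A v -> `|u - v| < rad u -> F v = F u.
  by rewrite /rad; case: pselect => // Au _; case: cid2.
pose U (B : set R) := \bigcup_(u in A `&` B) ball u (rad u).
have oU B : open (U B) by apply: bigcup_open => u _; exact: ball_open.
have AU B : (forall u v, F u = F v -> B u -> B v) -> A `&` B = A `&` U B.
  move=> FB; apply/seteqP; split=> u [Au Bu]; split => //.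
    by exists u => //; apply: ballxx; have [] := radP u Au.
  case: Bu => v [Av Bv] vu; have [_ /(_ u Au vu)] := radP v Av.
  by move=> /esym/FB; exact.
pose B := [set u | F u = F t].
have FB (u v : R) : F u = F v -> B u -> B v by rewrite /B /= => ->.
suff AB : A `&` B = A by have [] : (A `&` B) s by rewrite AB.
apply: cA.
- by exists t.
- by exists (U B); [exact: oU|exact: AU].
- exists (~` U (~` B)); first exact: open_closedC.
  have := AU (~` B) (fun u v uv nBu Bv => nBu (FB v u (esym uv) Bv)).
  move=> /seteqP[s1 s2]; apply/seteqP; split=> u [Au Bu]; split => //.
    by move=> Uu; have [_] := s2 u (conj Au Uu).
  by apply: contrapT => nBu; apply: Bu; have [] := s1 u (conj Au nBu).
Qed.

(** * The sheets of the plane slit along a horizontal ray *)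

Lemma norm_between (R : realType) (a b t m : R) : a <= t -> t <= b -> `|a| <= m -> `|b| <= m ->
  `|t| <= m.
Proof.
move=> at_ tb; rewrite !ler_norml => /andP[ma _] /andP[_ bm].
by rewrite (le_trans ma)//= (le_trans tb).
Qed.

Section sheets.
Context {R : realType}.
Variable z0 : R * R.

(** The signed number of crossings of the ray from [z0] to the right. Additivity fails in a ball
    around [z0], where winding about [z0] is possible. *)
Definition ray_crossing (x y : R * R) : R :=
  if (z0.1 < x.1) && (z0.1 < y.1) then (z0.2 <= y.2)%R%:R - (z0.2 <= x.2)%R%:R else 0.

(** The first coordinate is read off the centre [p] instead of [x], so that within a ball around [p]
    avoiding [z0] the value changes across the right ray only. *)
Definition sheet_jump (p x : R * R) : R := if z0.1 < p.1 then (z0.2 <= x.2)%R%:R else 0.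

Lemma ball_one_side p d : ~ ball p d z0 ->
  [\/ forall x, ball p d x -> x.1 < z0.1, forall x, ball p d x -> z0.1 < x.1,
      forall x, ball p d x -> x.2 < z0.2 | forall x, ball p d x -> z0.2 < x.2].
Proof.
move=> /ballE/not_andP nb.
have aux (a b : R) : ~ `|a - b| < d ->
    (forall x, `|a - x| < d -> x < b) \/ (forall x, `|a - x| < d -> b < x).
  move=> /negP; rewrite -leNgt => dab; have [ab|ba] := lerP a b; [left|right] => x.
    by move: dab; rewrite ler0_norm ?subr_le0// ltr_norml => ? /andP[]; lra.
  by move: dab; rewrite gtr0_norm ?subr_gt0// ltr_norml => ? /andP[]; lra.
case: nb => /aux[] H; [constructor 1|constructor 2|constructor 3|constructor 4];
  by move=> x /ballE[? ?]; exact: H.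
Qed.

(** Balls are squares, so one that avoids [z0] lies in a half-plane bounded by a coordinate line
    through [z0]; the ray can be crossed only in the right half-plane. *)
Lemma ray_crossingE p d x y : ~ ball p d z0 -> ball p d x -> ball p d y ->
  ray_crossing x y = sheet_jump p y - sheet_jump p x.
Proof.
move=> nb Bx By; rewrite /ray_crossing /sheet_jump.
have Bp : ball p d p.
  case/ballE : Bx => x1 _; apply/ballE; rewrite !subrr normr0.
  by rewrite (le_lt_trans _ x1).
have [H|H|H|H] := ball_one_side nb; have Hx := H x Bx; have Hy := H y By; have Hp := H p Bp.
- by rewrite (lt_gtF Hx) (lt_gtF Hp)/= subrr.
- by rewrite Hx Hy Hp.
- by rewrite !(leNgt z0.2) Hx Hy/= !subrr !if_same.
- by rewrite (ltW Hx) (ltW Hy) !subrr !if_same.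
Qed.

(** [n] is a primitive of minus the crossing number, so [n] plus the jump is locally constant on
    [O]. At a boundary point it must be constant on the whole intersection of [O] with some ball;
    that intersection might be disconnected, and the Lipschitz epigraph is what provides connecting
    paths. *)
Lemma sheet_function (O : set (R * R)) : is_domain O -> simply_connected O ->
  lipschitz_boundary O -> ~ O z0 ->
  exists n : R * R -> R, forall p, closure O p -> p <> z0 ->
  exists d k, 0 < d /\ forall x, O x -> ball p d x -> n x = k - sheet_jump p x.
Proof.
move=> [oO cO neO] [_ lO] lipO Oz0.
have coc : local_cocycle O (fun x y => - ray_crossing x y).
  move=> p r BO x y z Bx By Bz.
  have nb : ~ ball p r z0 by move/BO.
  by rewrite !(ray_crossingE nb)//; lra.
have [n nE] := local_cocycle_primitive coc oO lO cO neO.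
exists n => p Op /eqP pz0.
have [r1 r10 nb] : exists2 r1, 0 < r1 & ~ ball p r1 z0.
  exists (Num.max `|p.1 - z0.1| `|p.2 - z0.2|).
    rewrite lt_max !normr_gt0 !subr_eq0 -negb_and.
    by apply: contra pz0; rewrite -xpair_eqE -!surjective_pairing.
  by move=> /ballE[]; rewrite !lt_max !ltxx/= orbF => /lt_trans/[apply]; rewrite ltxx.
pose f x := n x + sheet_jump p x.
have fE x y q r : ball q r `<=` O -> ball q r x -> ball q r y ->
    ball p r1 x -> ball p r1 y -> f x = f y.
  move=> BO xq yq xp yp; rewrite /f; have := nE q r BO x y xq yq.
  by rewrite (ray_crossingE nb)//; lra.
suff [d d0 dP] : exists2 d, 0 < d & forall x y, O x -> O y -> ball p d x -> ball p d y -> f x = f y.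
  have [y [Oy yp]] : O `&` ball p d !=set0 by exact/Op/nbhsx_ballx.
  exists d, (f y); split => // x Ox xp.
  by rewrite -(dP x)// /f addrK.
have [/(open_ballP oO)[r r0 BO]|nOp] := pselect (O p).
  exists (Num.min r r1); first by rewrite lt_min r0.
  move=> x y _ _ Bx By.
  have [le1 le2] : Num.min r r1 <= r /\ Num.min r r1 <= r1.
    by rewrite !ge_min !lexx orbT.
  apply: (fE x y p r) => //.
  - exact: le_ball le1 _ Bx.
  - exact: le_ball le1 _ By.
  - exact: le_ball le2 _ Bx.
  - exact: le_ball le2 _ By.
have [|c [s [r [k [g [cs r0 lg gO]]]]]] := lipO p.
  by split => // /interior_subset.
pose Phi (a b : R) : R * R := (p.1 + (c * a - s * b), p.2 + (s * a + c * b)).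
pose rho := Num.min r r1.
have rho0 : 0 < rho by rewrite lt_min r0.
have [rhor rhor1] : rho <= r /\ rho <= r1 by rewrite !ge_min !lexx orbT.
have c1 : `|c| <= 1 by rewrite ler_norml; apply/andP; split; nra.
have s1 : `|s| <= 1 by rewrite ler_norml; apply/andP; split; nra.
have rot (a b u v : R) : `|u| <= 1 -> `|v| <= 1 -> `|u * a + v * b| <= `|a| + `|b|.
  move=> u1 v1; rewrite (le_trans (ler_normD _ _))// !normrM lerD// ler_piMl//.
have PhiD a b a' b' e : `|a - a'| + `|b - b'| < e -> ball (Phi a b) e (Phi a' b').
  move=> abe; apply/ballE; rewrite /Phi/=; split; apply: le_lt_trans abe.
    rewrite (_ : _ - _ = c * (a - a') + (- s) * (b - b')); last by ring.
    by apply: rot => //; rewrite normrN.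
  rewrite (_ : _ - _ = s * (a - a') + c * (b - b')); last by ring.
  exact: rot.
have Phi0 : Phi 0 0 = p by rewrite /Phi !mulr0 subrr addr0 !addr0; case: (p).
have PhiB a b : `|a| + `|b| < rho -> ball p rho (Phi a b).
  by move=> ab; rewrite -Phi0; apply: PhiD; rewrite !sub0r !normrN.
have PhiO a b : `|a| + `|b| < rho -> g a < b -> O (Phi a b).
  move=> ab gab; apply/gO; first exact: le_ball rhor _ (PhiB _ _ ab).
  rewrite /Phi/=.
  rewrite (_ : c * _ + _ = (c ^+ 2 + s ^+ 2) * a); last by ring.
  rewrite (_ : - s * _ + _ = (c ^+ 2 + s ^+ 2) * b); last by ring.
  by rewrite cs !mul1r.
have loc a b : `|a| + `|b| < rho -> g a < b -> exists2 e, 0 < e &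
    forall a' b', `|a'| + `|b'| < rho -> g a' < b' -> `|a - a'| < e -> `|b - b'| < e ->
    f (Phi a' b') = f (Phi a b).
  move=> ab gab; have [e e0 BO] := open_ballP oO (PhiO _ _ ab gab).
  exists (e / 2); first by rewrite divr_gt0.
  move=> a' b' ab' gab' aa bb; apply: (fE _ _ _ _ BO).
  - by apply: PhiD; rewrite (splitr e) ltrD.
  - exact: ballxx.
  - exact: le_ball rhor1 _ (PhiB _ _ ab').
  - exact: le_ball rhor1 _ (PhiB _ _ ab).
pose K := `|k|.
have K0 : 0 <= K by exact: normr_ge0.
(* In a ball of radius [d] the frame coordinates are at most [2 * d], so two abscissas differ by at
   most [4 * d] and the values of [g] by at most [4 * K * d]. Hence the height [h] is above the
   graph between two points of [O], and [2 * d + h < rho] keeps the paths inside the chart. *)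
pose d := rho / (5 + 4 * K).
have d0 : 0 < d by rewrite divr_gt0//; lra.
have dE : (5 + 4 * K) * d = rho by rewrite /d mulrC divfK// gt_eqF//; lra.
pose h := 2 * d + 4 * K * d.
have h0 : 0 <= h by rewrite /h; clear -K0 d0; nra.
have lip a b : g a <= g b + K * `|a - b|.
  have := lg (a, b) (conj I I) => /= /ler_normlW.
  have : k * `|a - b| <= K * `|a - b| by rewrite ler_wpM2r// ler_norm.
  lra.
(* Two points are joined inside [O] by going up to height [h], across, and down again. *)
have vert a b : `|a| <= 2 * d -> `|b| <= 2 * d -> g a < b -> f (Phi a b) = f (Phi a h).
  move=> ad bd gab.
  have bh : b <= h by rewrite (le_trans (ler_norm _))// (le_trans bd)// /h lerDl; clear -K0 d0; nra.
  apply: (@connected_locally_constant _ _ `[b, h]%classic (fun t => f (Phi a t))).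
  - exact: segment_connected.
  - have good t : `[b, h]%classic t -> `|a| + `|t| < rho /\ g a < t.
      rewrite /= in_itv/= => /andP[bt th]; split; last exact: lt_le_trans bt.
      have : `|t| <= h.
        rewrite ler_norml th andbT (le_trans _ bt)//.
        by move: bd; rewrite ler_norml /h => /andP[+ _]; clear -K0 d0; nra.
      by move: ad; rewrite -dE /h; clear -K0 d0; nra.
    move=> t /good[at_ gt]; have [e e0 eP] := loc a t at_ gt.
    exists e => // t' /good[at' gt'] tt'; apply: eP => //.
    by rewrite subrr normr0.
  - by rewrite /= in_itv/= lexx.
  - by rewrite /= in_itv/= lexx bh.
exists d => // x y Ox Oy xp yp.
pose co (x : R * R) : R * R := (c * (x.1 - p.1) + s * (x.2 - p.2),
                                - s * (x.1 - p.1) + c * (x.2 - p.2)).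
have coP z : O z -> ball p d z -> [/\ Phi (co z).1 (co z).2 = z, `|(co z).1| <= 2 * d,
    `|(co z).2| <= 2 * d & g (co z).1 < (co z).2].
  move=> Oz zp; have /ballE[z1 z2] := zp; split.
  - rewrite /Phi /co/= [RHS]surjective_pairing; congr pair.
      by transitivity (p.1 + (c ^+ 2 + s ^+ 2) * (z.1 - p.1)); [ring|rewrite cs; ring].
    by transitivity (p.2 + (c ^+ 2 + s ^+ 2) * (z.2 - p.2)); [ring|rewrite cs; ring].
  - apply: le_trans (rot _ _ _ _ c1 s1) _; rewrite ![`|_ - p.1|]distrC ![`|_ - p.2|]distrC.
    by clear -z1 z2; lra.
  - apply: le_trans (rot _ _ _ _ _ c1) _; first by rewrite normrN.
    by rewrite ![`|_ - p.1|]distrC ![`|_ - p.2|]distrC; clear -z1 z2; lra.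
  - apply: (gO z _).1 => //; apply: le_ball zp; rewrite (le_trans _ rhor)// -dE.
    by clear -K0 d0; nra.
have [xE x1 x2 gx] := coP x Ox xp; have [yE y1 y2 gy] := coP y Oy yp.
rewrite -xE -yE (vert (co x).1 (co x).2)// (vert (co y).1 (co y).2)//.
have hor (a b : R) : `|a| <= 2 * d -> `|b| <= 2 * d -> a <= b ->
    (exists u, [/\ `|u| <= 2 * d & g a < u]) -> f (Phi a h) = f (Phi b h).
  move=> ad bd ab [u [ud gau]].
  apply: (@connected_locally_constant _ _ `[a, b]%classic (fun t => f (Phi t h))).
  - exact: segment_connected.
  - have good t : `[a, b]%classic t -> `|t| + `|h| < rho /\ g t < h.
      rewrite /= in_itv/= => /andP[at_ tb].
      have td : `|t| <= 2 * d by apply: norm_between at_ tb ad bd.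
      split; first by rewrite (ger0_norm h0) -dE /h; clear -td d0; nra.
      have ta : K * (t - a) <= K * (4 * d).
        rewrite ler_wpM2l//; move: ad td; rewrite !ler_norml => /andP[a1 a2] /andP[t1 t2].
        by clear -a1 a2 t1 t2; lra.
      have u2 : u <= 2 * d := le_trans (ler_norm u) ud.
      have := lip t a; rewrite ger0_norm ?subr_ge0// => gta.
      by rewrite /h; clear -ta gau u2 gta; lra.
    move=> t /good[at_ gt]; have [e e0 eP] := loc t h at_ gt.
    exists e => // t' /good[at' gt'] tt'; apply: eP => //.
    by rewrite subrr normr0.
  - by rewrite /= in_itv/= lexx.
  - by rewrite /= in_itv/= lexx ab.
have [xy|/ltW yx] := lerP (co x).1 (co y).1; first by apply: hor => //; exists (co x).2.
by apply/esym/hor => //; exists (co y).2.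
Qed.

End sheets.

(** * Smooth functions of two variables *)

Section differentials.
Context {R : realType}.
Implicit Types (f g : scalar_field R) (z h : R * R).

(** Existence of partial derivatives does not give differentiability; one first-order estimate
    yields it together with the values of both partials. *)
Lemma differentiable_affine_bound f z (a b : R) :
  (forall e, 0 < e -> \forall h \near (0 : R * R),
     `|f (h + z) - f z - (h.1 * a + h.2 * b)| <= e * `|h|) ->
  [/\ differentiable f z, partial ord0 f z = a & partial ord_max f z = b].
Proof.
move=> fab; pose L h := h.1 * a + h.2 * b.
have L_lin : linear L.
  move=> k [u1 u2] [v1 v2]; rewrite /L/= /GRing.scale/=; ring.
pose LM := GRing.isLinear.Build _ _ _ _ _ L_lin.
pose LL : {linear (R * R)%type -> R} := HB.pack L LM.
have L_cont : continuous (LL : R * R -> R).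
  have c1 : continuous (fst : R * R -> R) by move=> u; apply: cvg_fst.
have c2 : continuous (snd : R * R -> R) by move=> u; apply: cvg_snd.
move=> u; apply: (@continuousD _ _ _ (fun h : R * R => h.1 * a) (fun h => h.2 * b)).
  by apply: (@continuousM _ _ (fst : R * R -> R) (cst a)); [exact: c1|exact: cst_continuous].
by apply: (@continuousM _ _ (snd : R * R -> R) (cst b)); [exact: c2|exact: cst_continuous].
have ee : f \o shift z = cst (f z) + LL +o_ (0 : R * R) id.
  apply/eqaddoP => e e0; apply: filterS (fab e e0) => h.
  by rewrite /= !fctE/= (opprD (f z)) addrA.
have dE := diff_unique L_cont ee.
have df : differentiable f z.
  by apply/diff_locallyP; rewrite dE; split.
split=> //; rewrite /partial deriveE// dE /LL/= /L/=.
  by rewrite mul1r mul0r addr0.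
by rewrite mul1r mul0r add0r.
Qed.

Lemma differentiable_cont f : (forall x, differentiable f x) -> continuous f.
Proof. by move=> df x; exact: differentiable_continuous. Qed.

Lemma partialD i f g x : differentiable f x -> differentiable g x ->
  partial i (fun y => f y + g y) x = partial i f x + partial i g x.
Proof. by move=> df dg; rewrite /partial -deriveD//; exact: diff_derivable. Qed.

Lemma partialM i f g x : differentiable f x -> differentiable g x ->
  partial i (fun y => f y * g y) x = partial i f x * g x + f x * partial i g x.
Proof.
move=> df dg; have df' : derivable f x (basis_vec R i) by exact: diff_derivable.
have dg' : derivable g x (basis_vec R i) by exact: diff_derivable.
have := deriveM df' dg'; rewrite /GRing.scale/= /partial => ->.
by rewrite addrC ['D__ f x * _]mulrC.
Qed.

Lemma partial_cst i (k : R) x : partial i (fun=> k) x = 0.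
Proof. exact: derive_cst. Qed.

Lemma differentiable_const (k : R) x : differentiable (cst k : R * R -> R) x.
Proof. exact: (@differentiable_cst _ (R * R)%type). Qed.

Lemma partialZ i (k : R) f x : differentiable f x ->
  partial i (fun y => k * f y) x = k * partial i f x.
Proof.
move=> df; rewrite partialM//.
by rewrite partial_cst mul0r add0r.
Qed.

Lemma partial_near i f g x : {near x, f =1 g} -> partial i f x = partial i g x.
Proof. by move=> fg; apply: near_eq_derive. Qed.

(** [smooth] quantifies over words of partial derivatives, which suits products badly; with the
    order bounded, the Leibniz rule goes through by induction. *)
Fixpoint Ck (n : nat) f : Prop :=
  (forall x, differentiable f x) /\
  if n is m.+1 then forall i, Ck m (partial i f) else True.

Lemma Ck_differentiable n f x : Ck n f -> differentiable f x.
Proof. by case: n => [|n] []. Qed.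

Lemma CkW n f : Ck n.+1 f -> Ck n f.
Proof.
elim: n f => [|n IH] f [df pf]; split => // i; exact/IH/pf.
Qed.

Lemma smooth_CkP f : smooth f <-> forall n, Ck n f.
Proof.
split=> [sf n|Cf s].
  elim: n f sf => [|n IH] f sf; split => //; do ?exact: (sf [::]).
  by move=> i; apply: IH => s x; have := sf (rcons s i) x; rewrite foldr_rcons.
move=> x; have [n] : exists n, (size s <= n)%N by exists (size s).
move: (Cf n) => {Cf}.
elim: n f s => [|n IH] f s Cf.
  by rewrite leqn0 => /eqP/size0nil ->; exact: Ck_differentiable Cf.
case: (lastP s) => [|{}s i] sn; first exact: Ck_differentiable Cf.
rewrite foldr_rcons; apply: IH; first by case: Cf => _ /(_ i).
by rewrite size_rcons in sn.
Qed.

Lemma smooth_differentiable f x : smooth f -> differentiable f x.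
Proof. by move=> /(_ [::] x). Qed.

Lemma smooth_partial i f : smooth f -> smooth (partial i f).
Proof. by move=> sf s x; have := sf (rcons s i) x; rewrite foldr_rcons. Qed.

Lemma smooth_continuous f : smooth f -> continuous f.
Proof. by move=> sf; apply: differentiable_cont => x; exact: smooth_differentiable. Qed.

Lemma smooth_cst (k : R) : smooth (fun=> k).
Proof.
have p0 (l : R) i : partial i (fun=> l) = (fun=> 0).
  by apply/funext => x; rewrite partial_cst.
apply/smooth_CkP => n; elim: n k => [|n IH] k; split => // *;
  by rewrite ?p0//; exact: differentiable_const.
Qed.

Lemma CkD n f g : Ck n f -> Ck n g -> Ck n (fun x => f x + g x).
Proof.
elim: n f g => [|n IH] f g [df pf] [dg pg]; split=> //;
  do ?[by move=> x; exact: differentiableD].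
move=> i; rewrite (_ : partial i _ = fun x => partial i f x + partial i g x).
  by apply: IH; [exact: pf|exact: pg].
by apply/funext => x; rewrite partialD.
Qed.

Lemma CkM n f g : Ck n f -> Ck n g -> Ck n (fun x => f x * g x).
Proof.
elim: n f g => [|n IH] f g Cf Cg; have [df pf] := Cf; have [dg pg] := Cg;
  split=> //; do ?[by move=> x; exact: differentiableM].
move=> i; rewrite (_ : partial i _ = fun x => partial i f x * g x + f x * partial i g x).
  by apply: CkD; apply: IH; do ?[exact: CkW|exact: pf|exact: pg].
by apply/funext => x; rewrite partialM.
Qed.

Lemma smoothD f g : smooth f -> smooth g -> smooth (fun x => f x + g x).
Proof. by move=> /smooth_CkP sf /smooth_CkP sg; apply/smooth_CkP => n; exact: CkD. Qed.

Lemma smoothM f g : smooth f -> smooth g -> smooth (fun x => f x * g x).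
Proof. by move=> /smooth_CkP sf /smooth_CkP sg; apply/smooth_CkP => n; exact: CkM. Qed.

Lemma smoothZ (k : R) f : smooth f -> smooth (fun x => k * f x).
Proof. exact/smoothM/smooth_cst. Qed.

Lemma smoothB f g : smooth f -> smooth g -> smooth (fun x => f x - g x).
Proof.
move=> sf /(smoothZ (-1)) sg; have := smoothD sf sg.
by congr smooth; apply/funext => x; rewrite mulN1r.
Qed.

End differentials.

(** * Test functions *)

Section test_functions.
Context {R : realType}.
Implicit Types (f g : scalar_field R) (z h : R * R).

Lemma supp_neq0 f x : f x != 0 -> supp f x.
Proof. by move=> fx; exact: subset_closure. Qed.

Lemma not_supp f x : ~ supp f x -> f x = 0.
Proof. by move=> sf; apply/eqP; apply/negP => /negP /supp_neq0. Qed.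

Lemma near_not_supp f x : ~ supp f x -> {near x, f =1 (fun=> 0)}.
Proof.
move=> sx; have : open (~` supp f) by apply: closed_openC; exact: closed_closure.
rewrite openE => /(_ x sx); apply: filterS => y; exact: not_supp.
Qed.

Lemma supp_sub f g : (forall x, g x != 0 -> f x != 0) -> supp g `<=` supp f.
Proof. by move=> fg; apply: closure_subset => x; exact: fg. Qed.

Lemma supp_sub_closed f (A : set (R * R)) : closed A -> (forall x, f x != 0 -> A x) ->
  supp f `<=` A.
Proof. move=> cA fA; rewrite [X in _ `<=` X]((closure_id A).1 cA).
by apply: closure_subset => x; exact: fA. Qed.

Lemma partial_not_supp i f x : ~ supp f x -> partial i f x = 0.
Proof. by move=> sx; rewrite (partial_near _ (near_not_supp sx)) partial_cst. Qed.

Lemma supp_partial i f : supp (partial i f) `<=` supp f.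
Proof.
apply: supp_sub_closed; first exact: closed_closure.
by move=> x fx; apply: contrapT => /(partial_not_supp i) /eqP; apply/negP.
Qed.

Lemma closed_bounded_compact (A : set (R * R)) r :
  closed A -> (forall x, A x -> `|x.1| <= r /\ `|x.2| <= r) -> compact A.
Proof.
move=> cA Ar; apply: (@subclosed_compact _ A (`[- r, r]%classic `*` `[- r, r]%classic)).
- exact: cA.
- by apply: compact_setX; exact: segment_compact.
- by move=> x /Ar[]; rewrite !ler_norml /= !in_itv.
Qed.

Lemma compact_bounded_prod (A : set (R * R)) : compact A ->
  exists2 r, 0 < r & forall x, A x -> `|x.1| < r /\ `|x.2| < r.
Proof.
move=> /compact_bounded[M [_ MP]]; exists (`|M| + 2); first by rewrite ltr_wpDl.
move=> x /(MP (`|M| + 1)); rewrite /= prod_normE => H.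
have /H : M < `|M| + 1 by rewrite (le_lt_trans (ler_norm _))// ltrDl.
by rewrite ge_max => /andP[x1 x2]; split; [apply: le_lt_trans x1 _|apply: le_lt_trans x2 _];
  rewrite ltrD2l ltrDl.
Qed.

Lemma test_smooth f : test_fun f -> smooth f. Proof. by case. Qed.

Lemma test_funP f r : smooth f -> (forall x, f x != 0 -> `|x.1| <= r /\ `|x.2| <= r) ->
  test_fun f.
Proof.
move=> sf fr; split=> //; apply: (closed_bounded_compact (r := r)).
  exact: closed_closure.
apply: (@supp_sub_closed f [set x | `|x.1| <= r /\ `|x.2| <= r]); last exact: fr.
have -> : [set x : R * R | `|x.1| <= r /\ `|x.2| <= r] =
    `[- r, r]%classic `*` `[- r, r]%classic.
  by apply/seteqP; split=> x; rewrite /= !in_itv/= !ler_norml.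
apply: compact_closed; first exact: norm_hausdorff.
by apply: compact_setX; exact: segment_compact.
Qed.

Lemma test_sub f g : test_fun f -> smooth g -> (forall x, g x != 0 -> f x != 0) -> test_fun g.
Proof.
move=> [sf cf] sg fg; split=> //; apply: (subclosed_compact _ cf); last exact: supp_sub.
exact: closed_closure.
Qed.

Lemma test_partial i f : test_fun f -> test_fun (partial i f).
Proof.
move=> [sf cf]; split; first exact: smooth_partial.
by apply: (subclosed_compact _ cf); [exact: closed_closure|exact: supp_partial].
Qed.

Lemma testM f g : smooth f -> test_fun g -> test_fun (fun x => f x * g x).
Proof.
move=> sf tg; apply: (test_sub tg); first exact: smoothM (test_smooth tg).
by move=> x; rewrite mulf_eq0 negb_or => /andP[].
Qed.

Lemma testZ (k : R) g : test_fun g -> test_fun (fun x => k * g x).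
Proof. exact/testM/smooth_cst. Qed.

Lemma testD f g : test_fun f -> test_fun g -> test_fun (fun x => f x + g x).
Proof.
move=> [sf cf] [sg cg]; split; first exact: smoothD.
apply: (subclosed_compact _ (compactU cf cg)); first exact: closed_closure.
rewrite /supp -closureU; apply: closure_subset => x /=.
have [->|f0] := eqVneq (f x) 0; first by rewrite add0r; right.
by left.
Qed.

Lemma test0 : test_fun (fun=> 0 : R).
Proof. by apply: (@test_funP _ 0); [exact: smooth_cst|move=> x; rewrite eqxx]. Qed.

Lemma test_bounded f : test_fun f -> exists2 M, 0 < M & forall x, `|f x| <= M.
Proof.
move=> [sf cf].
have /compact_bounded[M [_ MP]] : compact (f @` supp f).
  apply: continuous_compact cf; apply: continuous_subspaceT; exact: smooth_continuous.
exists (`|M| + 1); first by rewrite ltr_wpDl.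
move=> x; have [sx|/not_supp ->] := pselect (supp f x).
  by apply: MP; [rewrite (le_lt_trans (ler_norm _))// ltrDl|exists x].
by rewrite normr0 addr_ge0.
Qed.

Lemma test_bounded_supp f : test_fun f ->
  exists2 r, 0 < r & forall x, f x != 0 -> `|x.1| < r /\ `|x.2| < r.
Proof.
by move=> [_ /compact_bounded_prod[r r0 rP]]; exists r => // x /supp_neq0 /rP.
Qed.

Lemma is_derive_axis0 f (t y : R) : differentiable f (t, y) ->
  is_derive t 1 (fun u => f (u, y)) (partial ord0 f (t, y)).
Proof.
move=> df; have dl : derivable f (t, y) (basis_vec R ord0) by exact: diff_derivable.
have E : (fun h : R => h^-1 *: ((fun u => f (u, y)) (h *: 1 + t) - f (t, y))) =
    (fun h : R => h^-1 *: (f (h *: basis_vec R ord0 + (t, y)) - f (t, y))).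
  apply/funext => h; congr (_ *: (f _ - _)).
  by rewrite /basis_vec/=; congr pair; rewrite /= /GRing.scale/= ?mulr1 ?mulr0 ?add0r.
by split; rewrite /derivable /partial /derive /= E.
Qed.

Lemma is_derive_axis1 f (t y : R) : differentiable f (t, y) ->
  is_derive y 1 (fun u => f (t, u)) (partial ord_max f (t, y)).
Proof.
move=> df; have dl : derivable f (t, y) (basis_vec R ord_max) by exact: diff_derivable.
have E : (fun h : R => h^-1 *: ((fun u => f (t, u)) (h *: 1 + y) - f (t, y))) =
    (fun h : R => h^-1 *: (f (h *: basis_vec R ord_max + (t, y)) - f (t, y))).
  apply/funext => h; congr (_ *: (f _ - _)).
  by rewrite /basis_vec/=; congr pair; rewrite /= /GRing.scale/= ?mulr1 ?mulr0 ?add0r.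
by split; rewrite /derivable /partial /derive /= E.
Qed.

Lemma mean_value_bound (f df : R -> R) (M a b : R) :
  (forall t : R, is_derive t 1 f (df t)) -> (forall t, `|df t| <= M) ->
  `|f b - f a| <= M * `|b - a|.
Proof.
move=> fd dM.
wlog ab : a b / a < b.
  move=> H; have [/H//|ba|->] := ltgtP a b; last by rewrite !subrr normr0 mulr0.
  by rewrite distrC [`|b - a|]distrC; exact: H.
have [|c _ ->] := @MVT R f df a b ab (fun x _ => fd x).
- apply: derivable_within_continuous => x _; by have [] := fd x.
- by rewrite normrM ler_wpM2r.
Qed.

Lemma taylor1_bound (f df ddf : R -> R) (M a h : R) :
  (forall t : R, is_derive t 1 f (df t)) -> (forall t : R, is_derive t 1 df (ddf t)) ->
  (forall t, `|ddf t| <= M) -> `|f (h + a) - f a - h * df a| <= M * h ^+ 2.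
Proof.
move=> fd dfd ddM.
have M0 : 0 <= M by exact: le_trans (ddM 0).
have aux c : `|c - a| <= `|h| -> `|h * (df c - df a)| <= M * h ^+ 2.
  move=> ca; rewrite normrM -real_normK ?num_real// expr2 mulrCA ler_wpM2l//.
  by apply: le_trans (mean_value_bound _ _ dfd ddM) _; rewrite ler_wpM2l.
have [->|h0] := eqVneq h 0; first by rewrite add0r subrr mul0r subrr normr0 expr0n mulr0.
have [hp|hn] := ltrP 0 h.
  have ah : a < h + a by rewrite ltrDr.
  have [|c] := @MVT R f df a (h + a) ah (fun x _ => fd x).
  - apply: derivable_within_continuous => x _; by have [] := fd x.
  rewrite in_itv/= => /andP[ac ch] ->; rewrite addrK mulrC -mulrBr; apply: aux.
  by rewrite !gtr0_norm// ?subr_gt0//; lra.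
have {}hn : h < 0 by rewrite lt_neqAle h0.
have ah : h + a < a by rewrite gtrDr.
have [|c] := @MVT R f df (h + a) a ah (fun x _ => fd x).
- apply: derivable_within_continuous => x _; by have [] := fd x.
rewrite in_itv/= => /andP[ac ch] fE.
have -> : f (h + a) - f a = h * df c by rewrite -opprB fE; ring.
by rewrite -mulrBr; apply: aux; rewrite !ltr0_norm// ?subr_lt0//; lra.
Qed.

(** The constant is uniform in [z], which permits differentiation under the integral sign against
    any integrable kernel. *)
Lemma test_taylor f : test_fun f -> exists2 M, 0 < M & forall z h,
  `|f (h + z) - f z - (h.1 * partial ord0 f z + h.2 * partial ord_max f z)| <= M * `|h| ^+ 2.
Proof.
move=> tf; pose d i j := partial i (partial j f).
have td i j : test_fun (d i j) by do 2 apply: test_partial.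
have df x : differentiable f x by exact: smooth_differentiable (test_smooth tf).
have dd i x : differentiable (partial i f) x.
  exact: smooth_differentiable (test_smooth (test_partial i tf)).
have [M1 M10 M1P] := test_bounded (td ord0 ord0).
have [M2 M20 M2P] := test_bounded (td ord_max ord0).
have [M3 M30 M3P] := test_bounded (td ord_max ord_max).
exists (M1 + M2 + M3); first by rewrite !addr_gt0.
move=> [x y] [h1 h2]; rewrite (_ : (h1, h2) + (x, y) = (h1 + x, h2 + y))//=.
have t1 := @taylor1_bound (fun u => f (u, h2 + y)) _ _ M1 x h1
  (fun t => is_derive_axis0 (df (t, h2 + y))) (fun t => is_derive_axis0 (dd ord0 (t, h2 + y)))
  (fun t => M1P (t, h2 + y)).
have t3 := @taylor1_bound (fun u => f (x, u)) _ _ M3 y h2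
  (fun t => is_derive_axis1 (df (x, t))) (fun t => is_derive_axis1 (dd ord_max (x, t)))
  (fun t => M3P (x, t)).
have t2 := @mean_value_bound (fun u => partial ord0 f (x, u)) _ M2 y (h2 + y)
  (fun t => is_derive_axis1 (dd ord0 (x, t))) (fun t => M2P (x, t)).
rewrite addrK in t2.
have nh1 : `|h1| <= `|(h1, h2)| by rewrite prod_normE le_max lexx.
have nh2 : `|h2| <= `|(h1, h2)| by rewrite prod_normE le_max lexx orbT.
move: nh1 nh2; set n := `|(h1, h2)| => nh1 nh2.
have n0 : 0 <= n by exact: normr_ge0.
(* A move along axis 0 at height [h2 + y], the change of [partial ord0 f] between the two heights,
   and a move along axis 1. *)
have -> : f (h1 + x, h2 + y) - f (x, y) - (h1 * partial ord0 f (x, y) + h2 * partial ord_max f (x, y))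
  = (f (h1 + x, h2 + y) - f (x, h2 + y) - h1 * partial ord0 f (x, h2 + y))
  + h1 * (partial ord0 f (x, h2 + y) - partial ord0 f (x, y))
  + (f (x, h2 + y) - f (x, y) - h2 * partial ord_max f (x, y)) by ring.
rewrite !mulrDl; apply: (le_trans (ler_normD _ _)); apply: lerD; first
  apply: (le_trans (ler_normD _ _)); first apply: lerD.
- apply: le_trans t1 _; rewrite ler_wpM2l ?(ltW M10)// -(real_normK (num_real h1)).
  by rewrite lerXn2r.
- rewrite normrM; apply: (@le_trans _ _ (n * (M2 * n))); last by rewrite expr2 mulrCA.
  by apply: ler_pM => //; apply: le_trans t2 _; rewrite ler_wpM2l ?(ltW M20).
- apply: le_trans t3 _; rewrite ler_wpM2l ?(ltW M30)// -(real_normK (num_real h2)).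
  by rewrite lerXn2r.
Qed.

End test_functions.

(** * Smooth functions of one variable *)

Section smooth1.
Context {R : realType}.
Implicit Types (f g : R -> R).

Fixpoint Ck1 (n : nat) f : Prop :=
  if n is m.+1 then (forall x, derivable f x 1) /\ Ck1 m (derive1 f) else True.

Definition smooth1 f := forall n, Ck1 n f.

Lemma Ck1W n f : Ck1 n.+1 f -> Ck1 n f.
Proof. by elim: n f => [//|n IH] f [df pf]; split => //; exact: IH. Qed.

Lemma smooth1_derivable f x : smooth1 f -> derivable f x 1.
Proof. by move=> /(_ 1%N)[]. Qed.

Lemma smooth1_derive f : smooth1 f -> smooth1 (derive1 f).
Proof. by move=> sf n; have [] := sf n.+1. Qed.

Lemma smooth1_is_derive f (x : R) : smooth1 f -> is_derive x 1 f (derive1 f x).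
Proof. by move=> sf; rewrite derive1E; apply: derivableP; exact: smooth1_derivable. Qed.

Lemma is_derive_Ck1 n f g : (forall x : R, is_derive x 1 f (g x)) -> Ck1 n g -> Ck1 n.+1 f.
Proof.
move=> fg Cg; split; first by move=> x; have [] := fg x.
rewrite (_ : f^`()%classic = g)//; apply/funext => x; rewrite derive1E.
by have [] := fg x.
Qed.

Lemma Ck1_is_derive n f (x : R) : Ck1 n.+1 f -> is_derive x 1 f (derive1 f x).
Proof. by move=> [df _]; rewrite derive1E; exact: derivableP. Qed.

Lemma Ck1_cst n (k : R) : Ck1 n (fun=> k).
Proof.
elim: n k => // n IH k.
have d (x : R) : is_derive x 1 (fun=> k) 0 by exact: is_derive_cst.
by apply: (is_derive_Ck1 d); exact: IH.
Qed.

Lemma Ck1D n f g : Ck1 n f -> Ck1 n g -> Ck1 n (fun x => f x + g x).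
Proof.
elim: n f g => // n IH f g Cf Cg.
have d (x : R) : is_derive x 1 (fun x => f x + g x) (derive1 f x + derive1 g x).
  exact: is_deriveD (Ck1_is_derive x Cf) (Ck1_is_derive x Cg).
by apply: (is_derive_Ck1 d); apply: IH; [case: Cf|case: Cg].
Qed.

Lemma Ck1M n f g : Ck1 n f -> Ck1 n g -> Ck1 n (fun x => f x * g x).
Proof.
elim: n f g => // n IH f g Cf Cg.
have d (x : R) : is_derive x 1 (fun x => f x * g x) (f x * derive1 g x + g x * derive1 f x).
  exact: is_deriveM (Ck1_is_derive x Cf) (Ck1_is_derive x Cg).
by apply: (is_derive_Ck1 d); apply: Ck1D; apply: IH; do ?[exact: Ck1W|by case: Cf|by case: Cg].
Qed.

Lemma Ck1V n f : (forall x, f x != 0) -> Ck1 n f -> Ck1 n (fun x => (f x)^-1).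
Proof.
move=> f0; elim: n => // n IH Cf.
have d (x : R) : is_derive x 1 (fun x => (f x)^-1)
    ((- 1 * ((f x)^-1 * (f x)^-1)) * derive1 f x).
  by rewrite mulN1r -expr2 exprVn; exact: is_deriveV (f0 x) (Ck1_is_derive x Cf).
by apply: (is_derive_Ck1 d); apply: Ck1M; [apply: Ck1M; [exact: Ck1_cst|apply: Ck1M; apply: IH; exact: Ck1W]|case: Cf].
Qed.

Lemma Ck1_affine n f (a b : R) : Ck1 n f -> Ck1 n (fun x => f (a * x + b)).
Proof.
elim: n f => // n IH f Cf.
have da (x : R) : is_derive x 1 (fun x => a * x + b) a.
  have dZ : is_derive x 1 (fun x => a * x) a.
    by have := @is_deriveZ _ _ _ id a x 1 1 (is_derive_id _ _); rewrite /GRing.scale/= mulr1.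
  by have := is_deriveD dZ (is_derive_cst b x 1); rewrite addr0.
have d (x : R) : is_derive x 1 (fun x => f (a * x + b)) (derive1 f (a * x + b) * a).
  exact: (@is_derive1_comp _ f (fun x => a * x + b) x _ _ (Ck1_is_derive _ Cf) (da x)).
by apply: (is_derive_Ck1 d); apply: Ck1M; [apply: IH; case: Cf|exact: Ck1_cst].
Qed.

Lemma Ck1_id n : Ck1 n id.
Proof.
case: n => // n; have d (x : R) : is_derive x 1 id 1 by exact: is_derive_id.
by apply: (is_derive_Ck1 d); exact: Ck1_cst.
Qed.

Lemma smooth1M f g : smooth1 f -> smooth1 g -> smooth1 (fun x => f x * g x).
Proof. by move=> sf sg n; exact: Ck1M. Qed.

Lemma smooth1D f g : smooth1 f -> smooth1 g -> smooth1 (fun x => f x + g x).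
Proof. by move=> sf sg n; exact: Ck1D. Qed.

Lemma smooth1_affine f (a b : R) : smooth1 f -> smooth1 (fun x => f (a * x + b)).
Proof. by move=> sf n; exact: Ck1_affine. Qed.

Lemma differentiable_fst_comp f (z : R * R) : derivable f z.1 1 ->
  [/\ differentiable (fun x : R * R => f x.1) z,
      partial ord0 (fun x : R * R => f x.1) z = derive1 f z.1
    & partial ord_max (fun x : R * R => f x.1) z = 0].
Proof.
move=> /derivable1_diffP df.
have [] : [/\ differentiable (fun x : R * R => f x.1) z,
      partial ord0 (fun x : R * R => f x.1) z = 'd f (z.1) 1
    & partial ord_max (fun x : R * R => f x.1) z = 0].
  apply: differentiable_affine_bound => e e0.
  have /diff_locallyP[_ /eqaddoP /(_ _ e0)] := df.
  move=> /nbhs_ballP[d /= d0 dP]; apply/nbhs_ballP; exists d => //= h.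
  rewrite -ball_normE/= sub0r normrN prod_normE => hd.
  have := dP h.1; rewrite -ball_normE/= sub0r normrN => H.
  have /H : `|h.1| < d by rewrite (le_lt_trans _ hd)// le_max lexx.
  rewrite /= !fctE/= opprD addrA mulr0 addr0.
  have -> : 'd f (z.1) h.1 = h.1 * 'd f (z.1) 1.
    by rewrite -[RHS]/(h.1 *: _) -linearZ /GRing.scale/= mulr1.
  move=> /le_trans; apply.
  by rewrite ler_pM2l// le_max lexx.
by move=> dd -> ->; split => //; rewrite derive1E deriveE.
Qed.

Lemma differentiable_snd_comp f (z : R * R) : derivable f z.2 1 ->
  [/\ differentiable (fun x : R * R => f x.2) z,
      partial ord0 (fun x : R * R => f x.2) z = 0
    & partial ord_max (fun x : R * R => f x.2) z = derive1 f z.2].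
Proof.
move=> /derivable1_diffP df.
have [] : [/\ differentiable (fun x : R * R => f x.2) z,
      partial ord0 (fun x : R * R => f x.2) z = 0
    & partial ord_max (fun x : R * R => f x.2) z = 'd f (z.2) 1].
  apply: differentiable_affine_bound => e e0.
  have /diff_locallyP[_ /eqaddoP /(_ _ e0)] := df.
  move=> /nbhs_ballP[d /= d0 dP]; apply/nbhs_ballP; exists d => //= h.
  rewrite -ball_normE/= sub0r normrN prod_normE => hd.
  have := dP h.2; rewrite -ball_normE/= sub0r normrN => H.
  have /H : `|h.2| < d by rewrite (le_lt_trans _ hd)// le_max lexx orbT.
  rewrite /= !fctE/= opprD addrA mulr0 add0r.
  have -> : 'd f (z.2) h.2 = h.2 * 'd f (z.2) 1.
    by rewrite -[RHS]/(h.2 *: _) -linearZ /GRing.scale/= mulr1.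
  move=> /le_trans; apply.
  by rewrite ler_pM2l// le_max lexx orbT.
by move=> dd -> ->; split => //; rewrite derive1E deriveE.
Qed.

Lemma ord2E (i : 'I_2) : i = ord0 \/ i = ord_max.
Proof. by case: i => [[|[|//]] ?]; [left|right]; exact: val_inj. Qed.

Lemma smooth_fst f : smooth1 f -> smooth (fun x : R * R => f x.1).
Proof.
move=> sf; apply/smooth_CkP => n; elim: n f sf => [|n IH] f sf; split => //.
1,2: by move=> x; have [] := differentiable_fst_comp (smooth1_derivable (x := x.1) sf).
move=> i; have [->|->] := ord2E i.
  rewrite (_ : partial _ _ = fun x => derive1 f x.1); first exact/IH/smooth1_derive.
  by apply/funext => x; have [] := differentiable_fst_comp (smooth1_derivable (x := x.1) sf).
rewrite (_ : partial _ _ = fun=> 0); first by move/smooth_CkP: (@smooth_cst R 0).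
by apply/funext => x; have [] := differentiable_fst_comp (smooth1_derivable (x := x.1) sf).
Qed.

Lemma smooth_snd f : smooth1 f -> smooth (fun x : R * R => f x.2).
Proof.
move=> sf; apply/smooth_CkP => n; elim: n f sf => [|n IH] f sf; split => //.
1,2: by move=> x; have [] := differentiable_snd_comp (smooth1_derivable (x := x.2) sf).
move=> i; have [->|->] := ord2E i.
  rewrite (_ : partial _ _ = fun=> 0); first by move/smooth_CkP: (@smooth_cst R 0).
  by apply/funext => x; have [] := differentiable_snd_comp (smooth1_derivable (x := x.2) sf).
rewrite (_ : partial _ _ = fun x => derive1 f x.2); first exact/IH/smooth1_derive.
by apply/funext => x; have [] := differentiable_snd_comp (smooth1_derivable (x := x.2) sf).
Qed.

(* The linear combinations of these are stable under differentiation. *)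
Definition flat (k : nat) (x : R) : R := if 0 < x then x ^- k * expR (- x^-1) else 0.

(** From [expR y >= (y / m) ^+ m] with [y = 1 / x] and [m = k + 2]: two powers more than [x ^- k]
    consumes, so that the difference quotient at 0 tends to 0. *)
Lemma flat_bound k x : `|flat k x| <= k.+2%:R ^+ k.+2 * x ^+ 2.
Proof.
rewrite /flat; case: ifPn => x0; last first.
  by rewrite normr0 mulr_ge0 ?sqr_ge0 ?exprn_ge0.
have t0 : 0 < x^-1 by rewrite invr_gt0.
set m := k.+2; have m0 : 0 < m%:R :> R by rewrite ltr0n.
rewrite ger0_norm; last by rewrite mulr_ge0 ?expR_ge0// invr_ge0 exprn_ge0// ltW.
have e0 : (x^-1 / m%:R) ^+ m <= expR x^-1.
  have -> : expR x^-1 = expR (x^-1 / m%:R) ^+ m.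
    by rewrite -expRM_natl mulrC divfK// gt_eqF.
  rewrite lerXn2r// ?nnegrE ?expR_ge0 ?divr_ge0 ?ltW//.
  by rewrite (lt_le_trans _ (expR_ge1Dx _))// ltrDr.
rewrite expRN -[_ * _^-1]/(_ / _) ler_pdivrMr ?expR_gt0//.
apply: (@le_trans _ _ (m%:R ^+ m * x ^+ 2 * (x^-1 / m%:R) ^+ m)); last first.
  by rewrite ler_pM2l// mulr_gt0// exprn_gt0.
rewrite expr_div_n mulrCA mulrA.
rewrite (_ : _ * _ / _ = x ^+ 2 * x^-1 ^+ m); last first.
  by field; rewrite expf_neq0 ?gt_eqF.
by rewrite /m !exprS; rewrite exprVn; rewrite le_eqVlt; apply/orP; left; apply/eqP; field;
  rewrite expf_neq0 gt_eqF.
Qed.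

Lemma flat_derive k (x : R) : is_derive x 1 (flat k) (flat k.+2 x - k%:R * flat k.+1 x).
Proof.
have [x0|x0|->] := ltgtP x 0.
- rewrite {2 3}/flat ltNge (ltW x0)/= mulr0 subr0.
  apply: near_eq_is_derive (is_derive_cst 0 x 1); near=> y; rewrite /flat ltNge ltW//=.
  by near: y; exact: lt_nbhsl.
- have d : is_derive x 1 (fun y : R => y^-1 ^+ k * expR (- y^-1))
      (flat k.+2 x - k%:R * flat k.+1 x).
    have dV : is_derive x 1 (fun y : R => y^-1) (- x ^- 2).
      by have := @is_deriveV _ id x 1 1 (lt0r_neq0 x0) (is_derive_id _ _);
        rewrite /GRing.scale/= mulr1.
    have dE : is_derive x 1 (fun y : R => expR (- y^-1)) (expR (- x^-1) * - - x ^- 2).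
      exact: (@is_derive1_comp _ expR (fun y => - y^-1)).
    have dX : is_derive x 1 (fun y : R => y^-1 ^+ k) ((k%:R * x^-1 ^+ k.-1) * - x ^- 2).
      rewrite (_ : (fun y : R => y^-1 ^+ k) = (fun y : R => y^-1) ^+ k); last by rewrite exprfctE.
      exact: is_deriveX.
    apply: (is_derive_eq (is_deriveM dX dE)); rewrite /flat x0 /GRing.scale/=.
    have xn0 := lt0r_neq0 x0.
    case: k dX => [|k] _; first by rewrite /= !expr0; field.
    rewrite /= ?exprVn ?exprS ?expr0.
    have yn0 : x ^+ k != 0 by rewrite expf_neq0.
    by move: yn0; set y := x ^+ k => yn0; set n := k.+1%:R; set w := expR _; field; rewrite yn0.
  apply: near_eq_is_derive d; near=> y; rewrite /flat exprVn.
  suff -> : 0 < y by [].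
  by near: y; exact: lt_nbhsr.
- rewrite {2 3}/flat ltxx mulr0 subr0.
  have cv : h^-1 *: (flat k (h *: 1 + 0) - flat k 0) @[h --> (0:R)^'] --> (0 : R).
    have M0 : 0 < (k.+2%:R ^+ k.+2 : R) by rewrite exprn_gt0.
    apply/pseudometric_normed_Zmodule.cvgrPdist_le => e e0.
    near=> h; rewrite sub0r normrN addr0 {2}/flat ltxx subr0 /GRing.scale/= mulr1.
    have h0 : h != 0 by near: h; exact: nbhs_dnbhs_neq.
    rewrite normrM normfV ler_pdivrMl ?normr_gt0//.
    apply: (le_trans (flat_bound _ _)); rewrite -(real_normK (num_real h)) expr2 mulrCA.
    rewrite ler_wpM2l// -ler_pdivlMl//.
    near: h; apply: dnbhs0_le; by rewrite mulr_gt0// invr_gt0.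
  by split; [apply/cvg_ex; exists 0|exact/cvg_lim].
Unshelve. all: by end_near. Qed.

Lemma smooth1_flat k : smooth1 (flat k).
Proof.
move=> n; elim: n k => // n IH k.
apply: (is_derive_Ck1 (flat_derive k)); apply: Ck1D => //.
rewrite (_ : (fun x => - _) = fun x => - k%:R * flat k.+1 x); last first.
  by apply/funext => x; rewrite mulNr.
by apply: Ck1M => //; exact: Ck1_cst.
Qed.

Definition step (u : R) : R := flat 0 (1 + u) / (flat 0 (1 + u) + flat 0 (1 - u)).

Lemma flat0_gt0 x : (0 < flat 0 x) = (0 < x).
Proof. by rewrite /flat; case: ifP => x0; rewrite ?ltxx// expr0 invr1 mul1r expR_gt0. Qed.

Lemma flat0_ge0 x : 0 <= flat 0 x.
Proof. by rewrite /flat; case: ifP => x0; rewrite // expr0 invr1 mul1r expR_ge0. Qed.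

Lemma flat0_le0 x : x <= 0 -> flat 0 x = 0.
Proof. by rewrite /flat leNgt => /negbTE ->. Qed.

Lemma step_den_gt0 u : 0 < flat 0 (1 + u) + flat 0 (1 - u).
Proof.
have [u0|u0] := lerP 0 u.
  by rewrite ltr_pwDl ?flat0_ge0// flat0_gt0; lra.
by rewrite ltr_wpDl ?flat0_ge0// flat0_gt0; lra.
Qed.

Lemma smooth1_step : smooth1 step.
Proof.
have s1 : smooth1 (fun u => flat 0 (1 + u)).
  by have := smooth1_affine 1 1 (smooth1_flat 0); congr smooth1; apply/funext => u; rewrite mul1r addrC.
have s2 : smooth1 (fun u => flat 0 (1 - u)).
  by have := smooth1_affine (-1) 1 (smooth1_flat 0); congr smooth1; apply/funext => u; rewrite mulN1r addrC.
move=> n; apply: Ck1M; first exact: s1.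
apply: Ck1V; last exact: Ck1D.
by move=> u; rewrite lt0r_neq0// step_den_gt0.
Qed.

Lemma step_le u : u <= - 1 -> step u = 0.
Proof. by move=> u1; rewrite /step flat0_le0 ?mul0r//; lra. Qed.

Lemma step_ge u : 1 <= u -> step u = 1.
Proof.
move=> u1; have := step_den_gt0 u; rewrite /step [flat 0 (1 - u)]flat0_le0; last by lra.
by rewrite addr0 => h; rewrite divff// lt0r_neq0.
Qed.

(* A smoothing of the positive part [max 0 u], exact for [e <= `|u|]. *)
Definition ramp (e u : R) : R := u * step (u / e).

Lemma smooth1_ramp e : smooth1 (ramp e).
Proof.
apply: smooth1M; first by move=> n; exact: Ck1_id.
have := smooth1_affine e^-1 0 smooth1_step.
by congr smooth1; apply/funext => u; rewrite addr0 mulrC.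
Qed.

Lemma ramp_le e u : 0 < e -> u <= - e -> ramp e u = 0.
Proof. by move=> e0 ue; rewrite /ramp step_le ?mulr0// ler_pdivrMr// mulN1r. Qed.

Lemma ramp_ge e u : 0 < e -> e <= u -> ramp e u = u.
Proof. by move=> e0 ue; rewrite /ramp step_ge ?mulr1// ler_pdivlMr// mul1r. Qed.

Lemma derive1_near f g (x : R) : {near x, f =1 g} -> derive1 f x = derive1 g x.
Proof. by move=> fg; rewrite !derive1E; exact: near_eq_derive. Qed.

Lemma derive1_ramp_lt e u : 0 < e -> u < - e -> derive1 (ramp e) u = 0.
Proof.
move=> e0 ue; rewrite (@derive1_near _ (fun=> 0)); first by rewrite derive1_cst.
by near=> y; rewrite ramp_le// ltW//; near: y; exact: lt_nbhsl.
Unshelve. all: by end_near. Qed.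

Lemma derive1_ramp_gt e u : 0 < e -> e < u -> derive1 (ramp e) u = 1.
Proof.
move=> e0 ue; rewrite (@derive1_near _ id); first by rewrite derive1E derive_id.
by near=> y; rewrite ramp_ge// ltW//; near: y; exact: lt_nbhsr.
Unshelve. all: by end_near. Qed.

Lemma derive2_ramp e u : 0 < e -> e < `|u| -> derive1 (derive1 (ramp e)) u = 0.
Proof.
move=> e0; rewrite ltr_normr => /orP[ue|ue].
  rewrite (@derive1_near _ (fun=> 1)); first by rewrite derive1_cst.
  by near=> y; rewrite derive1_ramp_gt//; near: y; exact: lt_nbhsr.
rewrite (@derive1_near _ (fun=> 0)); first by rewrite derive1_cst.
by near=> y; rewrite derive1_ramp_lt//; near: y; apply: lt_nbhsl; rewrite ltrNr.
Unshelve. all: by end_near. Qed.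

(** [step (3 - 4 / d * t)] is 1 for [t <= d / 2] and 0 for [t >= d]: the result is 1 on the square
    of half-width [d / 2] about [p] and 0 off that of half-width [d]. *)
Definition bump (d : R) (p z : R * R) : R :=
  let b t := step (3 - 4 / d * t) * step (3 + 4 / d * t) in b (z.1 - p.1) * b (z.2 - p.2).

Lemma bump_eq1 d p z : 0 < d -> `|p.1 - z.1| <= d / 2 -> `|p.2 - z.2| <= d / 2 -> bump d p z = 1.
Proof.
move=> d0; rewrite [`|_ - z.1|]distrC [`|_ - z.2|]distrC.
have aux t : `|t| <= d / 2 -> step (3 - 4 / d * t) * step (3 + 4 / d * t) = 1.
  rewrite ler_norml => /andP[t1 t2].
  have [h1 h2] : -2 <= 4 / d * t /\ 4 / d * t <= 2.
    by rewrite mulrAC ler_pdivlMr// ler_pdivrMr//; split; lra.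
  by rewrite !step_ge ?mulr1//; lra.
by move=> z1 z2; rewrite /bump !aux// mulr1.
Qed.

Lemma bump_neq0 d p z : 0 < d -> bump d p z != 0 -> `|p.1 - z.1| < d /\ `|p.2 - z.2| < d.
Proof.
move=> d0; rewrite [`|_ - z.1|]distrC [`|_ - z.2|]distrC.
have aux t : step (3 - 4 / d * t) * step (3 + 4 / d * t) != 0 -> `|t| < d.
  rewrite mulf_eq0 negb_or => /andP[s1 s2].
  have h1 : 4 / d * t < 4.
    rewrite ltNge; apply: contra s1 => h; rewrite step_le//; lra.
  have h2 : - 4 < 4 / d * t.
    rewrite ltNge; apply: contra s2 => h; rewrite step_le//; lra.
  by move: h1 h2; rewrite mulrAC ltr_pdivrMr// ltr_pdivlMr// ltr_norml => ? ?; lra.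
by rewrite /bump mulf_eq0 negb_or => /andP[/aux ? /aux ?].
Qed.

Lemma test_bump d p : 0 < d -> test_fun (bump d p).
Proof.
move=> d0; have s a : smooth1 (fun t => step (3 - 4 / d * (t - a)) * step (3 + 4 / d * (t - a))).
  apply: smooth1M.
    have := smooth1_affine (- (4 / d)) (3 + 4 / d * a) smooth1_step.
    by congr smooth1; apply/funext => t; congr step; ring.
  have := smooth1_affine (4 / d) (3 - 4 / d * a) smooth1_step.
  by congr smooth1; apply/funext => t; congr step; ring.
apply: (@test_funP _ _ (d + `|p.1| + `|p.2|)).
  by apply: smoothM; [exact: smooth_fst (s _)|exact: smooth_snd (s _)].
move=> z /(bump_neq0 d0)[z1 z2].
have := ler_normB p.1 (p.1 - z.1); have := ler_normB p.2 (p.2 - z.2).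
rewrite !opprB !(addrC _ (_ - _)) !subrK.
have := normr_ge0 p.1; have := normr_ge0 p.2; lra.
Qed.

End smooth1.

Notation plane R := (measurableTypeR R * measurableTypeR R)%type.

(** * Integration on the plane *)

Section real_fubini.
Context d1 d2 (T1 : measurableType d1) (T2 : measurableType d2) (R : realType).
Variables (m1 : {sigma_finite_measure set T1 -> \bar R})
          (m2 : {sigma_finite_measure set T2 -> \bar R}).
Variable f : T1 * T2 -> R.
Hypothesis intf : ((m1 \x m2)%E).-integrable setT (EFin \o f).

(** Sections are integrable almost everywhere only, and elsewhere the real inner integral may be a
    default value of [fine]; hence the almost everywhere comparison with the extended-valued
    integral. *)
Lemma Rintegral_fubini1 :
  m1.-integrable setT (EFin \o (fun x => \int[m2]_y f (x, y))) /\
  \int[m1]_x \int[m2]_y f (x, y) = \int[(m1 \x m2)%E]_z f z.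
Proof.
pose F x := (\int[m2]_y (f (x, y))%:E)%E.
have iF : m1.-integrable setT F := integrable_fubini_F intf.
have mF := measurable_int _ iF.
have mfF : measurable_fun setT (fun x => fine (F x)).
  exact: measurableT_comp mF.
have FE : ae_eq m1 setT (EFin \o (fun x => \int[m2]_y f (x, y))) F.
  apply: filterS (ae_integrable1 intf) => x ix _.
  by rewrite /= /Rintegral fineK//; exact: integrable_fin_num.
split.
  apply: le_integrable iF => //; first exact/measurable_EFinP.
  by move=> x _; rewrite /= /Rintegral -/(F x); case: (F x) => [r//||] /=; rewrite normr0 leey.
rewrite /Rintegral; congr fine.
rewrite (ae_eq_integral F)//; last exact/measurable_EFinP.
exact: integral12_prod_meas1.
Qed.

Lemma Rintegral_fubini2 :
  m2.-integrable setT (EFin \o (fun y => \int[m1]_x f (x, y))) /\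
  \int[m2]_y \int[m1]_x f (x, y) = \int[(m1 \x m2)%E]_z f z.
Proof.
pose F y := (\int[m1]_x (f (x, y))%:E)%E.
have iF : m2.-integrable setT F.
  have mf := measurable_int _ intf.
  apply/integrableP; split; first exact: (measurable_fubini_G intf).
  have H := (integrable21ltyP m1 m2 mf).1 intf.
  apply: le_lt_trans H.
  apply: ge0_le_integral => //.
  - exact: measurableT_comp (measurable_fubini_G intf).
  - apply: (measurable_fun_fubini_tonelli_G (abse \o (EFin \o f))) => //.
      exact: measurableT_comp.
    by move=> y /=; rewrite lee_fin.
  - move=> y _; apply: le_abse_integral => //.
    exact: measurableT_comp mf (pair2_measurable _).
have mF := measurable_int _ iF.
have mfF : measurable_fun setT (fun x => fine (F x)).
  exact: measurableT_comp mF.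
have FE : ae_eq m2 setT (EFin \o (fun y => \int[m1]_x f (x, y))) F.
  apply: filterS (ae_integrable2 intf) => x ix _.
  by rewrite /= /Rintegral fineK//; exact: integrable_fin_num.
split.
  apply: le_integrable iF => //; first exact/measurable_EFinP.
  by move=> x _; rewrite /= /Rintegral -/(F x); case: (F x) => [r//||] /=; rewrite normr0 leey.
rewrite /Rintegral; congr fine.
rewrite (ae_eq_integral F)//; last exact/measurable_EFinP.
exact: integral21_prod_meas1.
Qed.

End real_fubini.

(** * Measurability and translation invariance on the plane *)

Section plane_measure.
Context {R : realType}.
Local Notation mu := (mu2 R).
Local Notation leb := (@lebesgue_measure R).

Lemma measurable_ball_plane (p : R * R) r : measurable (ball p r : set (plane R)).
Proof.
rewrite (_ : ball p r = ball p.1 r `*` ball p.2 r)//.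
by apply: measurableX; apply: open_measurable; exact: ball_open.
Qed.

(** A countable base of squares. The factor [s] gives access to the doubled square, which leaves
    room for mollification inside an open set. *)
Definition rational_ball (s : R) (q : rat * rat * rat) : set (R * R) :=
  ball ((ratr q.1.1, ratr q.1.2) : R * R) (s * ratr q.2).

Lemma rational_ball_near (O : set (R * R)) x : open O -> O x ->
  exists q, [/\ 0 < ratr q.2 :> R, rational_ball 1 q x & rational_ball 2 q `<=` O].
Proof.
move=> oO Ox; have [r r0 rO] := open_ballP oO Ox.
have r80 : 0 < r / 8 by rewrite divr_gt0.
have ex (u : R) : exists q : rat, `|u - ratr q| < r / 8.
  have /rat_in_itvoo[q] : u - r / 8 < u + r / 8 by lra.
  rewrite inE/= => /itvP h; exists q.
  have h1 : u - r / 8 < ratr q by rewrite h.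
  have h2 : ratr q < u + r / 8 by rewrite h.
  by rewrite ltr_norml; apply/andP; split; lra.
have [q1 q1x] := ex x.1; have [q2 q2x] := ex x.2.
have /rat_in_itvoo[q3] : r / 8 < r / 4 by lra.
rewrite inE/= => /itvP h.
have q3l : r / 8 < ratr q3 by rewrite h.
have q3r : ratr q3 < r / 4 by rewrite h.
exists (q1, q2, q3); split => /=; first exact: lt_trans q3l.
  apply/ballE => /=; rewrite mul1r distrC (distrC _ x.2); split;
    exact: lt_trans q3l.
move=> y /ballE/=[y1 y2]; apply: rO; apply/ballE.
move: q1x q2x y1 y2; rewrite !ltr_norml => /andP[? ?] /andP[? ?] /andP[? ?] /andP[? ?].
by split; apply/andP; split; lra.
Qed.

Lemma measurable_open_plane (O : set (R * R)) : open O -> measurable (O : set (plane R)).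
Proof.
move=> oO; pose B q := rational_ball 2 q.
have -> : O = \bigcup_(q in [set q | B q `<=` O]) B q.
  apply/seteqP; split=> [x Ox|x [q /= qO Bx]]; last exact: qO.
  have [q [q0 qx qO]] := rational_ball_near oO Ox; exists q => //.
  by apply: le_ball qx; rewrite ler_pM2r// ler1n.
have ctb : countable [set q | B q `<=` O] by exact: countableP.
have [->|/set0P ne] := eqVneq [set q | B q `<=` O] set0; first by rewrite bigcup_set0.
rewrite bigcup_mkcond; apply: countable_bigcupT_measurable => // q.
case: ifP => _; last exact: measurable0.
exact: measurable_ball_plane.
Qed.

Lemma measurable_continuous_plane (f : R * R -> R) : continuous f ->
  measurable_fun setT (f : plane R -> R).
Proof.
move=> cf; apply: (measurability _ (RGenOpens.measurableE R)).
move=> /= _ [_ [a [b ->]] <-]; apply: measurableI => //; apply: measurable_open_plane.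
by move/continuousP : cf; apply; exact: itv_open.
Qed.

Definition shiftR (h : R) : measurableTypeR R -> measurableTypeR R := fun x => x + h.
Definition shift2 (h : R * R) : plane R -> plane R := fun z => (z.1 + h.1, z.2 + h.2).

Lemma measurable_shiftR (h : R) : measurable_fun setT (shiftR h).
Proof. by apply: measurable_funD; [exact: measurable_id|exact: measurable_cst]. Qed.

Lemma measurable_shift2 (h : R * R) : measurable_fun setT (shift2 h).
Proof.
apply: measurable_fun_pair; apply: (measurableT_comp (measurable_shiftR _)).
  exact: measurable_fst.
exact: measurable_snd.
Qed.

Lemma lebesgue_shift (h : R) (A : set (measurableTypeR R)) : measurable A ->
  leb (shiftR h @^-1` A) = leb A.
Proof.
pose sm := isMeasurableFun.Build _ _ _ _ _ (measurable_shiftR h).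
pose sp : {mfun measurableTypeR R >-> measurableTypeR R} := HB.pack (shiftR h) sm.
move=> mA; apply/esym.
apply: (@lebesgue_measure_unique _ (pushforward leb sp)) mA.
move=> _ [[a b] _ <-]; rewrite [RHS]/(leb (shiftR h @^-1` _)).
have -> : shiftR h @^-1` `](a, b).1, (a, b).2]%classic = `]a - h, b - h]%classic.
  by apply/seteqP; split=> x; rewrite /shiftR /= !in_itv/= ltrBlDr lerBrDr.
have E1 := lebesgue_measure_itv `](a, b).1, (a, b).2]%R.
have E2 := lebesgue_measure_itv `]a - h, b - h]%R.
apply: etrans E1 _; apply: etrans (esym E2).
rewrite /= !lte_fin ltrD2r; case: ifP => // _.
by rewrite -!EFinB opprB addrA subrK.
Qed.

Lemma mu2_shift (h : R * R) (A : set (plane R)) : measurable A ->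
  mu (shift2 h @^-1` A) = mu A.
Proof.
pose sm := isMeasurableFun.Build _ _ _ _ _ (measurable_shift2 h).
pose sp : {mfun plane R >-> plane R} := HB.pack (shift2 h) sm.
move=> mA; apply/esym.
apply: (@product_measure_unique _ _ _ _ _ leb leb (pushforward mu sp)) mA.
move=> X Y mX mY.
rewrite [LHS]/(mu ((shiftR h.1 @^-1` X) `*` (shiftR h.2 @^-1` Y))).
have ms k (Z : set (measurableTypeR R)) : measurable Z -> measurable (shiftR k @^-1` Z).
  by move=> mZ; rewrite -[X in measurable X]setTI; exact: measurable_shiftR.
apply: etrans (product_measure1E _ _ (ms _ _ mX) (ms _ _ mY)) _.
by congr (_ * _)%E; exact: lebesgue_shift.
Qed.

Lemma ge0_integral_shift2 (h : R * R) (f : plane R -> \bar R) :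
  measurable_fun setT f -> (forall z, 0 <= f z)%E ->
  (\int[mu]_z f (shift2 h z) = \int[mu]_z f z)%E.
Proof.
move=> mf f0.
have := ge0_integral_pushforward (measurable_shift2 h) mu measurableT mf (fun y _ => f0 y).
rewrite preimage_setT => <-.
apply: eq_measure_integral => [|mf' A mA _]; first exact: measurable_shift2.
exact: mu2_shift.
Qed.

Lemma integrable_shift2 (h : R * R) (f : plane R -> \bar R) :
  mu.-integrable setT f -> mu.-integrable setT (f \o shift2 h).
Proof.
move=> /integrableP[mf fi]; apply/integrableP; split.
  exact: measurableT_comp mf (measurable_shift2 h).
rewrite (ge0_integral_shift2 h (f := fun z => `|f z|%E))//.
exact: measurableT_comp.
Qed.

Lemma Rintegral_shift2 (h : R * R) (f : plane R -> R) :
  mu.-integrable setT (EFin \o f) ->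
  \int[mu]_z f (shift2 h z) = \int[mu]_z f z.
Proof.
move=> fi; have mf := measurable_int _ fi.
have mf2 := measurableT_comp mf (measurable_shift2 h).
rewrite /Rintegral; congr fine.
rewrite [LHS]integralE [RHS]integralE; congr (_ - _)%E.
  apply: etrans (ge0_integral_shift2 h (measurable_funepos mf) _) => //.
  by apply: eq_integral => z _; rewrite !funeposE.
apply: etrans (ge0_integral_shift2 h (measurable_funeneg mf) _) => //.
by apply: eq_integral => z _; rewrite !funenegE.
Qed.

End plane_measure.

(** * Averaging operators *)

Section averages.
Context {R : realType}.
Local Notation mu := (mu2 R).
Local Notation leb := (@lebesgue_measure R).

Lemma integrable_mul_bounded d (T : measurableType d) (m : {measure set T -> \bar R})
    (k g : T -> R) (M : R) :
  m.-integrable setT (EFin \o k) -> measurable_fun setT g -> (forall x, `|g x| <= M) ->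
  m.-integrable setT (EFin \o (fun x => k x * g x)).
Proof.
move=> ik mg gM; have mk : measurable_fun setT k by exact/measurable_EFinP/(measurable_int _ ik).
apply: (@le_integrable _ _ _ _ _ _ _ (fun x => (M * k x)%:E)) => //.
- by apply/measurable_EFinP; exact: measurable_funM.
- move=> x _; rewrite /= lee_fin !normrM mulrC ler_wpM2r//.
  by rewrite (le_trans (gM x))// ler_norm.
- exact: (integrableZl measurableT M ik).
Qed.

Section real_integrable.
Context d (T : measurableType d) (m : {measure set T -> \bar R}).
Implicit Types f g : T -> R.

Lemma integrableRD f g : m.-integrable setT (EFin \o f) -> m.-integrable setT (EFin \o g) ->
  m.-integrable setT (EFin \o (fun x => f x + g x)).
Proof. exact: integrableD. Qed.

Lemma integrableRB f g : m.-integrable setT (EFin \o f) -> m.-integrable setT (EFin \o g) ->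
  m.-integrable setT (EFin \o (fun x => f x - g x)).
Proof. exact: integrableB. Qed.

Lemma integrableRZ (a : R) f : m.-integrable setT (EFin \o f) ->
  m.-integrable setT (EFin \o (fun x => a * f x)).
Proof. exact: integrableZl. Qed.

Lemma integrableR_measurable f : m.-integrable setT (EFin \o f) -> measurable_fun setT f.
Proof. by move=> fi; exact/measurable_EFinP/(measurable_int _ fi). Qed.

End real_integrable.

Section average.
Context d (X : measurableType d) (m : {measure set X -> \bar R}) (k : X -> R) (tau : X -> R * R).
Hypotheses (ik : m.-integrable setT (EFin \o k))
  (mtau : measurable_fun setT (tau : X -> plane R)).

(** Serves twice: for integration of a test function along a horizontal segment, with [tau] the
    first axis, and for mollification of [k] by [th], with [tau] the opposite map. In both cases the
    derivatives fall on [th]. *)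
Definition average (th : scalar_field R) : scalar_field R :=
  fun z => \int[m]_x (k x * th (z + tau x)).

Lemma measurable_translate (th : scalar_field R) z : continuous th ->
  measurable_fun setT (fun x => th (z + tau x)).
Proof.
move=> cth; have mth := measurable_continuous_plane cth.
rewrite (_ : (fun x => _) = fun x => th (shift2 z (tau x))).
  exact: measurableT_comp mth (measurableT_comp (measurable_shift2 z) mtau).
by apply/funext => x; rewrite addrC.
Qed.

Lemma integrable_translate (th : scalar_field R) z : test_fun th ->
  m.-integrable setT (EFin \o (fun x => k x * th (z + tau x))).
Proof.
move=> tth; have [M _ thM] := test_bounded tth.
apply: (@integrable_mul_bounded _ _ _ _ _ M) => //.
exact: measurable_translate (smooth_continuous (test_smooth tth)).
Qed.

(** No limit theorem is involved: the uniform Taylor bound on [th] leaves a remainder of at most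
    [M * |h| ^ 2] times the L^1 norm of [k]. *)
Lemma average_differentiable (th : scalar_field R) z : test_fun th ->
  [/\ differentiable (average th) z,
      partial ord0 (average th) z = average (partial ord0 th) z
    & partial ord_max (average th) z = average (partial ord_max th) z].
Proof.
move=> tth; have [M M0 thM] := test_taylor tth.
have t0 := test_partial ord0 tth; have t1 := test_partial ord_max tth.
pose C := \int[m]_x `|k x|.
have C0 : 0 <= C by apply: Rintegral_ge0.
have ink : m.-integrable setT (EFin \o (fun x => `|k x|)) by exact: integrable_norm.
apply: differentiable_affine_bound => e e0.
have MC0 : 0 < M * C + 1 by rewrite ltr_wpDl// mulr_ge0// ltW.
near=> h.
have -> : average th (h + z) - average th z -
    (h.1 * average (partial ord0 th) z + h.2 * average (partial ord_max th) z) =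
    \int[m]_x (k x * (th (h + (z + tau x)) - th (z + tau x) -
      (h.1 * partial ord0 th (z + tau x) + h.2 * partial ord_max th (z + tau x)))).
  rewrite /average -!RintegralZl//; do ?exact: integrable_translate.
  rewrite -RintegralD//; do ?[by apply: integrableRZ; exact: integrable_translate].
  rewrite -RintegralB//; do ?exact: integrable_translate.
  rewrite -RintegralB//.
  - by apply: eq_Rintegral => x _; rewrite addrA mulrBr mulrBr mulrDr; congr (_ - (_ + _)); rewrite mulrCA.
  - by apply: integrableRB; exact: integrable_translate.
  - by apply: integrableRD; apply: integrableRZ; exact: integrable_translate.
have mrest : measurable_fun setT (fun x => th (h + (z + tau x)) - th (z + tau x) -
      (h.1 * partial ord0 th (z + tau x) + h.2 * partial ord_max th (z + tau x))).
  have ms t w : test_fun t -> measurable_fun setT (fun x => t (w + tau x)).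
    by move=> tt; exact: measurable_translate (smooth_continuous (test_smooth tt)).
  apply: measurable_funB; first apply: measurable_funB; last apply: measurable_funD.
  - by under eq_fun do rewrite addrA; exact: ms.
  - exact: ms.
  - by apply: measurable_funM => //; exact: ms.
  - by apply: measurable_funM => //; exact: ms.
apply: (le_trans (le_normr_Rintegral _ _)) => //.
  by apply: (@integrable_mul_bounded _ _ _ _ _ (M * `|h| ^+ 2)).
apply: (@le_trans _ _ (\int[m]_x (M * `|h| ^+ 2 * `|k x|))).
  apply: le_Rintegral => //.
  - apply: integrable_norm => //.
    by apply: (@integrable_mul_bounded _ _ _ _ _ (M * `|h| ^+ 2)).
  - exact: integrableRZ.
  - by move=> x _; rewrite normrM mulrC ler_wpM2r.
rewrite RintegralZl// -/C.
have h1 : `|h| * (M * C + 1) <= e.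
  rewrite -ler_pdivlMr//; near: h.
  by apply: (@nbhs0_le _ (R * R)%type); rewrite divr_gt0.
have n0 := normr_ge0 h.
have h2 : M * C * `|h| <= e by apply: le_trans h1; rewrite mulrC ler_wpM2l// lerDl.
by have := ler_wpM2r n0 h2; rewrite expr2 => H; rewrite (le_trans _ H)// le_eqVlt; apply/orP; left; apply/eqP; ring.
Unshelve. all: by end_near. Qed.

Lemma Ck_average n (th : scalar_field R) : test_fun th -> Ck n (average th).
Proof.
elim: n th => [|n IH] th tth; split=> //; do ?by move=> z; have [] := average_differentiable z tth.
move=> i; have [->|->] := ord2E i.
  rewrite (_ : partial _ _ = average (partial ord0 th)); first exact/IH/test_partial.
  by apply/funext => z; have [] := average_differentiable z tth.
rewrite (_ : partial _ _ = average (partial ord_max th)); first exact/IH/test_partial.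
by apply/funext => z; have [] := average_differentiable z tth.
Qed.

Lemma partial_average i (th : scalar_field R) : test_fun th ->
  partial i (average th) = average (partial i th).
Proof.
move=> tth; apply/funext => z; have [_ h0 h1] := average_differentiable z tth.
by have [->|->] := ord2E i.
Qed.

Lemma test_average (th : scalar_field R) L : test_fun th ->
  (forall x, k x != 0 -> `|(tau x).1| <= L /\ `|(tau x).2| <= L) ->
  test_fun (average th).
Proof.
move=> tth tauL; have [r r0 rP] := test_bounded_supp tth.
apply: (@test_funP _ _ (r + L)); first by apply/smooth_CkP => n; exact: Ck_average.
move=> z az; have [x kx thx] : exists2 x, k x != 0 & th (z + tau x) != 0.
  apply: contrapT => H; move/eqP : az; apply.
  rewrite /average (_ : (fun x => _) = cst 0) ?Rintegral_cst ?mul0r//.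
  apply/funext => x /=.
  have [->|kx] := eqVneq (k x) 0; first by rewrite mul0r.
  have [->|thx] := eqVneq (th (z + tau x)) 0; first by rewrite mulr0.
  by exfalso; apply: H; exists x.
have [tx1 tx2] := tauL x kx; have [zx1 zx2] := rP _ thx.
have aux (a b : R) : `|a + b| < r -> `|b| <= L -> `|a| <= r + L.
  move=> ab bL; have := ler_normB (a + b) b; rewrite addrK => /le_trans; apply.
  by rewrite lerD// ltW.
by split; [exact: aux zx1 tx1|exact: aux zx2 tx2].
Qed.

End average.
End averages.

Section sigma_finite.
Context {R : realType}.
Local Notation mu := (mu2 R).
Local Notation leb := (@lebesgue_measure R).

Lemma mu2_boundedE (a b c d : R) :
  mu (`[a, b]%classic `*` `[c, d]%classic) = (leb `[a, b]%classic * leb `[c, d]%classic)%E.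
Proof. exact: (product_measure1E leb leb (measurable_itv _) (measurable_itv _)). Qed.

Lemma mu2_box_lty (a b c d : R) : (mu (`[a, b]%classic `*` `[c, d]%classic) < +oo)%E.
Proof.
rewrite mu2_boundedE; apply: lte_mul_pinfty; rewrite ?measure_ge0//.
  by rewrite lebesgue_measure_itv/=; case: ifP.
by rewrite lebesgue_measure_itv/=; case: ifP => _; rewrite ltry.
Qed.

Lemma sigma_finite_mu2 : sigma_finite setT mu.
Proof.
exists (fun n : nat => `[- n%:R, n%:R]%classic `*` `[- n%:R, n%:R]%classic).
  apply/seteqP; split=> // -[x y] _.
  have [n nP] : exists n : nat, `|x| + `|y| <= n%:R.
    by exists (Num.truncn (`|x| + `|y|)).+1; rewrite ltW// truncnS_gt.
  have := normr_ge0 x; have := normr_ge0 y => y0 x0.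
  by exists n => //; split; rewrite /= in_itv/= -ler_norml; lra.
by move=> n; split; [exact: measurableX|exact: mu2_box_lty].
Qed.

End sigma_finite.

(* A copy of [mu2] that carries its sigma-finite structure. *)
Definition area (R : realType) : set (plane R) -> \bar R :=
  (@lebesgue_measure R \x @lebesgue_measure R)%E.

HB.instance Definition _ (R : realType) := Measure.on (@area R).
HB.instance Definition _ (R : realType) :=
  Measure_isSigmaFinite.Build _ _ _ (@area R) (@sigma_finite_mu2 R).

(** * Integration along horizontal lines and its transpose *)

Section slide.
Context {R : realType}.
Local Notation mu := (mu2 R).
Local Notation leb := (@lebesgue_measure R).

Definition axis (s : R) : R * R := (s, 0).

Lemma measurable_axis : measurable_fun setT (axis : measurableTypeR R -> plane R).
Proof. by apply: measurable_fun_pair; [exact: measurable_id|exact: measurable_cst]. Qed.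

(** A convolution along the first axis: with the kernels [ker0] and [ker1], the first and second
    antiderivatives of [f] from the left. *)
Definition slide (k : R -> R) (f : scalar_field R) : scalar_field R :=
  fun z => \int[leb]_s (k s * f (z - axis s)).

Section dual.
Variables (k : R -> R) (f : scalar_field R).
Hypotheses (ik : leb.-integrable setT (EFin \o k)) (jf : mu.-integrable setT (EFin \o f)).
Let mk : measurable_fun setT (k : measurableTypeR R -> R).
Proof. exact: integrableR_measurable ik. Qed.
Let mf : measurable_fun setT (f : plane R -> R).
Proof. exact: integrableR_measurable jf. Qed.

Local Notation space := (plane R * measurableTypeR R)%type.
Local Notation m3 := (@area R \x @lebesgue_measure R)%E.

Let kf_slide (x : space) : R := k x.2 * f (x.1 - axis x.2).
Let kf (x : space) : R := k x.2 * f x.1.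

Let measurable_kf : measurable_fun setT kf.
Proof.
apply: measurable_funM; first exact: measurableT_comp mk measurable_snd.
exact: measurableT_comp mf measurable_fst.
Qed.

Let measurable_kf_slide : measurable_fun setT kf_slide.
Proof.
apply: measurable_funM; first exact: measurableT_comp mk measurable_snd.
apply: (measurableT_comp mf); apply: measurable_fun_pair.
  apply: measurable_funB; last exact: measurable_snd.
  exact: measurableT_comp measurable_fst measurable_fst.
by apply: measurable_funB => //; exact: measurableT_comp measurable_snd measurable_fst.
Qed.

Let absf := (\int[mu]_z (`|f z|)%:E)%E.
Let absk := (\int[leb]_s (`|k s|)%:E)%E.

Let absf_fin : (absf < +oo)%E.
Proof. by have /integrableP[] := jf. Qed.
Let absk_fin : (absk < +oo)%E.
Proof. by have /integrableP[] := ik. Qed.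
Let absf_ge0 : (0 <= absf)%E.
Proof. by apply: integral_ge0 => z _; rewrite lee_fin. Qed.
Let absk_ge0 : (0 <= absk)%E.
Proof. by apply: integral_ge0 => z _; rewrite lee_fin. Qed.
Let mabsf : measurable_fun setT (fun z : plane R => (`|f z|)%:E).
Proof. by apply/measurable_EFinP; exact: measurableT_comp. Qed.
Let mabsk : measurable_fun setT (fun z : measurableTypeR R => (`|k z|)%:E).
Proof. by apply/measurable_EFinP; exact: measurableT_comp. Qed.

Let integrable_kf : m3.-integrable setT (EFin \o kf).
Proof.
have mE : measurable_fun setT (EFin \o kf) by exact/measurable_EFinP.
apply/(integrable21ltyP (@area R) leb mE).
rewrite [ltLHS](_ : _ = absk * absf)%E; first by rewrite lte_mul_pinfty// ge0_fin_numE.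
transitivity (\int[leb]_s (absf * (`|k s|)%:E))%E; last first.
  by rewrite ge0_integralZl// muleC.
apply: eq_integral => s _; rewrite muleC -ge0_integralZl//.
by apply: eq_integral => z _; rewrite /kf /= normrM EFinM.
Qed.

Let integrable_kf_slide : m3.-integrable setT (EFin \o kf_slide).
Proof.
have mE : measurable_fun setT (EFin \o kf_slide) by exact/measurable_EFinP.
apply/(integrable21ltyP (@area R) leb mE).
rewrite [ltLHS](_ : _ = absk * absf)%E; first by rewrite lte_mul_pinfty// ge0_fin_numE.
transitivity (\int[leb]_s (absf * (`|k s|)%:E))%E; last first.
  by rewrite ge0_integralZl// muleC.
apply: eq_integral => s _; rewrite muleC -ge0_integralZl//.
rewrite -(ge0_integral_shift2 (- axis s)%R (f := fun z => (`|k s|)%:E * (`|f z|)%:E)%E).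
- by apply: eq_integral => z _; rewrite /kf_slide /= normrM EFinM.
- exact: measurable_funeM.
- by move=> z; rewrite -EFinM lee_fin mulr_ge0.
Qed.

Lemma integrable_slide : mu.-integrable setT (EFin \o slide k f).
Proof. by have [] := Rintegral_fubini1 integrable_kf_slide. Qed.

(** Fubini, and for each [s] the translation of [z] by [axis s]. A merely integrable [f] is thus
    integrated along lines by acting on the test function. *)
Lemma slide_dual (th : scalar_field R) : test_fun th ->
  \int[mu]_z (slide k f z * th z) = \int[mu]_z (f z * average leb k axis th z).
Proof.
move=> tth; have [M M0 thM] := test_bounded tth.
have cth := smooth_continuous (test_smooth tth).
have mth := measurable_continuous_plane cth.
have mth1 : measurable_fun setT (fun x : space => th x.1) by exact: measurableT_comp mth measurable_fst.
have mth2 : measurable_fun setT (fun x : space => th (x.1 + axis x.2)).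
  apply: (measurableT_comp mth); apply: measurable_fun_pair.
    apply: measurable_funD; last exact: measurable_snd.
    exact: measurableT_comp measurable_fst measurable_fst.
  by apply: measurable_funD => //; exact: measurableT_comp measurable_snd measurable_fst.
have i1 : m3.-integrable setT (EFin \o (fun x => kf_slide x * th x.1)).
  exact: integrable_mul_bounded mth1 (fun x => thM _).
have i2 : m3.-integrable setT (EFin \o (fun x => kf x * th (x.1 + axis x.2))).
  exact: integrable_mul_bounded mth2 (fun x => thM _).
transitivity (\int[m3]_x (kf_slide x * th x.1)).
  have [j1 <-] := Rintegral_fubini1 i1.
  have isl := integrable_slide.
  rewrite /Rintegral; congr fine; apply: ae_eq_integral => //.
  - have := integrable_mul_bounded isl mth thM; exact: measurable_int.
  - exact: (measurable_int _ j1).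
  apply: filterS (ae_integrable1 integrable_kf_slide) => z iz _ /=.
  by rewrite /slide -RintegralZr.
transitivity (\int[m3]_x (kf x * th (x.1 + axis x.2))).
  have [j1 <-] := Rintegral_fubini2 i1; have [j2 <-] := Rintegral_fubini2 i2.
  apply: eq_Rintegral => s _.
  rewrite -[LHS](Rintegral_shift2 (axis s)).
    apply: eq_Rintegral => z _; rewrite /kf_slide /kf/=.
    by rewrite (_ : shift2 (axis s) z = z + axis s)// addrK.
  have := integrable_mul_bounded (integrable_shift2 (- axis s) jf) mth thM.
  move=> /(integrableRZ (k s)); apply: eq_integrable => // z _.
  by rewrite /kf_slide /= mulrA.
have [j2 <-] := Rintegral_fubini1 i2.
apply: eq_Rintegral => z _; rewrite /average -RintegralZl//.
  by apply: eq_Rintegral => s _; rewrite /kf /= mulrA (mulrC (f z)).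
exact: (integrable_translate (X := measurableTypeR R) (tau := axis) ik measurable_axis z tth).
Qed.

End dual.
End slide.

Section FTC.
Context {R : realType}.
Local Notation leb := (@lebesgue_measure R).

Lemma Rintegral_derivative (F f : R -> R) (a b : R) : a < b ->
  (forall x : R, is_derive x 1 F (f x)) -> continuous f ->
  \int[leb]_(s in `[a, b]) f s = F b - F a.
Proof.
move=> ab Ff cf; rewrite /Rintegral (@continuous_FTC2 _ _ F)//.
- exact: continuous_subspaceT.
- have cF : continuous F.
    move=> x; apply: differentiable_continuous; apply/derivable1_diffP.
    by have [] := Ff x.
  split; first by move=> x _; have [] := Ff x.
    by apply: cvg_at_right_filter; exact: cF.
  by apply: cvg_at_left_filter; exact: cF.
- by move=> x _; rewrite derive1E; have [] := Ff x.
Qed.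

(** By Cauchy's formula for repeated integration, the weights 1 and [s] give the first and the
    second antiderivative. *)
Definition ker0 (L s : R) : R := \1_(`[0, L]%classic) s.
Definition ker1 (L s : R) : R := s * \1_(`[0, L]%classic) s.

Lemma ker0_neq0 L s : ker0 L s != 0 -> `|(axis s).1| <= L /\ `|(axis s).2| <= L.
Proof.
rewrite /ker0 indicE; case: (boolP (s \in _)) => [|_]; last by rewrite eqxx.
rewrite inE/= in_itv/= => /andP[s0 sL] _; rewrite normr0 ger0_norm//.
by rewrite (le_trans s0).
Qed.

Lemma ker1_neq0 L s : ker1 L s != 0 -> `|(axis s).1| <= L /\ `|(axis s).2| <= L.
Proof. by rewrite /ker1 mulf_eq0 negb_or => /andP[_ /ker0_neq0]. Qed.

Lemma integrable_ker0 L : leb.-integrable setT (EFin \o ker0 L).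
Proof.
have mI : measurable (`[0, L]%classic : set (measurableTypeR R)) by exact: measurable_itv.
have /(integrable_mkcond _ mI) : leb.-integrable `[0, L]%classic (EFin \o cst 1).
  apply: continuous_compact_integrable; first exact: segment_compact.
  by apply: continuous_subspaceT => x; exact: cvg_cst.
apply: eq_integrable => // s _.
by rewrite /ker0 /= patchE indicE; case: ifP.
Qed.

Lemma integrable_ker1 L : leb.-integrable setT (EFin \o ker1 L).
Proof.
have mI : measurable (`[0, L]%classic : set (measurableTypeR R)) by exact: measurable_itv.
have /(integrable_mkcond _ mI) : leb.-integrable `[0, L]%classic (EFin \o id).
  apply: continuous_compact_integrable; first exact: segment_compact.
  by apply: continuous_subspaceT => x; exact: cvg_id.
apply: eq_integrable => // s _.
by rewrite /ker1 /= patchE indicE; case: ifP => _; rewrite ?mulr1 ?mulr0.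
Qed.

Lemma average_ker0 L (th : scalar_field R) (z : R * R) : 
  average leb (ker0 L) (@axis R) th z = \int[leb]_(s in `[0, L]) th (z + axis s).
Proof.
rewrite [RHS]Rintegral_mkcond; apply: eq_Rintegral => s _.
by rewrite /ker0 patchE indicE; case: ifP => _; rewrite ?mul1r ?mul0r.
Qed.

Lemma average_ker1 L (th : scalar_field R) (z : R * R) : 
  average leb (ker1 L) (@axis R) th z = \int[leb]_(s in `[0, L]) (s * th (z + axis s)).
Proof.
rewrite [RHS]Rintegral_mkcond; apply: eq_Rintegral => s _.
by rewrite /ker1 patchE indicE; case: ifP => _; rewrite ?mulr1 ?mulr0 ?mul0r.
Qed.

Lemma is_derive_translate (th : scalar_field R) z (s : R) : smooth th ->
  is_derive s 1 (fun s => th (z + axis s)) (partial ord0 th (z + axis s)).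
Proof.
case: z => x y sth; rewrite (_ : (x, y) + axis s = (x + s, y)); last first.
  by rewrite /axis [LHS]surjective_pairing /= addr0.
have d := is_derive_axis0 (smooth_differentiable (x + s, y) sth).
have d1 : is_derive s 1 (fun u : R => x + u) 1.
  by have := is_deriveD (is_derive_cst x s 1) (is_derive_id s (1 : R)); rewrite add0r.
have := is_derive1_comp d d1; rewrite mulr1.
congr is_derive; apply/funext => u /=; congr th.
by rewrite /axis [RHS]surjective_pairing /= addr0.
Qed.

Lemma continuous_translate (th : scalar_field R) z : smooth th ->
  continuous (fun s => th (z + axis s)).
Proof.
move=> sth s; apply: differentiable_continuous; apply/derivable1_diffP.
by have [] := is_derive_translate z s sth.
Qed.

Lemma average_partial0_ker0 L (th : scalar_field R) z : 0 < L -> test_fun th ->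
  average leb (ker0 L) (@axis R) (partial ord0 th) z = th (z + axis L) - th z.
Proof.
move=> L0 tth; rewrite average_ker0.
have sth := test_smooth tth.
rewrite (Rintegral_derivative L0 (fun s => is_derive_translate z s sth)).
  by rewrite (_ : axis 0 = 0)// addr0.
exact: continuous_translate (smooth_partial _ sth).
Qed.

(** Integration by parts along the segment; the boundary term at 0 vanishes with the weight [s]. *)
Lemma average_partial0_ker1 L (th : scalar_field R) z : 0 < L -> test_fun th ->
  average leb (ker1 L) (@axis R) (partial ord0 th) z =
  L * th (z + axis L) - average leb (ker0 L) (@axis R) th z.
Proof.
move=> L0 tth; have sth := test_smooth tth.
have c0 := @continuous_translate th z sth.
have c1 := @continuous_translate (partial ord0 th) z (smooth_partial ord0 sth).
have cm : continuous (fun s : R => s * partial ord0 th (z + axis s)).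
  by move=> s; apply: cvgM; [exact: cvg_id|exact: c1].
have ii (f : R -> R) : continuous f -> leb.-integrable `[0, L]%classic (EFin \o f).
  move=> cf; apply: continuous_compact_integrable; first exact: segment_compact.
  exact: continuous_subspaceT.
have d (s : R) : is_derive s 1 (fun s => s * th (z + axis s))
    (s * partial ord0 th (z + axis s) + th (z + axis s)).
  have := is_deriveM (is_derive_id s (1 : R)) (is_derive_translate z s sth).
  by rewrite /GRing.scale/= mulr1.
have cd : continuous (fun s : R => s * partial ord0 th (z + axis s) + th (z + axis s)).
  by move=> s; apply: cvgD; [exact: cm|exact: c0].
have := Rintegral_derivative L0 d cd.
rewrite mul0r subr0 RintegralD//; [|exact: ii..].
by rewrite average_ker1 average_ker0 => <-; rewrite addrK.
Qed.

End FTC.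

(** * Continuity of translations in the mean *)

Section energy.
Context {R : realType}.
Local Notation mu := (mu2 R).
Variable p : nat.
Hypothesis p0 : (0 < p)%N.
Implicit Types f g : plane R -> R.

(** The [p]-th power of the L^p norm, used with [p = 1] for the fundamental lemma and [p = 2] for
    the function spaces. The factor [2 ^+ p] of [energyD] stands in for Minkowski's inequality. *)
Definition energy f : \bar R := (\int[mu]_z (`|f z| ^+ p)%:E)%E.

Lemma measurable_abse_pow f : measurable_fun setT f ->
  measurable_fun setT (fun z => (`|f z| ^+ p)%:E).
Proof.
move=> mf; apply/measurable_EFinP; apply: measurable_funX.
exact: measurableT_comp.
Qed.

Lemma energy_ge0 f : (0 <= energy f)%E.
Proof. by apply: integral_ge0 => z _; rewrite lee_fin exprn_ge0. Qed.

Lemma energy_le f g : measurable_fun setT f -> measurable_fun setT g ->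
  (forall z, `|f z| <= `|g z|) -> (energy f <= energy g)%E.
Proof.
move=> mf mg fg; apply: ge0_le_integral;
  do ?[exact: measurable_abse_pow|by move=> z _; rewrite lee_fin exprn_ge0|by []].
by move=> z _; rewrite lee_fin lerXn2r ?nnegrE.
Qed.

Lemma normD_pow (a b : R) : `|a + b| ^+ p <= 2 ^+ p * (`|a| ^+ p + `|b| ^+ p).
Proof.
have aux (x y : R) : 0 <= x -> x <= y -> (x + y) ^+ p <= 2 ^+ p * (x ^+ p + y ^+ p).
  move=> x0 xy; apply: (@le_trans _ _ ((2 * y) ^+ p)).
    by rewrite lerXn2r ?nnegrE//; lra.
  by rewrite exprMn ler_wpM2l ?exprn_ge0// lerDr exprn_ge0.
apply: (@le_trans _ _ ((`|a| + `|b|) ^+ p)).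
  by rewrite lerXn2r ?nnegrE// ?addr_ge0// ler_normD.
have [ab|/ltW ba] := lerP `|a| `|b|; first exact: aux.
by rewrite addrC [_ ^+ p + _]addrC; exact: aux.
Qed.

Lemma energyD f g : measurable_fun setT f -> measurable_fun setT g ->
  (energy (fun z => (f z + g z)%R) <= (2 ^+ p)%:E * (energy f + energy g))%E.
Proof.
move=> mf mg; have mf' := measurable_abse_pow mf; have mg' := measurable_abse_pow mg.
rewrite /energy -ge0_integralD//; do ?by move=> z _; rewrite lee_fin exprn_ge0.
rewrite -ge0_integralZl//; do ?[by rewrite lee_fin exprn_ge0|exact: emeasurable_funD
  |by move=> z _; rewrite adde_ge0 // lee_fin exprn_ge0].
have mfg : measurable_fun setT (fun z => f z + g z) by exact: measurable_funD.
apply: ge0_le_integral;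
  do ?[exact: measurable_abse_pow|by move=> z _; rewrite lee_fin exprn_ge0|by []].
- by apply: measurable_funeM; exact: emeasurable_funD.
- by move=> z _; rewrite -EFinD -EFinM lee_fin normD_pow.
Qed.

Lemma energyZ (a : R) f : measurable_fun setT f ->
  energy (fun z => a * f z) = ((`|a| ^+ p)%:E * energy f)%E.
Proof.
move=> mf; rewrite /energy -ge0_integralZl//; do ?[by rewrite lee_fin exprn_ge0
  |exact: measurable_abse_pow|by move=> z _; rewrite lee_fin exprn_ge0].
by apply: eq_integral => z _; rewrite normrM exprMn.
Qed.

Lemma energy_shift f h : measurable_fun setT f -> energy (f \o shift2 h) = energy f.
Proof.
move=> mf; rewrite /energy -[RHS](ge0_integral_shift2 h)//;
  do ?[exact: measurable_abse_pow|by move=> z; rewrite lee_fin exprn_ge0].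
Qed.

Definition mean_continuous f := forall e : R, 0 < e -> exists2 d : R, 0 < d &
  forall h : R * R, `|h.1| < d -> `|h.2| < d ->
  (energy (fun z => (f (shift2 h z) - f z)%R) <= e%:E)%E.

Lemma measurable_shifted f h : measurable_fun setT f ->
  measurable_fun setT (fun z => f (shift2 h z)).
Proof. by move=> mf; exact: measurableT_comp mf (measurable_shift2 h). Qed.

Lemma mean_continuousD f g : measurable_fun setT f -> measurable_fun setT g ->
  mean_continuous f -> mean_continuous g -> mean_continuous (fun z => f z + g z).
Proof.
move=> mf mg cf cg e e0.
have e1 : 0 < e / (2 ^+ p * 2) by rewrite divr_gt0// mulr_gt0// exprn_gt0.
have [d1 d10 d1P] := cf _ e1; have [d2 d20 d2P] := cg _ e1.
exists (Num.min d1 d2); first by rewrite lt_min d10.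
move=> h; rewrite !lt_min => /andP[h11 h12] /andP[h21 h22].
under [X in (energy X <= _)%E]eq_fun do rewrite opprD addrACA.
apply: le_trans (energyD _ _) _; do ?by apply: measurable_funB => //; exact: measurable_shifted.
apply: (@le_trans _ _ ((2 ^+ p)%:E * ((e / (2 ^+ p * 2))%:E + (e / (2 ^+ p * 2))%:E))%E).
  apply: lee_wpmul2l; first by rewrite lee_fin exprn_ge0.
  by apply: leeD; [exact: d1P|exact: d2P].
rewrite -EFinD -EFinM lee_fin le_eqVlt; apply/orP; left; apply/eqP.
by field; rewrite expf_neq0.
Qed.

Lemma mean_continuousZ (a : R) f : measurable_fun setT f ->
  mean_continuous f -> mean_continuous (fun z => a * f z).
Proof.
move=> mf cf e e0.
have a0 : 0 < `|a| ^+ p + 1 by rewrite ltr_wpDl// exprn_ge0.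
have [d d0 dP] := cf (e / (`|a| ^+ p + 1)) (divr_gt0 e0 a0).
exists d => // h h1 h2; under [X in (energy X <= _)%E]eq_fun do rewrite -mulrBr.
rewrite energyZ; last by apply: measurable_funB => //; exact: measurable_shifted.
apply: (@le_trans _ _ ((`|a| ^+ p)%:E * (e / (`|a| ^+ p + 1))%:E)%E).
  by apply: lee_wpmul2l; [rewrite lee_fin exprn_ge0|exact: dP].
rewrite -EFinM lee_fin mulrA ler_pdivrMr//.
by rewrite mulrDr mulr1 mulrC lerDl ltW.
Qed.

Lemma mean_continuousB f g : measurable_fun setT f -> measurable_fun setT g ->
  mean_continuous f -> mean_continuous g -> mean_continuous (fun z => f z - g z).
Proof.
move=> mf mg cf cg.
have mN : measurable_fun setT (fun z => -1 * g z) by exact: measurable_funM.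
have := mean_continuousD mf mN cf (mean_continuousZ (-1) mg cg).
by congr mean_continuous; apply/funext => z /=; rewrite mulN1r.
Qed.

(** The three-term estimate: the error [f - g] enters once as it is and once translated, with the
    same energy. *)
Lemma mean_continuous_lim f : measurable_fun setT f ->
  (forall e : R, 0 < e -> exists g, [/\ measurable_fun setT g, mean_continuous g
     & (energy (fun z => (f z - g z)%R) <= e%:E)%E]) ->
  mean_continuous f.
Proof.
move=> mf fg e e0.
pose C : R := 2 ^+ p; have C0 : 0 < C by rewrite exprn_gt0.
have C1 : 0 < C * (C * 2 + 1) by rewrite mulr_gt0// addr_gt0// mulr_gt0.
(* Two applications of [energyD] bound the total by [C * (C * (e1 + e1) + e1)]. *)
set e1 := e / (C * (C * 2 + 1)); have e10 : 0 < e1 by rewrite divr_gt0.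
have [g [mg cg fge]] := fg _ e10; have [d d0 dP] := cg _ e10.
exists d => // h h1 h2.
pose r z := f z - g z; have mr : measurable_fun setT r by exact: measurable_funB.
rewrite (_ : (fun z => _) = (fun z => (r (shift2 h z) + (-1) * r z) + (g (shift2 h z) - g z))); last first.
  by apply/funext => z; rewrite /r; ring.
have ms := measurable_shifted h mr.
have mN : measurable_fun setT (fun z => - 1 * r z) by exact: measurable_funM.
apply: le_trans (energyD _ _) _.
- exact: measurable_funD.
- by apply: measurable_funB => //; exact: measurable_shifted.
have Er : (energy (fun z => (r (shift2 h z) + -1 * r z)%R) <= (C * (e1 + e1))%:E)%E.
  apply: le_trans (energyD ms mN) _; rewrite EFinM; apply: lee_wpmul2l.
  - by rewrite lee_fin ltW.
  - rewrite EFinD energyZ// normrN1 expr1n mul1e; apply: leeD => //.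
    by rewrite (energy_shift h mr).
apply: (@le_trans _ _ (C%:E * ((C * (e1 + e1))%:E + e1%:E))%E).
  apply: lee_wpmul2l; first by rewrite lee_fin ltW.
  by apply: leeD => //; exact: dP.
rewrite -EFinD -EFinM lee_fin le_eqVlt; apply/orP; left; apply/eqP.
rewrite /e1; field; by rewrite !lt0r_neq0// addr_gt0// mulr_gt0.
Qed.

Lemma energy_dominated f (g_ : (plane R -> R)^nat) (F : plane R -> R) :
  measurable_fun setT f -> (forall n, measurable_fun setT (g_ n)) ->
  measurable_fun setT F -> (energy F < +oo)%E ->
  (forall z n, `|f z - g_ n z| <= `|F z|) -> (forall z, g_ n z @[n --> \oo] --> f z) ->
  forall e : R, 0 < e -> exists n, (energy (fun z => (f z - g_ n z)%R) <= e%:E)%E.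
Proof.
move=> mf mg mF EF fgF gf e e0.
have [|||||] := @dominated_convergence _ _ _ mu setT measurableT
  (fun n z => (`|f z - g_ n z| ^+ p)%:E) (cst 0%E) (fun z => (`|F z| ^+ p)%:E).
- by move=> n; apply: measurable_abse_pow; exact: measurable_funB.
- exact: measurable_cst.
- apply: aeW => z _; apply: cvg_EFin; first exact: nearW.
  rewrite [X in _ --> X](_ : _ = `|f z - f z| ^+ p); last by rewrite subrr normr0 expr0n eqn0Ngt p0.
  have h : `|f z - g_ n z| @[n --> \oo] --> `|f z - f z|.
    by apply: cvg_norm; apply: cvgB => //; exact: cvg_cst.
  exact: cvg_comp _ _ h (@exprn_continuous R p _).
- apply/integrableP; split; first exact: measurable_abse_pow.
  by under eq_integral do rewrite gee0_abs ?lee_fin ?exprn_ge0//.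
- by apply: aeW => z n _; rewrite /= ger0_norm ?exprn_ge0// lee_fin lerXn2r ?nnegrE.
move=> _ _ /=; rewrite integral_cst// mul0e => /fine_cvgP[fin /cvgr_le /(_ e e0) le].
near \oo => n; exists n; rewrite -[energy _]fineK; last by near: n; exact: fin.
by rewrite lee_fin; near: n; exact: le.
Unshelve. all: by end_near. Qed.

End energy.

(** * Mean continuity of indicators, from rectangles to measurable sets *)

Section indicators.
Context {R : realType}.
Local Notation mu := (mu2 R).
Local Notation leb := (@lebesgue_measure R).
Variable p : nat.
Hypothesis p0 : (0 < p)%N.

Lemma lebesgue_segment (a b : R) : a <= b -> leb `[a, b]%classic = (b - a)%:E.
Proof.
move=> ab; have := lebesgue_measure_itv `[a, b]%R; rewrite /= lte_fin => E.
apply: etrans E _; case: ltP => // ba; rewrite (@le_anti _ _ a b) ?ab// subrr//.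
Qed.

Lemma mu2_box (a b c d : R) : a <= b -> c <= d ->
  mu (`[a, b]%classic `*` `[c, d]%classic) = ((b - a) * (d - c))%:E.
Proof. by move=> ab cd; rewrite mu2_boundedE !lebesgue_segment. Qed.

Lemma mean_continuous0 : mean_continuous p (cst 0 : plane R -> R).
Proof.
move=> e e0; exists 1 => // h _ _; rewrite /energy.
under eq_integral do rewrite subrr normr0 expr0n eqn0Ngt p0.
by rewrite integral0 lee_fin ltW.
Qed.

Lemma measurable_ocbox (a b c d : R) :
  measurable (`]a, b]%classic `*` `]c, d]%classic : set (plane R)).
Proof. by apply: measurableX; exact: measurable_itv. Qed.

Lemma measurable_box (a b c d : R) :
  measurable (`[a, b]%classic `*` `[c, d]%classic : set (plane R)).
Proof. by apply: measurableX; exact: measurable_itv. Qed.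

Lemma itv_swap (t x u : R) : u - t <= x <= u + t -> x - t <= u <= x + t.
Proof. by move=> /andP[? ?]; apply/andP; split; lra. Qed.

Lemma endpoint_crossed (t l m x u : R) : u - t < x -> x < u + t ->
  ((l < x) && (x <= m)) != ((l < u) && (u <= m)) ->
  (u - t <= l <= u + t) \/ (u - t <= m <= u + t).
Proof.
move=> xu1 xu2; have [lx|xl] := ltP l x; have [xm|mx] := leP x m;
  have [lu|ul] := ltP l u; have [um|mu'] := leP u m => //= _;
  solve [left; apply/andP; split; lra|right; apply/andP; split; lra].
Qed.

Lemma near_interval (t l m x u : R) : t <= 1 -> u - t < x -> x < u + t ->
  ((l < x) && (x <= m)) || ((l < u) && (u <= m)) -> l - 1 <= u <= m + 1.
Proof. by move=> t1 xu1 xu2 /orP[] /andP[? ?]; apply/andP; split; lra. Qed.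

Lemma shift_bounds (t u v : R) : - t < v -> v < t -> u - t < u + v /\ u + v < u + t.
Proof. by move=> ? ?; split; lra. Qed.

(** A shift shorter than [t] changes the indicator only in four strips of half-width [t] along the
    sides. Prolonged by 1 at each end, as [t <= 1] permits, they have total area [4 * t * K]. *)
Lemma mean_continuous_box (a b c d : R) :
  mean_continuous p (\1_(`]a, b]%classic `*` `]c, d]%classic) : plane R -> R).
Proof.
set S := _ `*` _.
have [ab|ab] := ltP a b; last first.
  rewrite (_ : \1_S = cst 0); first exact: mean_continuous0.
  rewrite (_ : S = set0) ?indic0// -subset0 => z [/=]; rewrite in_itv/=.
  by move=> /andP[h1 h2]; have := lt_le_trans h1 h2; rewrite ltNge ab.
have [cd|cd] := ltP c d; last first.
  rewrite (_ : \1_S = cst 0); first exact: mean_continuous0.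
  rewrite (_ : S = set0) ?indic0// -subset0 => z [_ /=]; rewrite in_itv/=.
  by move=> /andP[h1 h2]; have := lt_le_trans h1 h2; rewrite ltNge cd.
move=> e e0.
pose K := (b - a + 2) + (d - c + 2); have K0 : 0 < K by rewrite /K; lra.
pose t := Num.min 1 (e / (4 * K)).
have t0 : 0 < t by rewrite lt_min ltr01 divr_gt0// mulr_gt0.
have t1 : t <= 1 by rewrite ge_min lexx.
have tK : t * (4 * K) <= e by rewrite -ler_pdivlMr ?mulr_gt0// ge_min lexx orbT.
pose B (x : R) := `[x - t, x + t]%classic : set R.
pose E1 : set (plane R) := B a `*` `[c - 1, d + 1]%classic.
pose E2 : set (plane R) := B b `*` `[c - 1, d + 1]%classic.
pose E3 : set (plane R) := `[a - 1, b + 1]%classic `*` B c.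
pose E4 : set (plane R) := `[a - 1, b + 1]%classic `*` B d.
have mE1 : measurable E1 by exact: measurable_box.
have mE2 : measurable E2 by exact: measurable_box.
have mE3 : measurable E3 by exact: measurable_box.
have mE4 : measurable E4 by exact: measurable_box.
exists t => // h h1 h2.
pose G z : R := \1_E1 z + \1_E2 z + (\1_E3 z + \1_E4 z).
have GE : (\int[mu]_z (G z)%:E = (mu E1 + mu E2 + (mu E3 + mu E4)))%E.
  rewrite (eq_integral (fun z => ((\1_E1 z)%:E + (\1_E2 z)%:E) + ((\1_E3 z)%:E + (\1_E4 z)%:E))%E)//.
  have mi E : measurable E -> measurable_fun setT (fun z : plane R => (\1_E z)%:E).
    by move=> mE; apply/measurable_EFinP; exact: measurable_indic.
  rewrite ge0_integralD//; do ?[by move=> z _; rewrite adde_ge0// lee_fin|by apply: emeasurable_funD; exact: mi].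
  rewrite ge0_integralD//; do ?[by move=> z _; rewrite lee_fin|exact: mi].
  rewrite ge0_integralD//; do ?[by move=> z _; rewrite lee_fin|exact: mi].
  have ii E : measurable E -> (\int[mu]_z (\1_E z)%:E = mu E)%E.
    by move=> mE; rewrite integral_indic// setIT.
  by rewrite (ii _ mE1) (ii _ mE2) (ii _ mE3) (ii _ mE4).
pose I : \bar R := (\int[mu]_z (G z)%:E)%E.
apply: (@le_trans _ _ I); last first.
  have q x : x - t <= x + t by lra.
  have q1 : c - 1 <= d + 1 by lra.
  have q2 : a - 1 <= b + 1 by lra.
  rewrite /I GE /E1 /E2 /E3 /E4 /B !mu2_box//.
  by rewrite -!EFinD lee_fin; rewrite /K in tK; lra.
have mS : measurable_fun setT (\1_S : plane R -> R) by apply: measurable_indic; exact: measurable_ocbox.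
have mD : measurable_fun setT (fun z => (\1_S (shift2 h z) : R) - \1_S z).
  by apply: measurable_funB => //; exact: measurable_shifted.
have mG : measurable_fun setT (fun z => (G z)%:E).
  by apply/measurable_EFinP; apply: measurable_funD; apply: measurable_funD; exact: measurable_indic.
apply: ge0_le_integral; do ?[by []|exact: measurable_abse_pow|by move=> z _; rewrite lee_fin exprn_ge0].
move=> z _; rewrite lee_fin.
have G0 : 0 <= G z by rewrite !addr_ge0.
have [->|neq] := eqVneq (\1_S (shift2 h z) : R) (\1_S z).
  by rewrite subrr normr0 expr0n eqn0Ngt p0.
have -> : `|\1_S (shift2 h z) - \1_S z| = 1 :> R.
  move: neq; rewrite !indicE; case: (_ \in S); case: (_ \in S); rewrite ?eqxx//= => _.
    by rewrite subr0 normr1.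
  by rewrite sub0r normrN1.
rewrite expr1n.
have G1 : [\/ E1 z, E2 z, E3 z | E4 z] -> 1 <= G z.
  have pos (E : set (plane R)) : 0 <= (\1_E z : R) by [].
  move=> Ez; rewrite /G; have := pos E1; have := pos E2; have := pos E3; have := pos E4.
  have one (E : set (plane R)) : E z -> (\1_E z : R) = 1.
    by move=> ?; rewrite indicE mem_set.
  by case: Ez => /one -> ? ? ? ?; rewrite -?addrA ?(lerDl, ler_wpDl, addr_ge0)//; lra.
apply: G1; move: neq; rewrite !indicE /S.
move: h1 h2; rewrite !ltr_norml => /andP[h1 h1'] /andP[h2 h2'].
have inS w : (w \in `]a, b]%classic `*` `]c, d]%classic) =
    ((a < w.1) && (w.1 <= b)) && ((c < w.2) && (w.2 <= d)).
  by apply/idP/idP; rewrite inE/= !in_itv/=; [move=> [-> ->]|move=> /andP[-> ->]].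
rewrite !inS /shift2/=.
have inE1 : (z.1 - t <= a <= z.1 + t) -> (c - 1 <= z.2 <= d + 1) -> E1 z.
  by move=> /itv_swap h3 h4; split; rewrite /= ?in_itv.
have inE2 : (z.1 - t <= b <= z.1 + t) -> (c - 1 <= z.2 <= d + 1) -> E2 z.
  by move=> /itv_swap h3 h4; split; rewrite /= ?in_itv.
have inE3 : (z.2 - t <= c <= z.2 + t) -> (a - 1 <= z.1 <= b + 1) -> E3 z.
  by move=> /itv_swap h3 h4; split; rewrite /= ?in_itv.
have inE4 : (z.2 - t <= d <= z.2 + t) -> (a - 1 <= z.1 <= b + 1) -> E4 z.
  by move=> /itv_swap h3 h4; split; rewrite /= ?in_itv.
have [x1 x2] := shift_bounds z.1 h1 h1'; have [y1 y2] := shift_bounds z.2 h2 h2'.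
have := endpoint_crossed (l := a) (m := b) x1 x2; have := endpoint_crossed (l := c) (m := d) y1 y2.
have := near_interval (l := a) (m := b) t1 x1 x2; have := near_interval (l := c) (m := d) t1 y1 y2.
case: (_ && (z.1 + h.1 <= b)); case: (_ && (z.2 + h.2 <= d));
  case: (_ && (z.1 <= b)); case: (_ && (z.2 <= d)) => /= i2 i1 c2 c1 neq.
all: try by move: neq; rewrite eqxx.
all: try by case: (c1 isT) => ?; [constructor 1; apply: inE1|constructor 2; apply: inE2]; rewrite ?i2.
all: by case: (c2 isT) => ?; [constructor 3; apply: inE3|constructor 4; apply: inE4]; rewrite ?i1.
Qed.

End indicators.

Section mean_continuity.
Context {R : realType}.
Local Notation mu := (mu2 R).
Local Notation leb := (@lebesgue_measure R).
Variable p : nat.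
Hypothesis p0 : (0 < p)%N.
Variable r : R.

Definition ocbox : set (plane R) := `]- r, r]%classic `*` `]- r, r]%classic.

Let mD : measurable ocbox. Proof. exact: measurable_ocbox. Qed.

Lemma energy_ocbox : (energy p (\1_ocbox : plane R -> R) < +oo)%E.
Proof.
apply: (@le_lt_trans _ _ (mu ocbox)); last first.
  apply: le_lt_trans (mu2_box_lty (- r) r (- r) r).
  apply: le_measure; rewrite ?inE//; first exact: measurable_box.
  by move=> z [/= h1 h2]; split; rewrite /=; apply: subset_itv_oc_cc.
rewrite -[X in (_ <= mu X)%E]setIT -integral_indic//; apply: ge0_le_integral;
  do ?[by []|by move=> z _; rewrite lee_fin exprn_ge0].
- by apply: measurable_abse_pow; exact: measurable_indic.
- by apply/measurable_EFinP; exact: measurable_indic.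
move=> z _; rewrite lee_fin indicE; case: (_ \in _); rewrite /= ?normr1 ?expr1n//.
by rewrite normr0 expr0n eqn0Ngt p0.
Qed.

(** Intersection with a bounded box keeps energies finite, so that the whole plane has the property
    and Dynkin's theorem applies. *)
Definition mean_continuous_set (S : set (plane R)) :=
  mean_continuous p (\1_(S `&` ocbox) : plane R -> R).

Let mI S : measurable S -> measurable_fun setT (\1_(S `&` ocbox) : plane R -> R).
Proof. by move=> mS; apply: measurable_indic; exact: measurableI. Qed.

Let indE (S : set (plane R)) z :
  (\1_(S `&` ocbox) z : R) = (z \in S)%:R * (z \in ocbox)%:R.
Proof.
rewrite indicE -natrM mulnb; congr (_ %:R); congr nat_of_bool.
by apply/idP/andP; rewrite !inE // => -[].
Qed.

Lemma mean_continuous_setD S S' : measurable S -> measurable S' -> S' `<=` S ->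
  mean_continuous_set S -> mean_continuous_set S' -> mean_continuous_set (S `\` S').
Proof.
move=> mS mS' S'S cS cS'; have := mean_continuousB (mI mS) (mI mS') cS cS'.
rewrite /mean_continuous_set; congr mean_continuous; apply/funext => z.
rewrite !indE -mulrBl; congr (_ * _); rewrite in_setD; have [zS'|] := boolP (z \in S').
  by rewrite (mem_set (S'S z (set_mem zS')))/= subrr.
by rewrite /= andbT subr0.
Qed.

Lemma mean_continuous_bigcup (F : (set (plane R))^nat) : (forall n, measurable (F n)) ->
  trivIset setT F -> (forall n, mean_continuous_set (F n)) ->
  mean_continuous_set (\bigcup_k F k).
Proof.
move=> mF tF cF; have mU : measurable (\bigcup_k F k) by exact: bigcup_measurable.
have mUn n : measurable (\big[setU/set0]_(k < n) F k) by exact: bigsetU_measurable.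
have cUn n : mean_continuous_set (\big[setU/set0]_(k < n) F k).
  elim: n => [|n IH].
    by rewrite big_ord0 /mean_continuous_set set0I indic0; exact: mean_continuous0.
  have := mean_continuousD (mI (mUn n)) (mI (mF n)) IH (cF n).
  rewrite /mean_continuous_set; congr mean_continuous; apply/funext => z.
  rewrite big_ord_recr/= !indE -mulrDl in_setU; congr (_ * _).
  have [zF|_] := boolP (z \in F n); last by rewrite orbF addr0.
  rewrite orbT; suff -> : z \in \big[setU/set0]_(k < n) F k = false by rewrite add0r.
  apply/negP; rewrite inE -bigcup_mkord => -[k /= kn Fkz].
  move/trivIsetP : tF => /(_ k n I I); rewrite lt_eqF// => /(_ isT) kn0.
  have : (F k `&` F n) z by split => //; exact: set_mem.
  by rewrite kn0.
apply: mean_continuous_lim => //; first exact: mI.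
move=> e e0.
have [||||||n nP] := @energy_dominated _ _ p0 (\1_(\bigcup_k F k `&` ocbox))
   (fun n => \1_(\big[setU/set0]_(k < n) F k `&` ocbox)) (\1_ocbox) _ _ _ _ _ _ e e0.
- exact: mI.
- by move=> n; exact: mI.
- exact: measurable_indic.
- exact: energy_ocbox.
- move=> z n; rewrite !indE -mulrBl normrM indicE ler_piMl//.
  have [/set_mem zn|_] := boolP (z \in \big[setU/set0]_(k < n) F k).
    rewrite mem_set ?subrr ?normr0//.
    by move: zn; rewrite -bigcup_mkord => -[k _ Fkz]; exists k.
  by rewrite subr0; case: (_ \in _); rewrite ?normr0 ?normr1.
- move=> z; have [[k _ Fkz]|nU] := pselect ((\bigcup_k F k) z).
    apply: cvg_near_cst; near=> n; rewrite !indE; congr (_%:R * _).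
    rewrite (mem_set (A := \bigcup_k F k)); last by exists k.
    rewrite mem_set// -bigcup_mkord; exists k => //=; near: n; exact: nbhs_infty_gt.
  apply: cvg_near_cst; near=> n; rewrite !indE; congr (_%:R * _).
  rewrite (memNset (A := \bigcup_k F k))// memNset//.
  by rewrite -bigcup_mkord => -[k _ Fkz]; apply: nU; exists k.
by exists (\1_(\big[setU/set0]_(k < n) F k `&` ocbox)); split; [exact: mI (mUn n)|exact: cUn|exact: nP].
Unshelve. all: by end_near. Qed.

Lemma mean_continuous_ocrect (a b c d : R) :
  mean_continuous_set (`]a, b]%classic `*` `]c, d]%classic).
Proof.
rewrite /mean_continuous_set /ocbox -setXI.
have ocI (x y x' y' : R) : exists u v, `]x, y]%classic `&` `]x', y']%classic = `]u, v]%classic.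
  exists (Num.max x x'), (Num.min y y'); apply/seteqP; split=> t /=; rewrite !in_itv/=.
    by move=> [/andP[? ?] /andP[? ?]]; rewrite gt_max le_min; apply/andP; split; apply/andP.
  by rewrite gt_max le_min => /andP[/andP[-> ->] /andP[-> ->]].
have [u [v ->]] := ocI a b (- r) r; have [u' [v' ->]] := ocI c d (- r) r.
exact: mean_continuous_box.
Qed.

Let oc : set (set (measurableTypeR R)) := (R.-ocitv).-measurable.

Let mean_continuous_setI S S' : S `&` ocbox = S' `&` ocbox ->
  mean_continuous_set S -> mean_continuous_set S'.
Proof. by rewrite /mean_continuous_set => ->. Qed.

(** Dynkin's theorem is used three times: here for the first factor, starting from half-open
    intervals, then for the second factor, then for the sigma-algebra generated by rectangles. *)
Lemma mean_continuous_strip (A : set (measurableTypeR R)) (c d : R) : measurable A ->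
  mean_continuous_set (A `*` `]c, d]%classic).
Proof.
have mX B : measurable B -> measurable (B `*` `]c, d]%classic : set (plane R)).
  by move=> mB; apply: measurableX.
have T : mean_continuous_set (setT `*` `]c, d]%classic).
  apply: (mean_continuous_setI (S := `]- r, r]%classic `*` `]c, d]%classic)); last exact: mean_continuous_ocrect.
  by apply/seteqP; split=> z [[z1 z2] [z3 z4]]; split; split.
move: A; apply: (dynkin_induction (G := oc)) => //.
- exact: (@measurableI _ (ocitv_type R)).
- by move=> _ [[a b] _ <-]; exact: mean_continuous_ocrect.
- move=> S mS cS; have := mean_continuous_setD (mX _ measurableT) (mX _ mS) _ T cS.
  rewrite (_ : _ `\` _ = ~` S `*` `]c, d]%classic); last first.
    apply/seteqP; split=> z /=; first by move=> [[_ z2] zS]; split => // z1; exact: zS.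
    by move=> [z1 z2]; split => // -[].
  by apply => z [].
- move=> F mF tF cF; rewrite (_ : _ `*` _ = \bigcup_k (F k `*` `]c, d]%classic)); last first.
    apply/seteqP; split=> z /=; first by move=> [[k _ ?] ?]; exists k.
    by move=> [k _ [? ?]]; split => //; exists k.
  apply: mean_continuous_bigcup => //; first by move=> n; exact: mX.
  by apply/trivIsetP => i j _ _ ij; apply/seteqP; split=> z // [[zi _] [zj _]];
    move/trivIsetP : tF => /(_ i j I I ij) /seteqP[/(_ z.1)] => /(_ (conj zi zj)).
Qed.

Lemma mean_continuous_rect (A B : set (measurableTypeR R)) : measurable A -> measurable B ->
  mean_continuous_set (A `*` B).
Proof.
move=> mA.
have mX B' : measurable B' -> measurable (A `*` B' : set (plane R)).
  by move=> mB; apply: measurableX.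
have T : mean_continuous_set (A `*` setT).
  apply: (mean_continuous_setI (S := A `*` `]- r, r]%classic)); last exact: mean_continuous_strip.
  by apply/seteqP; split=> z [[z1 z2] [z3 z4]]; split; split.
move: B; apply: (dynkin_induction (G := oc)) => //.
- exact: (@measurableI _ (ocitv_type R)).
- by move=> _ [[a b] _ <-]; exact: mean_continuous_strip.
- move=> S mS cS; have := mean_continuous_setD (mX _ measurableT) (mX _ mS) _ T cS.
  rewrite (_ : _ `\` _ = A `*` ~` S); last first.
    apply/seteqP; split=> z /=; first by move=> [[z1 _] zS]; split => // z2; exact: zS.
    by move=> [z1 z2]; split => // -[].
  by apply => z [].
- move=> F mF tF cF; rewrite (_ : _ `*` _ = \bigcup_k (A `*` F k)); last first.
    apply/seteqP; split=> z /=; first by move=> [? [k _ ?]]; exists k.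
    by move=> [k _ [? ?]]; split => //; exists k.
  apply: mean_continuous_bigcup => //; first by move=> n; exact: mX.
  by apply/trivIsetP => i j _ _ ij; apply/seteqP; split=> z // [[_ zi] [_ zj]];
    move/trivIsetP : tF => /(_ i j I I ij) /seteqP[/(_ z.2)] => /(_ (conj zi zj)).
Qed.

Lemma mean_continuous_measurable (S : set (plane R)) : measurable S -> mean_continuous_set S.
Proof.
pose G : set (set (plane R)) := [set A `*` B | A in measurable & B in measurable].
move=> mS; have GE := measurable_prod_measurableType (measurableTypeR R) (measurableTypeR R).
apply: (@dynkin_induction _ (plane R) G) => //.
- move=> _ _ [A1 mA1 [B1 mB1 <-]] [A2 mA2 [B2 mB2 <-]].
  exists (A1 `&` A2); first exact: measurableI.
  by exists (B1 `&` B2); [exact: measurableI|rewrite setXI].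
- by rewrite -setXTT; exact: mean_continuous_rect.
- by move=> _ [A mA [B mB <-]]; exact: mean_continuous_rect.
- move=> S' mS' cS'; rewrite -setTD; apply: mean_continuous_setD => //.
  by rewrite -setXTT; exact: mean_continuous_rect.
- by move=> F mF tF cF; exact: mean_continuous_bigcup.
by rewrite -GE.
Qed.

End mean_continuity.

Section mean_continuity_Lp.
Context {R : realType}.
Local Notation mu := (mu2 R).
Variable p : nat.
Hypothesis p0 : (0 < p)%N.
Variable r : R.

Import HBNNSimple.

Lemma mean_continuous_nnsfun (g : {nnsfun plane R >-> R}) :
  (forall z, ~ ocbox r z -> g z = 0) -> mean_continuous p (g : plane R -> R).
Proof.
move=> g0; have -> : (g : plane R -> R) = fun z =>
    \sum_(k <- finmap.enum_fset (fset_set (range g))) (k * \1_(g @^-1` [set k]) z).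
  apply/funext => z; rewrite {1}fimfunE fsbig_finite//.
have mg k : measurable (g @^-1` [set k]) by exact: measurable_sfunP.
elim: (finmap.enum_fset _) => [|k s IH].
  under eq_fun do rewrite big_nil; exact: mean_continuous0.
have mk : measurable_fun setT (\1_(g @^-1` [set k]) : plane R -> R) by exact: measurable_indic.
under eq_fun do rewrite big_cons; apply: mean_continuousD => //.
- exact: measurable_funM.
- by apply: measurable_sum => j; apply: measurable_funM => //; exact: measurable_indic.
(* The level set of 0 is the only one that may leave [ocbox], and its coefficient is 0. *)
have [->|k0] := eqVneq k 0.
  by under eq_fun do rewrite mul0r; exact: mean_continuous0.
apply: mean_continuousZ => //.
have := mean_continuous_measurable p0 r (mg k); rewrite /mean_continuous_set.
rewrite (_ : _ `&` _ = g @^-1` [set k])//; apply/setIidPl => z /= gzk.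
by apply: contrapT => /g0; rewrite gzk; move/eqP: k0.
Qed.

Lemma mean_continuous_ge0 (f : plane R -> R) : measurable_fun setT f ->
  (forall z, 0 <= f z) -> (forall z, ~ ocbox r z -> f z = 0) ->
  (energy p f < +oo)%E -> mean_continuous p f.
Proof.
move=> mf f0 fr ef; have mf' : measurable_fun setT (EFin \o f) by exact/measurable_EFinP.
pose g n := nnsfun_approx measurableT mf' n.
have gf n z : g n z <= f z.
  rewrite -lee_fin /g nnsfun_approxE; apply: (le_approx n (D := setT) (f := EFin \o f)) => //.
  by move=> x _; rewrite lee_fin.
apply: mean_continuous_lim => // e e0.
have [||||||n nP] := @energy_dominated _ _ p0 f (fun n => g n : plane R -> R) f _ _ _ _ _ _ e e0 => //.
- by move=> z n; rewrite !ger0_norm ?subr_ge0// gerBl.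
- move=> z; have : (g n z)%:E @[n --> \oo] --> (f z)%:E.
    by apply: (@cvg_nnsfun_approx _ _ _ setT measurableT (EFin \o f) mf') => // x _; rewrite lee_fin.
  by move=> /fine_cvgP[_].
exists (g n); split => //.
apply: mean_continuous_nnsfun => z /fr fz; apply/eqP; rewrite eq_le.
by rewrite -{1}fz gf/=.
Qed.

Lemma norm_max0_le (x : R) : `|Num.max x 0| <= `|x|.
Proof.
rewrite ger0_norm ?le_max ?lexx ?orbT//; case: (leP x 0) => [_|/ltW/ger0_norm->//].
exact: normr_ge0.
Qed.

Lemma mean_continuous_Lp (f : plane R -> R) : measurable_fun setT f ->
  (forall z, ~ ocbox r z -> f z = 0) -> (energy p f < +oo)%E -> mean_continuous p f.
Proof.
move=> mf fr ef.
pose fp z := Num.max (f z) 0; pose fn z := Num.max (- f z) 0.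
have mfp : measurable_fun setT fp by apply: measurable_maxr.
have mfn : measurable_fun setT fn by apply: measurable_maxr => //; exact: measurableT_comp.
have -> : f = fun z => fp z - fn z.
  by apply/funext => z; rewrite /fp /fn; case: (leP (f z) 0) => ?; case: (leP (- f z) 0) => ?; lra.
apply: mean_continuousB => //; apply: mean_continuous_ge0 => //.
- by move=> z; rewrite le_max lexx orbT.
- by move=> z /fr; rewrite /fp => ->; rewrite maxxx.
- apply: le_lt_trans ef; apply: energy_le => // z; rewrite /fp.
  exact: norm_max0_le.
- by move=> z; rewrite le_max lexx orbT.
- by move=> z /fr; rewrite /fn => ->; rewrite oppr0 maxxx.
- apply: le_lt_trans ef; apply: energy_le => // z; rewrite /fn -[leRHS]normrN.
  exact: norm_max0_le.
Qed.

End mean_continuity_Lp.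

(** * Mollification *)

Section mollifier.
Context {R : realType}.
Local Notation mu := (mu2 R).
Local Notation leb := (@lebesgue_measure R).

(** A kernel of mass 1 whose second antiderivative is [ramp e]. It changes sign, as [ramp e] dips
    below 0 just to the left of 0, so its L^1 norm has to be bounded separately. *)
Definition eta (e : R) : R -> R := derive1 (derive1 (ramp e)).
(** The minus sign gives [rho e (z0 - z)] the factor [eta e (z.2 - z0.2)], the second derivative of
    a profile centred at [z0.2]. *)
Definition rho (e : R) (x : R * R) : R := eta e x.1 * eta e (- x.2).

Lemma smooth1_eta e : smooth1 (eta e).
Proof. exact/smooth1_derive/smooth1_derive/smooth1_ramp. Qed.

Lemma eta_out e u : 0 < e -> e < `|u| -> eta e u = 0.
Proof. exact: derive2_ramp. Qed.

Lemma eta_neq0 e u : 0 < e -> eta e u != 0 -> `|u| <= e.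
Proof. by move=> e0; apply: contraNT; rewrite -ltNge => /(eta_out e0) ->. Qed.

Lemma rho_neq0 e x : 0 < e -> rho e x != 0 -> `|x.1| <= e /\ `|x.2| <= e.
Proof.
by move=> e0; rewrite mulf_eq0 negb_or => /andP[/eta_neq0-> // /eta_neq0]; rewrite normrN => ->.
Qed.

Lemma test_rho e : 0 < e -> test_fun (rho e).
Proof.
move=> e0; apply: (@test_funP _ _ e) => [|x]; last exact: rho_neq0.
apply: smoothM; first exact: smooth_fst (smooth1_eta e).
have -> : (fun x : R * R => eta e (- x.2)) = fun x => (fun u => eta e (-1 * u + 0)) x.2.
  by apply/funext => x; rewrite mulN1r addr0.
exact: smooth_snd (smooth1_affine (-1) 0 (smooth1_eta e)).
Qed.

Lemma is_derive_scale (f : R -> R) (a x : R) : smooth1 f ->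
  is_derive x 1 (fun u => f (a * u)) (derive1 f (a * x) * a).
Proof.
move=> sf; apply: (@is_derive1_comp _ f (fun u => a * u) x _ _ (smooth1_is_derive _ sf)).
by have := @is_deriveZ _ _ _ id a x 1 1 (is_derive_id _ _); rewrite /GRing.scale/= mulr1.
Qed.

Lemma eta_scale e u : 0 < e -> eta e u = e^-1 * eta 1 (e^-1 * u).
Proof.
move=> e0; have en0 := lt0r_neq0 e0; have sr := smooth1_ramp (1 : R).
have E0 : ramp e = fun u => e * ramp 1 (e^-1 * u).
  by apply/funext => x; rewrite /ramp divr1 [x / e]mulrC !mulrA divff// mul1r.
have E1 : derive1 (ramp e) = fun u => derive1 (ramp 1) (e^-1 * u).
  apply/funext => x; rewrite derive1E E0.
  have d := is_deriveZ e (is_derive_scale e^-1 x sr).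
  by rewrite (@derive_val _ _ _ _ _ _ _ d) /GRing.scale/= mulrCA divff// mulr1.
have -> : eta e u = derive1 (fun u => derive1 (ramp 1) (e^-1 * u)) u by rewrite -E1.
rewrite derive1E.
have d := is_derive_scale e^-1 u (smooth1_derive sr).
by rewrite (@derive_val _ _ _ _ _ _ _ d) mulrC.
Qed.

(** Scaling reduces this to [e = 1]. The factor [bump 4] makes a test function of the plane out of
    [eta 1], so that [test_bounded] applies, and is 1 on the segment where it is evaluated. *)
Lemma eta_bound : exists2 C : R, 0 < C & forall e u, 0 < e -> `|eta e u| <= C / e.
Proof.
have t : test_fun (fun z => eta 1 z.1 * bump 4 (0 : R * R) z).
  by apply: testM; [exact: smooth_fst (smooth1_eta 1)|exact: test_bump].
have [M M0 MP] := test_bounded t; exists M => // e u e0.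
rewrite eta_scale// normrM gtr0_norm ?invr_gt0// mulrC ler_pM2r ?invr_gt0//.
set v := _ * u; have [v1|v1] := leP `|v| 1; last by rewrite eta_out// normr0 ltW.
have := MP (v, 0); rewrite bump_eq1 ?mulr1//= sub0r ?normrN.
  by rewrite (le_trans v1)//; lra.
by rewrite normr0; lra.
Qed.

End mollifier.

Section boxes.
Context {R : realType}.
Local Notation mu := (mu2 R).
Local Notation leb := (@lebesgue_measure R).

Definition box (r : R) : set (plane R) := `[- r, r]%classic `*` `[- r, r]%classic.

Lemma boxP r z : box r z <-> `|z.1| <= r /\ `|z.2| <= r.
Proof. by rewrite /box /= !in_itv/= !ler_norml; split=> -[]. Qed.

Lemma measurable_boxr r : measurable (box r).
Proof. exact: measurable_box. Qed.

Lemma compact_box r : compact (box r : set (R * R)).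
Proof. by apply: compact_setX; exact: segment_compact. Qed.

Lemma mu_box_lty r : (mu (box r) < +oo)%E.
Proof. exact: mu2_box_lty. Qed.

Lemma integrable_mul_supported (f th : plane R -> R) (M r : R) :
  mu.-integrable (box r) (EFin \o f) -> measurable_fun setT th ->
  (forall z, `|th z| <= M) -> (forall z, th z != 0 -> box r z) ->
  mu.-integrable setT (EFin \o (fun z => f z * th z)).
Proof.
move=> /(integrable_mkcond _ (measurable_boxr r)) fi mth thM thr.
have -> : (fun z => f z * th z) = fun z => (f \_ (box r)) z * th z.
  apply/funext => z; rewrite patchE; case: ifPn => //.
  rewrite notin_setE => zr; have [->|/thr//] := eqVneq (th z) 0.
  by rewrite !mulr0.
apply: integrable_mul_bounded mth thM.
by rewrite -restrict_EFin.
Qed.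

Lemma integrable_bounded_supported (th : plane R -> R) (M r : R) : measurable_fun setT th ->
  (forall z, `|th z| <= M) -> (forall z, th z != 0 -> box r z) ->
  mu.-integrable setT (EFin \o th).
Proof.
move=> mth thM thr.
have -> : th = fun z => (cst 1 z : R) * th z by apply/funext => z; rewrite mul1r.
apply: integrable_mul_supported mth thM thr.
apply: measurable_bounded_integrable.
- exact: measurable_boxr.
- exact: mu_box_lty.
- exact: measurable_cst.
- by exists 1; split => // y y1 x _ /=; rewrite normr1 ltW.
Qed.

Lemma test_fun_data (th : scalar_field R) : test_fun th ->
  measurable_fun setT (th : plane R -> R) /\ exists M r, [/\ 0 < M, 0 < r,
  forall z, `|th z| <= M & forall z, th z != 0 -> box r z].
Proof.
move=> tth; split; first exact: measurable_continuous_plane (smooth_continuous (test_smooth tth)).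
have [M M0 MP] := test_bounded tth; have [r r0 rP] := test_bounded_supp tth.
by exists M, r; split=> // z /rP[z1 z2]; apply/boxP; split; exact: ltW.
Qed.

Lemma integrable_test (th : scalar_field R) : test_fun th -> mu.-integrable setT (EFin \o th).
Proof.
move=> /test_fun_data[mth [M [r [_ _ MP rP]]]].
exact: integrable_bounded_supported mth MP rP.
Qed.

Lemma integrable_loc_test (f th : scalar_field R) : loc_integrable f -> test_fun th ->
  mu.-integrable setT (EFin \o (fun z => f z * th z)).
Proof.
move=> lf /test_fun_data[mth [M [r [_ _ MP rP]]]].
have lr := lf _ (compact_box (r := r)).
exact: (@integrable_mul_supported f th M r).
Qed.

Lemma Rintegral_supported (F f : R -> R) (L : R) : 0 < L ->
  (forall x : R, is_derive x 1 F (f x)) -> continuous f ->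
  (forall x, L < `|x| -> f x = 0) ->
  leb.-integrable setT (EFin \o f) /\ \int[leb]_x f x = F L - F (- L).
Proof.
move=> L0 Ff cf fL.
have mI : measurable (`[- L, L]%classic : set (measurableTypeR R)) by exact: measurable_itv.
have fE : f = f \_ `[- L, L].
  apply/funext => x; rewrite patchE; case: ifPn => //.
  by rewrite notin_setE/= in_itv/= -ler_norml => /negP; rewrite -ltNge => /fL.
split.
  have /(integrable_mkcond _ mI) : leb.-integrable `[- L, L]%classic (EFin \o f).
    by apply: continuous_compact_integrable; [exact: segment_compact|exact: continuous_subspaceT].
  by rewrite restrict_EFin -fE.
rewrite fE -Rintegral_mkcond (Rintegral_derivative _ Ff)//.
by rewrite gtrN.
Qed.

End boxes.

Section mollifier_mass.
Context {R : realType}.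
Local Notation mu := (mu2 R).
Local Notation leb := (@lebesgue_measure R).

Lemma continuous_eta (e : R) : continuous (eta e).
Proof. by move=> x; apply: differentiable_continuous; exact/derivable1_diffP/smooth1_derivable/smooth1_eta. Qed.

Lemma integral_eta (e : R) : 0 < e ->
  leb.-integrable setT (EFin \o eta e) /\ \int[leb]_x eta e x = 1.
Proof.
move=> e0; have [||||i ->] := @Rintegral_supported _ (derive1 (ramp e)) (eta e) (2 * e).
- by rewrite mulr_gt0.
- by move=> x; exact/smooth1_is_derive/smooth1_derive/smooth1_ramp.
- exact: continuous_eta.
- by move=> x ex; apply: eta_out => //; apply: le_lt_trans ex; lra.
by split=> //; rewrite derive1_ramp_gt ?derive1_ramp_lt ?subr0//; lra.
Qed.

Lemma integral_etaN (e : R) : 0 < e ->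
  leb.-integrable setT (EFin \o (fun x => eta e (- x))) /\ \int[leb]_x eta e (- x) = 1.
Proof.
move=> e0; have [||||i ->] := @Rintegral_supported _ (fun x => - derive1 (ramp e) (-1 * x))
   (fun x => eta e (- x)) (2 * e).
- by rewrite mulr_gt0.
- move=> x; have d := is_derive_scale (-1) x (smooth1_derive (smooth1_ramp e)).
  by have := is_deriveN d; rewrite mulN1r mulrN1 opprK.
- by move=> x; apply: continuous_comp; [exact: opp_continuous|exact: continuous_eta].
- by move=> x ex; apply: eta_out => //; rewrite normrN; apply: le_lt_trans ex; lra.
split=> //; rewrite opprK !mulN1r opprK.
by rewrite derive1_ramp_lt ?derive1_ramp_gt ?oppr0 ?add0r//; lra.
Qed.

Lemma test_rhoN (e : R) : 0 < e -> test_fun (fun z => rho e (- z)).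
Proof.
move=> e0; apply: (@test_funP _ _ e) => [|x /(rho_neq0 e0)]; last by rewrite /= !normrN.
apply: smoothM; last first.
  have -> : (fun x : R * R => eta e (- (- x).2)) = fun x => eta e x.2.
    by apply/funext => x; rewrite opprK.
  exact: smooth_snd (smooth1_eta e).
have -> : (fun x : R * R => eta e (- x).1) = fun x => (fun u => eta e (-1 * u + 0)) x.1.
  by apply/funext => x; rewrite mulN1r addr0.
exact: smooth_fst (smooth1_affine (-1) 0 (smooth1_eta e)).
Qed.

Lemma integral_rhoN (e : R) : 0 < e -> \int[mu]_z rho e (- z) = 1.
Proof.
move=> e0; have [i1 E1] := integral_eta e0; have [i2 E2] := integral_etaN e0.
have [_ <-] := @Rintegral_fubini1 _ _ _ _ _ leb leb _ (integrable_test (test_rhoN e0)).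
transitivity (\int[leb]_x eta e (- x)) => //; apply: eq_Rintegral => x _.
transitivity (\int[leb]_y (eta e (- x) * eta e y)).
  by apply: eq_Rintegral => y _; rewrite /rho /= opprK.
by rewrite (RintegralZl _ measurableT i1) E1 mulr1.
Qed.

(** A height of at most [(C / e) ^+ 2] on a square of area [(2 * e) ^+ 2]: the bound does not depend
    on [e]. *)
Lemma mass_rhoN : exists2 Z : R, 0 < Z & forall e, 0 < e -> \int[mu]_z `|rho e (- z)| <= Z.
Proof.
have [C C0 CP] := @eta_bound R; exists (4 * C ^+ 2) => [|e e0].
  by rewrite mulr_gt0// exprn_gt0.
have tr := test_rhoN e0; have [mr [M [r [_ _ MP rP]]]] := test_fun_data tr.
have mb : measurable_fun setT (\1_(box e) : plane R -> R).
  by apply: measurable_indic; exact: measurable_boxr.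
have K0 : 0 <= (C / e) ^+ 2 by rewrite sqr_ge0.
have ib : mu.-integrable setT (EFin \o (\1_(box e) : plane R -> R)).
  apply: (@integrable_bounded_supported _ _ 1 e) => // z; rewrite indicE.
    by case: (_ \in _); rewrite /= ?normr1 ?normr0.
  by case: (boolP (z \in _)); rewrite ?inE ?eqxx.
have le : forall z, `|rho e (- z)| <= (C / e) ^+ 2 * \1_(box e) z.
  move=> z; have [->|rz] := eqVneq (rho e (- z)) 0; first by rewrite normr0 mulr_ge0// indicE.
  have zb : box e z by apply/boxP; have := rho_neq0 e0 rz; rewrite /= !normrN.
  rewrite indicE mem_set// mulr1 normrM expr2 ler_pM//; first exact: CP.
  by exact: CP.
apply: (@le_trans _ _ (\int[mu]_z ((C / e) ^+ 2 * \1_(box e) z))).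
  apply: le_Rintegral => //; last exact: integrableRZ.
  by have := integrable_norm (integrable_test tr).
rewrite RintegralZl// /Rintegral integral_indic ?setIT//; last exact: measurable_boxr.
rewrite /box mu2_box; try lra; rewrite /=.
have en := lt0r_neq0 e0.
by rewrite (_ : _ * _ = 4 * C ^+ 2)//; field.
Qed.

End mollifier_mass.

(** * Convergence of mollifications in energy *)

Section weighted_mean.
Context {R : realType}.
Local Notation mu := (mu2 R).
Variables (kap g : plane R -> R) (p : nat).
Hypotheses (p12 : (0 < p <= 2)%N) (ik : mu.-integrable setT (EFin \o kap))
  (mg : measurable_fun setT g) (ikg : mu.-integrable setT (EFin \o (fun h => kap h * g h))).
Let Z := \int[mu]_h `|kap h|.
Hypothesis Z0 : 0 < Z.

(** Jensen's inequality for a kernel of any sign. For [p = 2] it comes from the positivity of the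
    integral of [|kap| * (Z * |g| - A) ^+ 2], which equals [Z * (Z * b - A ^+ 2)]. *)
Lemma weighted_mean_pow :
  ((`|\int[mu]_h (kap h * g h)| ^+ p)%:E <=
   (Z ^+ p.-1)%:E * \int[mu]_h (`|kap h| * `|g h| ^+ p)%:E)%E.
Proof.
have mk := integrableR_measurable ik.
have iak : mu.-integrable setT (EFin \o (fun h => `|kap h|)) by have := integrable_norm ik.
have iakg : mu.-integrable setT (EFin \o (fun h => `|kap h| * `|g h|)).
  have := integrable_norm ikg; congr integrable.
  by apply/funext => h /=; rewrite normrM.
have A1 : `|\int[mu]_h (kap h * g h)| <= \int[mu]_h (`|kap h| * `|g h|).
  apply: le_trans (le_normr_Rintegral _ ikg) _ => //.
  by under eq_Rintegral do rewrite normrM.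
have [p1|p2] : p = 1%N \/ p = 2%N by move: p12; case: (p) => [|[|[|]]]//; [left|right].
  rewrite p1 expr1 expr0 mul1e.
  under eq_integral do rewrite expr1.
  rewrite [leRHS](_ : _ = (\int[mu]_h (`|kap h| * `|g h|))%:E) ?lee_fin//.
  by rewrite /Rintegral fineK//; exact: integrable_fin_num.
rewrite p2 expr1 /=.
set B := (\int[mu]_h _)%E.
have B0 : (0 <= B)%E by apply: integral_ge0 => h _; rewrite lee_fin mulr_ge0// exprn_ge0.
have [->|Boo] := eqVneq B +oo%E; first by rewrite mulry gtr0_sg// mul1e leey.
have mkg : measurable_fun setT (fun h => `|kap h| * `|g h| ^+ 2).
  by apply: measurable_funM; [|apply: measurable_funX]; exact: measurableT_comp.
have iB : mu.-integrable setT (EFin \o (fun h => `|kap h| * `|g h| ^+ 2)).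
  apply/integrableP; split; first exact/measurable_EFinP.
  under eq_integral do rewrite /= ger0_norm ?mulr_ge0 ?exprn_ge0//.
  by rewrite ltey.
rewrite /B [X in (_ * X)%E](_ : _ = (\int[mu]_h (`|kap h| * `|g h| ^+ 2))%:E); last first.
  by rewrite /Rintegral fineK//; exact: integrable_fin_num.
set b := Rintegral mu setT (fun h => `|kap h| * `|g h| ^+ 2); set A := Rintegral mu setT (fun h => `|kap h| * `|g h|) in A1.
have : 0 <= \int[mu]_h ((Z ^+ 2 * (`|kap h| * `|g h| ^+ 2) - (2 * Z * A) * (`|kap h| * `|g h|))
                        + A ^+ 2 * `|kap h|).
  apply: Rintegral_ge0 => h _; rewrite (_ : _ + _ = `|kap h| * (Z * `|g h| - A) ^+ 2).
    by rewrite mulr_ge0// sqr_ge0.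
  by ring.
rewrite RintegralD//; last 2 first.
- by apply: integrableRB; exact: integrableRZ.
- exact: integrableRZ.
rewrite RintegralB//; do ?exact: integrableRZ.
rewrite !RintegralZl// -/b -/A -/Z => H.
have A2 : A ^+ 2 <= Z * b.
  by rewrite -(ler_pM2l Z0) -subr_ge0; move: H; congr (0 <= _); ring.
rewrite -EFinM lee_fin (le_trans _ A2)// lerXn2r ?nnegrE//.
exact: le_trans A1.
Qed.

End weighted_mean.

Section moll.
Context {R : realType}.
Local Notation mu := (mu2 R).

(** The convolution of [f] with [rho e], as an average with weight [f], so that its regularity is
    that of [rho e]. *)
Definition moll (e : R) (f : plane R -> R) : scalar_field R :=
  average mu f (fun w => - w) (rho e).

Lemma measurable_oppp : measurable_fun setT ((fun w => - w) : plane R -> plane R).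
Proof.
by apply: measurable_fun_pair; exact: measurableT_comp.
Qed.

Lemma shift2C (h z : R * R) : shift2 h z = shift2 z h.
Proof. by rewrite /shift2 addrC [z.2 + _]addrC. Qed.

Lemma sub_shift2 (h z : R * R) : z - shift2 z h = - h.
Proof.
by case: h z => [a b] [c d]; apply/pair_equal_spec; rewrite /=; split; ring.
Qed.

Section estimate.
Variables (e : R) (f : plane R -> R) (e0 : 0 < e).
Hypothesis jf : mu.-integrable setT (EFin \o f).
Let mf := integrableR_measurable jf.
Let kap (h : plane R) := rho e (- h).
Let ik : mu.-integrable setT (EFin \o kap). Proof. exact/integrable_test/test_rhoN. Qed.
Let mk := integrableR_measurable ik.

Lemma integrable_moll z : mu.-integrable setT (EFin \o (fun w => f w * rho e (z - w))).
Proof. exact: integrable_translate jf measurable_oppp _ z (test_rho e0). Qed.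

Let ikf z : mu.-integrable setT (EFin \o (fun h => kap h * f (shift2 h z))).
Proof.
have := integrable_shift2 z (integrable_moll z); congr integrable.
by apply/funext => h; rewrite /kap [RHS]/= mulrC shift2C -(sub_shift2 h z).
Qed.

(** Since the kernel has mass 1, the error is a weighted mean of increments of [f], to which mean
    continuity applies. *)
Lemma moll_sub z : moll e f z - f z = \int[mu]_h (kap h * (f (shift2 h z) - f z)).
Proof.
under [RHS]eq_Rintegral do rewrite mulrBr [kap _ * f z]mulrC.
rewrite RintegralB//; last exact: integrableRZ.
rewrite RintegralZl// integral_rhoN// mulr1; congr (_ - _).
rewrite /moll /average -(Rintegral_shift2 z (integrable_moll z)).
by apply: eq_Rintegral => h _; rewrite sub_shift2 mulrC shift2C.
Qed.

Let Z := \int[mu]_h `|kap h|.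

Let Z1 : 1 <= Z.
Proof.
rewrite -(integral_rhoN e0); apply: le_Rintegral => //.
  by have := integrable_norm ik.
by move=> h _; exact: ler_norm.
Qed.

Lemma moll_smooth : smooth (moll e f).
Proof.
apply/smooth_CkP => n; apply: Ck_average => //; [exact: measurable_oppp|exact: test_rho].
Qed.

(** After the inequality for weighted means, Tonelli puts the integral in [z] inside, where the
    hypothesis bounds it for each [h] in the support of the kernel. *)
Lemma energy_moll p t : (0 < p <= 2)%N ->
  (forall h : R * R, `|h.1| <= e -> `|h.2| <= e ->
     (energy p (fun z => (f (shift2 h z) - f z)%R) <= t%:E)%E) ->
  (energy p (fun z => (moll e f z - f z)%R) <= (Z ^+ p * t)%:E)%E.
Proof.
move=> p12 ft; have p0 : (0 < p)%N by case/andP: p12.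
have Z0 : 0 < Z by exact: lt_le_trans Z1.
have mm : measurable_fun setT (moll e f : plane R -> R).
  exact: measurable_continuous_plane (smooth_continuous moll_smooth).
pose F (x : plane R * plane R) := (`|kap x.2| * `|f (shift2 x.2 x.1) - f x.1| ^+ p)%:E.
have ms : measurable_fun setT (fun x : plane R * plane R => shift2 x.2 x.1).
  apply: measurable_fun_pair; apply: measurable_funD.
  - exact: measurableT_comp measurable_fst measurable_fst.
  - exact: measurableT_comp measurable_fst measurable_snd.
  - exact: measurableT_comp measurable_snd measurable_fst.
  - exact: measurableT_comp measurable_snd measurable_snd.
have mF : measurable_fun setT F.
  apply/measurable_EFinP; apply: measurable_funM.
    exact: measurableT_comp (measurableT_comp mk measurable_snd).
  apply: measurable_funX; apply: measurableT_comp => //; apply: measurable_funB.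
    exact: measurableT_comp mf ms.
  exact: measurableT_comp mf measurable_fst.
have F0 x : (0 <= F x)%E by rewrite lee_fin mulr_ge0// exprn_ge0.
have md h : measurable_fun setT (fun z => f (shift2 h z) - f z).
  by apply: measurable_funB => //; exact: measurable_shifted.
apply: (@le_trans _ _ (\int[mu]_z ((Z ^+ p.-1)%:E * \int[@area R]_h F (z, h)))%E).
  have mG := measurable_funeM (Z ^+ p.-1)%:E
    (@measurable_fun_fubini_tonelli_F _ _ _ _ _ (@area R) F mF F0).
  have mA : measurable_fun setT (fun z => (`|moll e f z - f z| ^+ p)%:E).
    by apply: measurable_abse_pow; exact: measurable_funB.
  apply: ge0_le_integral; do ?[exact: mG|exact: mA|by []|by move=> z _; rewrite lee_fin exprn_ge0
    |by move=> z _; rewrite mule_ge0 ?lee_fin ?exprn_ge0 ?ltW// integral_ge0].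
  move=> z _; rewrite moll_sub; apply: weighted_mean_pow => //.
    apply: measurable_funB => //; rewrite (_ : (fun h => _) = fun h => f (shift2 z h)).
      exact: measurable_shifted.
    by apply/funext => h; rewrite shift2C.
  have := integrableRB (ikf z) (integrableRZ (f z) ik); congr integrable.
  by apply/funext => h /=; rewrite mulrBr [f z * _]mulrC.
have mF1 := @measurable_fun_fubini_tonelli_F _ _ _ _ _ (@area R) F mF F0.
rewrite ge0_integralZl; do ?[exact: measurableT|exact: mF1
  |by move=> z _; exact: integral_ge0|by rewrite lee_fin exprn_ge0// ltW].
have -> : (\int[mu]_z \int[@area R]_h F (z, h) = \int[mu]_h \int[mu]_z F (z, h))%E.
  exact: (@fubini_tonelli _ _ _ _ _ (@area R) (@area R) F mF F0).
rewrite -[in leRHS](prednK p0) exprSr -mulrA EFinM.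
apply: lee_wpmul2l; first by rewrite lee_fin exprn_ge0// ltW.
have iak : mu.-integrable setT (EFin \o (fun h => `|kap h|)) by have := integrable_norm ik.
have -> : (Z * t)%:E = (\int[mu]_h (`|kap h| * t)%:E)%E.
  rewrite /Z -RintegralZr// /Rintegral fineK//; apply: integrable_fin_num => //.
  by have := integrableRZ t iak; congr integrable; apply/funext => h /=; rewrite mulrC.
have t0 : 0 <= t.
  rewrite -lee_fin; apply: le_trans (energy_ge0 p _) (ft 0 _ _); by rewrite /= normr0 ltW.
have mG := @measurable_fun_fubini_tonelli_G _ _ _ _ _ (@area R) F mF F0.
have mA : measurable_fun setT (fun h => (`|kap h| * t)%:E).
  by apply/measurable_EFinP; apply: measurable_funM => //; exact: measurableT_comp.
apply: ge0_le_integral; do ?[exact: mG|exact: mA|by []|by move=> h _; exact: integral_ge0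
  |by move=> h _; rewrite lee_fin mulr_ge0].
move=> h _; rewrite /F/=; under eq_integral do rewrite EFinM.
rewrite ge0_integralZl; do ?[exact: measurableT|exact: measurable_abse_pow
  |by move=> z _; rewrite lee_fin exprn_ge0|by rewrite lee_fin].
have [k0|kn0] := eqVneq (kap h) 0; first by rewrite k0 normr0 !mul0r mul0e.
rewrite EFinM lee_wpmul2l ?lee_fin//.
by have := rho_neq0 e0 kn0; rewrite /= !normrN => -[h1 h2]; exact: ft.
Qed.

End estimate.

Lemma moll_cvg p f : (0 < p <= 2)%N -> mu.-integrable setT (EFin \o f) -> mean_continuous p f ->
  forall t : R, 0 < t -> exists2 d, 0 < d & forall e, 0 < e < d ->
  (energy p (fun z => (moll e f z - f z)%R) <= t%:E)%E.
Proof.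
move=> p12 jf cf t t0; have [Z Z0 ZP] := @mass_rhoN R.
have Zp : 0 < Z ^+ p by rewrite exprn_gt0.
have [d d0 dP] := cf _ (divr_gt0 t0 Zp); exists d => // e /andP[e0 ed].
apply: le_trans (energy_moll e0 jf p12 (t := t / Z ^+ p) _) _.
  by move=> h h1 h2; apply: dP; exact: le_lt_trans ed.
rewrite lee_fin -[leRHS](mulfVK (lt0r_neq0 Zp)) mulrC ler_wpM2l//; first by rewrite divr_ge0 ?ltW.
by apply: lerXn2r; rewrite ?nnegrE; [exact: Rintegral_ge0|exact: ltW|exact: ZP].
Qed.

End moll.

(** * The fundamental lemma of the calculus of variations *)

Section fundamental_lemma.
Context {R : realType}.
Local Notation mu := (mu2 R).

Lemma ae_sub (P Q : R * R -> Prop) : {ae mu, forall z, P z} -> (forall z, P z -> Q z) ->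
  {ae mu, forall z, Q z}.
Proof.
move=> [N [mN N0 PN]] PQ; exists N; split=> // z nQ; apply: PN => Pz.
by apply: nQ; exact: PQ.
Qed.

Lemma ae_and (P Q : R * R -> Prop) : {ae mu, forall z, P z} -> {ae mu, forall z, Q z} ->
  {ae mu, forall z, P z /\ Q z}.
Proof.
move=> [N [mN N0 PN]] [M [mM M0 QM]]; exists (N `|` M); split.
- exact: measurableU.
- by rewrite measureU0.
- move=> z /not_andP[nP|nQ]; [left; exact: PN|right; exact: QM].
Qed.

Lemma near_ball_box (q : R * R) (r : R) : exists r', forall z, ball q r z -> ocbox r' z.
Proof.
exists (`|q.1| + `|q.2| + r + 1) => z /ballE[z1 z2]; split; rewrite /= in_itv/=.
  have := ler_norm q.1; have := ler_norm (- q.1); have := normr_ge0 q.2; rewrite normrN.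
  by move: z1; rewrite ltr_norml => /andP[? ?] ? ? ?; apply/andP; split; lra.
have := ler_norm q.2; have := ler_norm (- q.2); have := normr_ge0 q.1; rewrite normrN.
by move: z2; rewrite ltr_norml => /andP[? ?] ? ? ?; apply/andP; split; lra.
Qed.

Lemma ball_box (q z w : R * R) (r e : R) : ball q r z -> `|z.1 - w.1| <= e ->
  `|z.2 - w.2| <= e -> e <= r -> ball q (2 * r) w.
Proof.
move=> /ballE[z1 z2] w1 w2 er; apply/ballE; rewrite mulr2n mulrDl mul1r; split.
  by rewrite -(subrKA z.1) (le_lt_trans (ler_normD _ _))// ltr_leD// (le_trans w1).
by rewrite -(subrKA z.2) (le_lt_trans (ler_normD _ _))// ltr_leD// (le_trans w2).
Qed.

Lemma energy_set0_ae p (f : plane R -> R) (B : set (plane R)) : (0 < p)%N ->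
  measurable B -> measurable_fun setT f ->
  (forall t : R, 0 < t -> ((\int[mu]_(z in B) (`|f z| ^+ p)%:E) <= t%:E)%E) ->
  {ae mu, forall z, B z -> f z = 0}.
Proof.
move=> p0 mB mf ft.
have I0 : (\int[mu]_(z in B) `|(`|f z| ^+ p)%:E| = 0)%E.
  under eq_integral do rewrite gee0_abs ?lee_fin ?exprn_ge0//.
  apply/eqP; rewrite eq_le integral_ge0 ?andbT; last by move=> z _; rewrite lee_fin exprn_ge0.
  by apply/lee_addgt0Pr => t t0; rewrite add0e; exact: ft.
have mF : measurable_fun B (fun z => (`|f z| ^+ p)%:E).
  by apply: measurable_funS (measurable_abse_pow p mf).
have /ae_sub := (ae_eq_integral_abs mu mB mF).1 I0; apply => z h Bz.
by have /= /eqP := h Bz; rewrite eqe expf_eq0 p0/= normr_eq0 => /eqP.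
Qed.

(** Cutting [g] to the doubled square makes it integrable, and for [e < r] its mollification at a
    point of the square does not see the cut. These mollifications vanish on the square and converge
    in L^1 to the cut function, which is therefore 0 there. *)
Lemma ae_zero_square (g : scalar_field R) (q : R * R) (r : R) : 0 < r ->
  mu.-integrable (ball q (2 * r)) (EFin \o g) ->
  (forall z e, 0 < e < r -> ball q r z -> \int[mu]_w (g w * rho e (z - w)) = 0) ->
  {ae mu, forall z, ball q r z -> g z = 0}.
Proof.
move=> r0 gi g0; pose B2 : set (plane R) := ball q (2 * r).
have mB2 : measurable B2 by exact: measurable_ball_plane.
have mB : measurable (ball q r : set (plane R)) by exact: measurable_ball_plane.
pose f : plane R -> R := g \_ B2.
have jf : mu.-integrable setT (EFin \o f).
  by rewrite /f -restrict_EFin; exact/(integrable_mkcond _ mB2).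
have mf := integrableR_measurable jf.
have [r' r'P] := near_ball_box q (2 * r).
have cf : mean_continuous 1 f.
  apply: (@mean_continuous_Lp _ 1 _ r') => // [z zr|].
    by rewrite /f patchE memNset// => /r'P.
  by have /integrableP[_] := jf; under eq_integral do rewrite /= -[`|_|%R]expr1.
have B12 z : ball q r z -> B2 z by apply: le_ball; lra.
have main : {ae mu, forall z, ball q r z -> f z = 0}.
  apply: (@energy_set0_ae 1) => // t t0.
  have [d d0 dP] := @moll_cvg _ 1 f isT jf cf t t0.
  pose e := Num.min (d / 2) (r / 2).
  have e0 : 0 < e by rewrite lt_min !divr_gt0.
  have ed : e < d by rewrite gt_min; apply/orP; left; lra.
  have er : e < r by rewrite gt_min; apply/orP; right; lra.
  have /dP : 0 < e < d by rewrite e0.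
  apply: le_trans; have mm := measurable_continuous_plane (smooth_continuous (moll_smooth e0 jf)).
  have md : measurable_fun setT (fun z => moll e f z - f z) by exact: measurable_funB.
  apply: (@le_trans _ _ (\int[mu]_(z in ball q r) (`|moll e f z - f z| ^+ 1)%:E)%E); last first.
    apply: ge0_subset_integral => //; first exact: measurable_abse_pow.
  rewrite le_eqVlt; apply/orP; left; apply/eqP; apply: eq_integral => z /set_mem zB.
  have -> : moll e f z = 0.
    have ee : 0 < e < r by rewrite e0.
    apply: etrans (g0 z e ee zB).
    apply: eq_Rintegral => w _; have [->|nz] := eqVneq (rho e (z - w)) 0.
      by rewrite !mulr0.
    congr (_ * _); rewrite /f patchE mem_set//; have [h1 h2] := rho_neq0 e0 nz.
    exact: ball_box zB h1 h2 (ltW er).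
  by rewrite sub0r normrN.
move: main => /ae_sub; apply => z h zB; have := h zB.
by rewrite /f patchE mem_set//; exact: B12.
Qed.

Lemma test_rho_at (z : R * R) (e : R) : 0 < e ->
  test_fun (fun w => rho e (z - w)) /\
  supp (fun w : R * R => rho e (z - w)) `<=` [set w | `|z.1 - w.1| <= e /\ `|z.2 - w.2| <= e].
Proof.
move=> e0; have nz w : rho e (z - w) != 0 -> `|z.1 - w.1| <= e /\ `|z.2 - w.2| <= e.
  by move=> /(rho_neq0 e0).
split; last first.
  apply: supp_sub_closed => //.
  have -> : [set w : R * R | `|z.1 - w.1| <= e /\ `|z.2 - w.2| <= e] =
     (fst @^-1` [set u | `|z.1 - u| <= e]) `&` (snd @^-1` [set u | `|z.2 - u| <= e]) by [].
  have cl a : closed [set u : R | `|a - u| <= e].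
    have -> : [set u : R | `|a - u| <= e] = `[a - e, a + e]%classic.
      apply/seteqP; split=> u /=; rewrite in_itv/= ler_norml => /andP[? ?]; apply/andP; split; lra.
    exact: itv_closed.
  have c1 : continuous (fst : R * R -> R) by move=> u; apply: cvg_fst.
  have c2 : continuous (snd : R * R -> R) by move=> u; apply: cvg_snd.
  by apply: closedI; apply: closed_comp => // u _; do ?[exact: c1|exact: c2|exact: cl].
apply: (@test_funP _ _ (e + `|z.1| + `|z.2|)) => [|w /nz[h1 h2]].
  apply: smoothM.
    have -> : (fun w : R * R => eta e (z - w).1) = fun w => (fun u => eta e (-1 * u + z.1)) w.1.
      by apply/funext => w; rewrite mulN1r addrC.
    exact: smooth_fst (smooth1_affine (-1) z.1 (smooth1_eta e)).
  have -> : (fun w : R * R => eta e (- (z - w).2)) = fun w => (fun u => eta e (1 * u + - z.2)) w.2.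
    by apply/funext => w; rewrite mul1r /= opprB.
  exact: smooth_snd (smooth1_affine 1 (- z.2) (smooth1_eta e)).
have H (a u : R) : `|a - u| <= e -> `|u| <= e + `|a|.
  move=> h; rewrite -[u](subrK a) (le_trans (ler_normD _ _))// lerD2r distrC//.
have := H _ _ h1; have := H _ _ h2; have := normr_ge0 z.1; have := normr_ge0 z.2.
by move=> ? ? ? ?; split; lra.
Qed.

(** Tested with the mollifiers [rho e (z - _)] only, because these are the test functions for which
    the integral of the potential is computed. *)
Lemma ae_zero_open (g : scalar_field R) (U : set (R * R)) : open U -> loc_integrable g ->
  (forall z e, 0 < e -> (forall w, `|z.1 - w.1| <= e -> `|z.2 - w.2| <= e -> U w) ->
     \int[mu]_w (g w * rho e (z - w)) = 0) ->
  {ae mu, forall z, U z -> g z = 0}.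
Proof.
move=> oU lg g0.
have : forall n : nat, {ae mu, forall z,
    forall q, unpickle n = Some q -> 0 < ratr q.2 :> R -> rational_ball 2 q `<=` U ->
    rational_ball 1 q z -> g z = 0}.
  move=> n; case: (unpickle n) => [q|]; last by apply: aeW.
  have [[q0 qU]|H] := pselect (0 < ratr q.2 :> R /\ rational_ball 2 q `<=` U); last first.
    by apply: aeW => z q' [<-] q0 qU; exfalso; apply: H.
  have : {ae mu, forall z, ball ((ratr q.1.1, ratr q.1.2) : R * R) (ratr q.2) z -> g z = 0}.
    apply: ae_zero_square => //.
      have [r rP] := near_ball_box (ratr q.1.1, ratr q.1.2) (2 * ratr q.2).
      apply: (integrableS _ _ _ (lg _ (compact_box (r := r)))); do ?exact: measurable_ball_plane.
      - exact: measurable_boxr.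
      - move=> z /rP[/= h1 h2]; split; exact: subset_itv_oc_cc.
    move=> z e /andP[e0 er] zq.
    by apply: g0 => // w w1 w2; apply: qU; exact: ball_box zq w1 w2 (ltW er).
  by move=> /ae_sub; apply => z h q' [<-] _ _; rewrite /rational_ball mul1r.
move=> /ae_foralln/ae_sub; apply => z h Uz.
have [q [q0 qz qU]] := rational_ball_near oU Uz.
by apply: (h (pickle q) q) => //; exact: pickleK.
Qed.

Lemma dist_zero_ae (g : scalar_field R) (U : set (R * R)) : open U -> loc_integrable g ->
  (forall phi, test_fun phi -> supp phi `<=` U -> dist_of g phi = 0) ->
  {ae mu, forall z, U z -> g z = 0}.
Proof.
move=> oU lg g0; apply: ae_zero_open => // z e e0 zU.
have [t s] := test_rho_at z e0; apply: g0 => // w /s[h1 h2]; exact: zU.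
Qed.

Lemma dist_eq0_ae (g : scalar_field R) : loc_integrable g ->
  (forall phi, test_fun phi -> dist_of g phi = 0) -> {ae mu, forall z, g z = 0}.
Proof.
move=> lg g0; have := @dist_zero_ae g setT openT lg (fun phi t _ => g0 phi t).
by move=> /ae_sub; apply => z; exact.
Qed.

Lemma dist_of_ae0 (g : scalar_field R) phi : loc_integrable g -> test_fun phi ->
  {ae mu, forall z, g z * phi z = 0} -> dist_of g phi = 0.
Proof.
move=> lg tphi g0; rewrite /dist_of /Rintegral.
have mi := measurable_int _ (integrable_loc_test lg tphi).
rewrite (@ae_eq_integral _ _ _ mu setT (cst 0%E)) ?integral0//.
by move: g0 => /ae_sub; apply => z gz _ /=; rewrite gz.
Qed.

Lemma dist_supp_closed (T : functional R) : closed (dist_supp T).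
Proof.
move=> x clx U oU Ux; have [y [sy Uy]] : dist_supp T `&` U !=set0.
  by apply: clx; exact: open_nbhs_nbhs.
exact: sy.
Qed.

(** Each point off [A] lies in a rational ball on which [g] is the zero distribution, and there are
    countably many such balls. *)
Lemma dist_supp_ae (g : scalar_field R) (A : set (R * R)) : loc_integrable g -> closed A ->
  dist_supp (dist_of g) `<=` A -> {ae mu, forall z, ~ A z -> g z = 0}.
Proof.
move=> lg cA gA.
have : forall n : nat, {ae mu, forall z,
    forall q, unpickle n = Some q -> 
    (forall phi, test_fun phi -> supp phi `<=` rational_ball 1 q -> dist_of g phi = 0) ->
    rational_ball 1 q z -> g z = 0}.
  move=> n; case: (unpickle n) => [q|]; last by apply: aeW.
  have [H|H] := pselect (forall phi, test_fun phi -> supp phi `<=` rational_ball 1 q ->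
    dist_of g phi = 0); last by apply: aeW => z q' [<-].
  have := @dist_zero_ae g (rational_ball 1 q) (ball_open _ _) lg H.
  by move=> /ae_sub; apply => z h q' [<-].
move=> /ae_foralln/ae_sub; apply => z h nAz.
have : ~ dist_supp (dist_of g) z by move=> /gA.
rewrite /dist_supp/= => /existsNP[U] /not_implyP[oU] /not_implyP[Uz] nU.
have [q [q0 qz qU]] := rational_ball_near oU Uz.
apply: (h (pickle q) q) => //; first exact: pickleK.
move=> phi tphi sphi; apply: contrapT => /eqP gp; apply: nU; exists phi; split=> // w /sphi wq.
by apply: qU; apply: le_ball wq; rewrite ler_pM2r// ler1n.
Qed.

End fundamental_lemma.

(** * Test fields cut along a ray *)

Section gluing.
Context {R : realType}.
Implicit Types O : set (R * R).

(* One step of the gluing: interpolating with a bump keeps the equality with v wherever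
   both interpolants have it. *)
Lemma glue_test O (v : scalar_field R) : compact (closure O) ->
  (forall p, closure O p -> exists d w, [/\ 0 < d, smooth w &
     forall x, O x -> ball p d x -> w x = v x]) ->
  exists2 u, test_fun u & forall x, O x -> u x = v x.
Proof.
move=> cO vw.
pose good S := exists2 u : scalar_field R, test_fun u & forall x, O x -> S x -> u x = v x.
have good0 : good set0 by exists (fun=> 0); first exact: test0.
have step S p d w : 0 < d -> smooth w -> (forall x, O x -> ball p d x -> w x = v x) ->
    good S -> good (S `|` ball p (d / 2)).
  move=> d0 sw wv [u tu uv]; have tb := test_bump p d0.
  exists (fun x => w x * bump d p x + (1 - bump d p x) * u x).
    apply: testD; first exact: testM.
    by apply: testM => //; apply: smoothB; [exact: smooth_cst|exact: test_smooth].
  move=> x Ox Sx; have [b0|bn] := eqVneq (bump d p x) 0.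
    rewrite b0 mulr0 add0r subr0 mul1r; apply: uv => //.
    case: Sx => // /ballE[x1 x2]; exfalso; move/eqP: b0; apply/negP.
    by rewrite bump_eq1 ?oner_eq0// ltW.
  rewrite wv//; last exact/ballE/(bump_neq0 d0).
  case: Sx => [Sx|/ballE[x1 x2]]; first by rewrite uv//; ring.
  by rewrite bump_eq1 ?ltW// mulr1 subrr mul0r addr0.
have [F FP] : exists F : R * R -> R * scalar_field R, forall p, closure O p ->
    [/\ 0 < (F p).1, smooth (F p).2 &
     forall x, O x -> ball p (F p).1 x -> (F p).2 x = v x].
  have /choice[F FP] : forall p, exists dw : R * scalar_field R, closure O p ->
      [/\ 0 < dw.1, smooth dw.2 & forall x, O x -> ball p dw.1 x -> dw.2 x = v x].
    move=> p; have [/vw[d [w [d0 sw wv]]]|nc] := pselect (closure O p); first by exists (d, w).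
    by exists (0, cst 0) => /nc.
  by exists F.
pose cover_of (s : seq (R * R)) := \bigcup_(p in [set p | p \in s]) ball p ((F p).1 / 2).
pose G := [set s : seq (R * R) | forall p, p \in s -> closure O p].
(* The filter of properties shared by all sets that contain some finite union of half-radius balls.
   For this filter the near-covering form of compactness yields a finite subcover. *)
pose FF := filter_from G (fun s => [set T : set (R * R) | cover_of s `<=` T]).
have FFf : Filter FF.
  apply: filter_from_filter; first by exists [::].
  move=> s t Gs Gt; exists (s ++ t) => [p|T sT].
    by rewrite mem_cat => /orP[]; [exact: Gs|exact: Gt].
  by split=> x [p /= ps xp]; apply: sT; exists p; rewrite //= mem_cat ps ?orbT.
have [|s Gs sP] := (compact_near_coveringP _).1 cO _ FF (fun T x => T x) FFf.
  move=> p cp; have [d0 _ _] := FP p cp.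
  exists (ball p ((F p).1 / 2), [set T | cover_of [:: p] `<=` T]) => /=.
    split; first by apply: nbhsx_ballx; rewrite divr_gt0.
    by exists [:: p] => // q; rewrite inE => /eqP->.
  by move=> [x T] [/= xp pT]; apply: pT; exists p; rewrite //= inE.
have : good (cover_of s).
  elim: s Gs {sP} => [|p s IH] sO.
    by move: good0; congr good; apply/seteqP; split=> // x [].
  have [d0 sw wv] := FP p (sO _ (mem_head _ _)).
  have /(step _ _ _ _ d0 sw wv) : good (cover_of s).
    by apply: IH => q qs; apply: sO; rewrite inE qs orbT.
  congr good; apply/seteqP; split=> x.
    by move=> [[q /= qs xq]|xp]; [exists q; rewrite /= ?inE ?qs ?orbT|exists p; rewrite /= ?mem_head].
  by move=> [q /=]; rewrite inE => /orP[/eqP->|qs] xq; [right|left; exists q].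
move=> [u tu uv]; exists u => // x Ox; apply: uv => //.
exact: (sP (cover_of s) (subset_refl _)) (subset_closure Ox).
Qed.

End gluing.

(** * A test field with a single strain component *)

Section cut_field.
Context {R : realType}.
Variables (O : set (R * R)) (z0 : R * R) (e : R).
Hypotheses (Od : is_domain O) (Osc : simply_connected O) (Olip : lipschitz_boundary O)
  (cO : compact (closure O)) (e0 : 0 < e).
Hypothesis avoid : forall w, closure O w -> ~ (`|w.1 - z0.1| <= e /\ `|w.2 - z0.2| <= e).

(** The components 11 and 12 of its symmetric gradient vanish for every [f], which leaves [d_2 u_2].
    For [f u = k * (u - z0.2)] it is a multiple of the rotation about [z0]. *)
Definition sheared (f : R -> R) : vector_field R := fun i z =>
  if i == ord0 then f z.2 else (z0.1 - z.1) * derive1 f z.2.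

Lemma smooth_sheared f i : smooth1 f -> smooth (sheared f i).
Proof.
move=> sf; rewrite /sheared; have [->|->] := ord2E i; rewrite ?eqxx/=; first exact: smooth_snd.
apply: smoothM; last exact/smooth_snd/smooth1_derive.
apply: smoothB; first exact: smooth_cst.
by apply: (@smooth_fst _ id) => n; exact: Ck1_id.
Qed.

Lemma partial_fst f i (z : R * R) : smooth1 f ->
  partial i (fun x : R * R => f x.1) z = (i == ord0)%:R * derive1 f z.1.
Proof.
move=> sf; have [_ h0 h1] := differentiable_fst_comp (smooth1_derivable (x := z.1) sf).
by have [->|->] := ord2E i; rewrite ?h0 ?h1 ?mul1r ?mul0r.
Qed.

Lemma partial_snd f i (z : R * R) : smooth1 f ->
  partial i (fun x : R * R => f x.2) z = (i == ord_max)%:R * derive1 f z.2.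
Proof.
move=> sf; have [_ h0 h1] := differentiable_snd_comp (smooth1_derivable (x := z.2) sf).
by have [->|->] := ord2E i; rewrite ?h0 ?h1 ?mul1r ?mul0r.
Qed.

Lemma partial_sheared f z : smooth1 f ->
  [/\ partial ord0 (sheared f ord0) z = 0,
      partial ord_max (sheared f ord0) z + partial ord0 (sheared f ord_max) z = 0 &
      partial ord_max (sheared f ord_max) z = (z0.1 - z.1) * derive1 (derive1 f) z.2].
Proof.
move=> sf; have sf' := smooth1_derive sf.
have s1 : smooth (fun x : R * R => z0.1 - x.1).
  apply: smoothB; first exact: smooth_cst.
  by apply: (@smooth_fst _ id) => n; exact: Ck1_id.
have p1 i : partial i (fun x : R * R => z0.1 - x.1) z = - (i == ord0)%:R.
  have := @partial_fst (fun u => -1 * u + z0.1) i z.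
  have -> : (fun x : R * R => -1 * x.1 + z0.1) = fun x => z0.1 - x.1.
    by apply/funext => x; rewrite mulN1r addrC.
  move=> ->; last by apply: (@smooth1_affine _ id) => n; exact: Ck1_id.
  have d : is_derive z.1 1 (fun u => -1 * u + z0.1) (-1).
    have := is_deriveD (is_deriveZ (-1) (is_derive_id z.1 (1 : R))) (is_derive_cst z0.1 z.1 1).
    by rewrite addr0 /GRing.scale/= mulr1.
  by rewrite derive1E (@derive_val _ _ _ _ _ _ _ d) mulrN1.
rewrite /sheared /= !(partial_snd _ _ sf).
rewrite !partialM; do ?[exact: smooth_differentiable|exact/smooth_differentiable/smooth_snd].
rewrite !p1 !(partial_snd _ _ sf') /=.
by split; ring.
Qed.

Lemma derive1_shift f (b u : R) : smooth1 f ->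
  derive1 (fun u => f (u - b)) u = derive1 f (u - b).
Proof.
move=> sf; rewrite derive1E.
have d : is_derive u 1 (fun u => u - b) 1.
  by have := is_deriveB (is_derive_id u (1 : R)) (is_derive_cst b u 1); rewrite subr0.
have := @is_derive1_comp _ f (fun u => u - b) u _ _ (smooth1_is_derive (u - b) sf) d.
rewrite mulr1 => d'.
by rewrite (@derive_val _ _ _ _ _ _ _ d').
Qed.

(** [a] is 0 to the right of [z0] and 1 elsewhere, where the field has to bend across the left ray;
    [k] is the local multiple of the rotation to be added. *)
Definition profile (a k u : R) : R := a * ramp e (u - z0.2) + k * (u - z0.2).

Let smooth1_id : smooth1 (id : R -> R). Proof. by move=> n; exact: Ck1_id. Qed.

Let smooth1_shift f (b : R) : smooth1 f -> smooth1 (fun u => f (u - b)).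
Proof.
move=> sf; have := smooth1_affine 1 (- b) sf; congr smooth1.
by apply/funext => u; rewrite mul1r.
Qed.

Lemma smooth1_profile a k : smooth1 (profile a k).
Proof.
have sc c : smooth1 (cst c : R -> R).
  have := smooth1_affine 0 c smooth1_id; congr smooth1.
  by apply/funext => u; rewrite mul0r add0r.
apply: smooth1D; apply: smooth1M; do ?exact: (sc _).
  exact: smooth1_shift (smooth1_ramp e).
exact: (smooth1_shift z0.2 smooth1_id).
Qed.

Lemma derive1_profile a k :
  derive1 (profile a k) = fun u => a * derive1 (ramp e) (u - z0.2) + k.
Proof.
apply/funext => u; rewrite derive1E.
have d1 := smooth1_is_derive u (smooth1_shift z0.2 (smooth1_ramp e)).
have d2 := smooth1_is_derive u (smooth1_shift z0.2 smooth1_id).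
have d := is_deriveD (is_deriveZ a d1) (is_deriveZ k d2).
rewrite (@derive_val _ _ _ _ _ _ _ d) /GRing.scale/= derive1_shift; last exact: smooth1_ramp.
by rewrite (@derive1_shift id)// [derive1 id _]derive1E derive_id mulr1.
Qed.

Lemma derive2_profile a k u : derive1 (derive1 (profile a k)) u = a * eta e (u - z0.2).
Proof.
rewrite derive1_profile derive1E.
have d1 := smooth1_is_derive u (smooth1_shift z0.2 (smooth1_derive (smooth1_ramp e))).
have d := is_deriveD (is_deriveZ a d1) (is_derive_cst k u 1).
rewrite (@derive_val _ _ _ _ _ _ _ d) /GRing.scale/= derive1_shift ?addr0//.
exact/smooth1_derive/smooth1_ramp.
Qed.

(* The field is a rigid motion on both sides of the ray to the right of z0; the jump across
   the ray is removed by adding the multiple [n] of the rotation about z0. *)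
Lemma cut_field_local : exists v : vector_field R, forall p, closure O p ->
  exists d a k, 0 < d /\ forall x, O x -> ball p d x ->
    (forall i, sheared (profile a k) i x = v i x) /\
    (z0.1 - x.1) * (a * eta e (x.2 - z0.2)) = ramp e (z0.1 - x.1) * eta e (x.2 - z0.2).
Proof.
have Oz0 : ~ O z0.
  move=> Oz; apply: (avoid (subset_closure Oz)); rewrite !subrr normr0; split; exact: ltW.
have [n nP] := sheet_function Od Osc Olip Oz0.
pose J (x : R * R) : R := (z0.2 <= x.2)%R%:R.
pose v : vector_field R := fun i x => if i == ord0
  then (if z0.1 < x.1 then J x * (x.2 - z0.2) else ramp e (x.2 - z0.2)) + n x * (x.2 - z0.2)
  else (z0.1 - x.1) * ((if z0.1 < x.1 then J x else derive1 (ramp e) (x.2 - z0.2)) + n x).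
exists v => p cp.
have [|d1 [k [d10 nk]]] := nP p cp.
  by move=> pz; apply: (avoid cp); rewrite pz !subrr normr0; split; exact: ltW.
have eta0 u : e < `|u - z0.2| -> eta e (u - z0.2) = 0 by exact: eta_out.
(* Off the strip of half-width [e] about the horizontal line through [z0], the sharp and the
   smoothed fields agree. *)
have J0 x : e < `|x.2 - z0.2| -> ramp e (x.2 - z0.2) = J x * (x.2 - z0.2) /\
    derive1 (ramp e) (x.2 - z0.2) = J x.
  rewrite ltr_normr => /orP[h|h].
    have -> : J x = 1 by rewrite /J -subr_ge0 ltW// (lt_trans e0).
    by rewrite ramp_ge ?derive1_ramp_gt ?ltW// mul1r.
  have h' : x.2 - z0.2 < - e by rewrite ltrNr.
  have -> : J x = 0.
    rewrite /J (_ : (_ <= _) = false)//; apply/negbTE; rewrite -ltNge.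
    by rewrite -subr_lt0 (lt_trans h')// oppr_lt0.
  by rewrite ramp_le ?derive1_ramp_lt ?mul0r// ltW.
have shE a k' i x : sheared (profile a k') i x = if i == ord0 then
    a * ramp e (x.2 - z0.2) + k' * (x.2 - z0.2)
    else (z0.1 - x.1) * (a * derive1 (ramp e) (x.2 - z0.2) + k').
  by rewrite /sheared derive1_profile.
(* To the right of [z0], [n + J] is locally constant: the jump of [J] is absorbed. Points of the
   strip have [x.1 >= z0.1 + e], being off the avoided square, so [ramp e (z0.1 - x.1) = 0]
   there. *)
have [px|px] := ltP z0.1 p.1.
  exists (Num.min d1 (p.1 - z0.1)), 0, k; split; first by rewrite lt_min d10 subr_gt0.
  move=> x Ox /ballE[x1 x2]; move: x1 x2; rewrite !lt_min => /andP[x1 x1'] /andP[x2 _].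
  have xz : z0.1 < x.1 by move: x1'; rewrite ltr_norml => /andP[_]; rewrite ltrBlDr; lra.
  have := nk x Ox; rewrite /sheet_jump px -/(J x) => nx.
  have {}nx : n x = k - J x by apply: nx; apply/ballE.
  split=> [i|]; first by rewrite shE /v xz nx; case: ifP => _; ring.
  rewrite mul0r mulr0; have [h|h] := ltP e `|x.2 - z0.2|; first by rewrite eta0// mulr0.
  rewrite ramp_le ?mul0r//; have [//|h'] := leP (z0.1 - x.1) (- e).
  exfalso; apply: (avoid (subset_closure Ox)); split => //.
  by rewrite ler_norml; apply/andP; split; lra.
have nk' x : O x -> ball p d1 x -> n x = k.
  move=> Ox /(nk x Ox) ->; rewrite /sheet_jump (_ : z0.1 < p.1 = false) ?subr0//.
  by apply/negbTE; rewrite -leNgt.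
(* Above or below the strip: points near [p] may lie on either side of the vertical line through
   [z0], but both formulas for [v] agree there. *)
have [py|py] := ltP e `|p.2 - z0.2|.
  exists (Num.min d1 (`|p.2 - z0.2| - e)), 1, k; split; first by rewrite lt_min d10 subr_gt0.
  move=> x Ox /ballE[x1 x2]; move: x1 x2; rewrite !lt_min => /andP[x1 _] /andP[x2 x2'].
  have xy : e < `|x.2 - z0.2|.
    have := ler_distD x.2 p.2 z0.2; lra.
  have nx : n x = k by apply: nk' => //; apply/ballE.
  have [j1 j2] := J0 x xy.
  split=> [i|]; last by rewrite eta0// !mulr0.
  by rewrite shE /v nx j1 j2; case: ifP => _; case: ifP => _; ring.
(* In the strip, to the left of the avoided square: the field bends here, and [ramp e (z0.1 - x.1)]
   is exactly [z0.1 - x.1]. *)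
have pxe : p.1 < z0.1 - e.
  rewrite ltNge; apply/negP => h; apply: (avoid cp); split => //.
  by rewrite ler_norml; apply/andP; split; lra.
exists (Num.min d1 (z0.1 - e - p.1)), 1, k; split; first by rewrite lt_min d10 subr_gt0.
move=> x Ox /ballE[x1 x2]; move: x1 x2; rewrite !lt_min => /andP[x1 x1'] /andP[x2 _].
have xz : x.1 < z0.1 - e by move: x1'; rewrite ltr_norml => /andP[? _]; lra.
have nx : n x = k by apply: nk' => //; apply/ballE.
split=> [i|]; last by rewrite mul1r ramp_ge//; lra.
have xz' : (z0.1 < x.1) = false by apply/negbTE; rewrite -leNgt ltW// (lt_trans xz)// gtrBl.
rewrite shE /v nx xz'.
by case: ifP => _; ring.
Qed.

(** The glued field equals a single [sheared] field in a neighbourhood of each point of the open set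
    [O], so its derivatives can be read off locally. *)
Lemma cut_field : exists u : vector_field R, (forall i, test_fun (u i)) /\
  forall z, O z -> [/\ partial ord0 (u ord0) z = 0,
    partial ord_max (u ord0) z + partial ord0 (u ord_max) z = 0 &
    partial ord_max (u ord_max) z = ramp e (z0.1 - z.1) * eta e (z.2 - z0.2)].
Proof.
have [v vP] := cut_field_local.
have /choice[u uP] : forall i, exists ui, test_fun ui /\ forall x, O x -> ui x = v i x.
  move=> i; have [|ui tu uv] := @glue_test _ O (v i) cO; last by exists ui.
  move=> p /vP[d [a [k [d0 dP]]]]; exists d, (sheared (profile a k) i); split=> //.
    exact/smooth_sheared/smooth1_profile.
  by move=> x Ox xp; have [] := dP x Ox xp.
exists u; split=> [i|z Oz]; first by have [] := uP i.
have [d [a [k [d0 dP]]]] := vP z (subset_closure Oz).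
have nz i : {near z, u i =1 sheared (profile a k) i}.
  have oO : open O by case: Od.
  near=> x; have Ox : O x by near: x; exact: open_nbhs_nbhs.
  have xz : ball z d x by near: x; exact: nbhsx_ballx.
  by have [_ ->//] := uP i; have [->] := dP x Ox xz.
have [s1 s2 s3] := partial_sheared z (smooth1_profile a k).
have [|_ E] := dP z Oz; first exact: ballxx.
have pu i j : partial j (u i) z = partial j (sheared (profile a k) i) z.
  exact: partial_near (nz i).
rewrite (pu ord0 ord0) (pu ord0 ord_max) (pu ord_max ord0) (pu ord_max ord_max).
by split; rewrite ?s1 ?s2 ?s3 ?derive2_profile.
Unshelve. all: by end_near. Qed.

End cut_field.

(** * Airy's function *)

Section integral_tools.
Context {R : realType}.
Local Notation mu := (mu2 R).

Lemma measurable_closed_plane (A : set (R * R)) : closed A -> measurable (A : set (plane R)).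
Proof.
move=> cA; rewrite -(setCK A); apply: measurableC; apply: measurable_open_plane.
exact: closed_openC.
Qed.

Lemma measurable_compact_plane (K : set (R * R)) : compact K -> measurable (K : set (plane R)).
Proof.
move=> cK; apply: measurable_closed_plane; apply: compact_closed cK.
exact: norm_hausdorff.
Qed.

Lemma integrable_loc (f : scalar_field R) : mu.-integrable setT (EFin \o f) -> loc_integrable f.
Proof.
by move=> jf K cK; apply: integrableS jf => //; exact: measurable_compact_plane.
Qed.

Lemma RintegralN (f : plane R -> R) : mu.-integrable setT (EFin \o f) ->
  \int[mu]_z (- f z) = - \int[mu]_z f z.
Proof.
move=> jf; rewrite -mulN1r -RintegralZl//; apply: eq_Rintegral => z _.
by rewrite mulN1r.
Qed.

Lemma Rintegral_ae (f g : plane R -> R) : mu.-integrable setT (EFin \o f) ->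
  mu.-integrable setT (EFin \o g) -> {ae mu, forall z, f z = g z} ->
  \int[mu]_z f z = \int[mu]_z g z.
Proof.
move=> jf jg fg; rewrite /Rintegral; congr fine; apply: ae_eq_integral => //.
- exact: measurable_int jf.
- exact: measurable_int jg.
- by move: fg => /ae_sub; apply => z -> _.
Qed.

Definition weak_partial (i : 'I_2) (f g : scalar_field R) := forall phi, test_fun phi ->
  \int[mu]_z (f z * partial i phi z) = - \int[mu]_z (g z * phi z).

End integral_tools.

(** * Potential and slopes by integration from the left *)

Section potential.
Context {R : realType}.
Local Notation mu := (mu2 R).
Local Notation leb := (@lebesgue_measure R).
Variables (O : set (R * R)) (s : tensor_field R) (r : R).
Hypotheses (r0 : 0 < r) (Or : forall z, closure O z -> `|z.1| < r /\ `|z.2| < r)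
  (s0 : forall i j z, ~ O z -> s i j z = 0)
  (js : forall i j, mu.-integrable setT (EFin \o s i j))
  (sS : forall i j z, s i j z = s j i z)
  (sdiv : forall i th, test_fun th -> \int[mu]_z (s i ord0 z * partial ord0 th z) +
     \int[mu]_z (s i ord_max z * partial ord_max th z) = 0).

Local Notation P := (average (X := measurableTypeR R) leb (ker0 (4 * r)) (@axis R)).
Local Notation Q := (average (X := measurableTypeR R) leb (ker1 (4 * r)) (@axis R)).

(* The lines are followed over the length [4 r] only, so that the required equations hold
   just at points with first coordinate below [3 r]. *)
Definition potential : scalar_field R := slide (ker1 (4 * r)) (s ord_max ord_max).

(** For the second slope, equilibrium trades [d_2] of the component 22 for minus [d_1] of the
    component 21, which undoes one of the two integrations. *)
Definition slope (i : 'I_2) : scalar_field R :=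
  if i == ord0 then slide (ker0 (4 * r)) (s ord_max ord_max)
  else fun z => - slide (ker0 (4 * r)) (s ord_max ord0) z.

(** For symmetric [s] this is [tr(s) I - s], with signs and reversed indices arranged as in
    [dist_perp2]. *)
Definition hess (i j : 'I_2) : scalar_field R :=
  fun z => (-1) ^+ (i + j) * s (rev_ord i) (rev_ord j) z.

Definition near_test (th : scalar_field R) :=
  test_fun th /\ forall z, th z != 0 -> z.1 <= 3 * r.

Let L0 : 0 < 4 * r. Proof. by rewrite mulr_gt0. Qed.

Lemma closed_le1 (c : R) : closed [set z : R * R | z.1 <= c].
Proof.
have c1 : continuous (fst : R * R -> R) by move=> u; apply: cvg_fst.
by apply: (@closed_comp _ _ fst [set u : R | u <= c]) => //; exact: closed_le.
Qed.

Lemma partial_le1 i (th : scalar_field R) (c : R) : (forall z, th z != 0 -> z.1 <= c) ->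
  forall z, partial i th z != 0 -> z.1 <= c.
Proof.
move=> thc z /supp_neq0 /supp_partial.
exact: (@supp_sub_closed _ th [set z | z.1 <= c] (closed_le1 (c := c))).
Qed.

Lemma near_test_partial i th : near_test th -> near_test (partial i th).
Proof. by move=> [tth thr]; split; [exact: test_partial|exact: partial_le1]. Qed.

Lemma test_P th : test_fun th -> test_fun (P th).
Proof.
move=> tth; apply: (@test_average _ _ _ _ _ _ _ _ th (4 * r)) => //.
- exact: integrable_ker0.
- exact: measurable_axis.
- exact: ker0_neq0.
Qed.

Lemma test_Q th : test_fun th -> test_fun (Q th).
Proof.
move=> tth; apply: (@test_average _ _ _ _ _ _ _ _ th (4 * r)) => //.
- exact: integrable_ker1.
- exact: measurable_axis.
- exact: ker1_neq0.
Qed.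

Lemma partial_P i th : test_fun th -> partial i (P th) = P (partial i th).
Proof.
move=> tth; apply: partial_average => //; [exact: integrable_ker0|exact: measurable_axis].
Qed.

Lemma partial_Q i th : test_fun th -> partial i (Q th) = Q (partial i th).
Proof.
move=> tth; apply: partial_average => //; [exact: integrable_ker1|exact: measurable_axis].
Qed.

(** The origin of the length [4 * r]: first coordinates in the closure exceed [- r], so the far end
    of the segment lies beyond [3 * r]. *)
Lemma far_test th z : near_test th -> closure O z -> th (z + axis (4 * r)) = 0.
Proof.
move=> [_ thr] /Or[]; rewrite ltr_norml => /andP[z1 _] _.
by apply/eqP; apply: contraPT isT => /thr /=; rewrite /axis /= => h; exfalso; lra.
Qed.

Lemma P_partial0 th z : near_test th -> closure O z -> P (partial ord0 th) z = - th z.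
Proof. by move=> nth Oz; have [tth _] := nth; rewrite average_partial0_ker0// far_test// sub0r. Qed.

Lemma Q_partial0 th z : near_test th -> closure O z -> Q (partial ord0 th) z = - P th z.
Proof.
by move=> nth Oz; have [tth _] := nth; rewrite average_partial0_ker1// far_test// mulr0 sub0r.
Qed.

Lemma integral_s i j (f g : scalar_field R) : (forall z, O z -> f z = g z) ->
  \int[mu]_z (s i j z * f z) = \int[mu]_z (s i j z * g z).
Proof.
move=> fg; apply: eq_Rintegral => z _; have [/fg->//|/s0->] := pselect (O z).
by rewrite !mul0r.
Qed.

Lemma integrable_s i j th : test_fun th -> mu.-integrable setT (EFin \o (fun z => s i j z * th z)).
Proof. exact/integrable_loc_test/integrable_loc. Qed.

Lemma integral_sN i j th : test_fun th ->
  \int[mu]_z (s i j z * - th z) = - \int[mu]_z (s i j z * th z).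
Proof.
move=> tth; rewrite -RintegralN; last exact: integrable_s.
by apply: eq_Rintegral => z _; rewrite mulrN.
Qed.

Lemma integrable_slideN k i j : leb.-integrable setT (EFin \o k) ->
  mu.-integrable setT (EFin \o (fun z => - slide k (s i j) z)).
Proof.
move=> ik; have := integrableRZ (-1) (integrable_slide ik (js i j)); congr integrable.
by apply/funext => z; rewrite /= mulN1r.
Qed.

Lemma integrable_potential : mu.-integrable setT (EFin \o potential).
Proof. exact: integrable_slide (integrable_ker1 _) (js _ _). Qed.

Lemma integrable_slope i : mu.-integrable setT (EFin \o slope i).
Proof.
rewrite /slope; have [->|->] := ord2E i; rewrite ?eqxx/=.
  exact: integrable_slide (integrable_ker0 _) (js _ _).
exact: integrable_slideN (integrable_ker0 _).
Qed.

Lemma dual_P i j th : test_fun th ->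
  \int[mu]_z (slide (ker0 (4 * r)) (s i j) z * th z) = \int[mu]_z (s i j z * P th z).
Proof. exact: slide_dual (integrable_ker0 _) (js _ _) _. Qed.

Lemma dual_PN i j th : test_fun th ->
  \int[mu]_z (- slide (ker0 (4 * r)) (s i j) z * th z) = - \int[mu]_z (s i j z * P th z).
Proof.
move=> tth; rewrite -dual_P// -RintegralN; first by apply: eq_Rintegral => z _; rewrite mulNr.
apply: integrable_loc_test tth; apply: integrable_loc.
exact: integrable_slide (integrable_ker0 _) (js _ _).
Qed.

Lemma dual_Q i j th : test_fun th ->
  \int[mu]_z (slide (ker1 (4 * r)) (s i j) z * th z) = \int[mu]_z (s i j z * Q th z).
Proof. exact: slide_dual (integrable_ker1 _) (js _ _) _. Qed.

Lemma sdiv_max i th : test_fun th -> \int[mu]_z (s i ord_max z * partial ord_max th z) =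
  - \int[mu]_z (s i ord0 z * partial ord0 th z).
Proof. by move=> /(sdiv i)/eqP; rewrite addrC addr_eq0 => /eqP. Qed.

(** For the first index, the transposed claim is that [Q] applied to [d_1 th] is [- P th] on Omega.
    For the second, equilibrium tested with [Q th] trades the vertical derivative for a horizontal
    one. *)
Lemma potential_slope i th : near_test th ->
  \int[mu]_z (potential z * partial i th z) = - \int[mu]_z (slope i z * th z).
Proof.
move=> nth; have [tth _] := nth; have tP := test_P tth.
rewrite /potential dual_Q; last exact: test_partial.
rewrite /slope; have [->|->] := ord2E i; rewrite ?eqxx/=.
  by rewrite dual_P// -integral_sN//; apply: integral_s => z /subset_closure; exact: Q_partial0.
rewrite dual_PN// opprK -partial_Q// sdiv_max; last exact: test_Q.
by rewrite partial_Q// (integral_s _ _ (fun z h => Q_partial0 nth (subset_closure h))) integral_sN// opprK.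
Qed.

Lemma slope_hess i j th : near_test th ->
  \int[mu]_z (slope i z * partial j th z) = - \int[mu]_z (hess i j z * th z).
Proof.
move=> nth; have [tth _] := nth; have tP := test_P tth; have tj := test_partial j tth.
have P0 k l : \int[mu]_z (s k l z * P (partial ord0 th) z) = - \int[mu]_z (s k l z * th z).
  by rewrite -integral_sN//; apply: integral_s => z /subset_closure; exact: P_partial0.
have hE (c : R) k l : \int[mu]_z (c * s k l z * th z) = c * \int[mu]_z (s k l z * th z).
  rewrite -RintegralZl//; last exact: integrable_s.
  by apply: eq_Rintegral => z _; rewrite mulrA.
have r0E : rev_ord (ord0 : 'I_2) = ord_max by exact: val_inj.
have r1E : rev_ord (ord_max : 'I_2) = ord0 by exact: val_inj.
rewrite /hess hE /slope; have [iE|iE] := ord2E i; have [jE|jE] := ord2E j;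
  rewrite {}iE {}jE in tj *; rewrite ?eqxx/= ?r0E ?r1E ?addn0 ?expr0 ?expr1 ?mul1r.
- by rewrite (dual_P _ _ tj) P0.
- rewrite (dual_P _ _ tj) -(partial_P ord_max tth) (sdiv_max _ tP) (partial_P ord0 tth) P0.
  by rewrite opprK mulN1r opprK.
- rewrite (dual_PN _ _ tj) P0 opprK mulN1r opprK; apply: eq_Rintegral => z _.
  by rewrite sS.
- rewrite (dual_PN _ _ tj) -(partial_P ord_max tth).
  have -> : \int[mu]_z (s ord_max ord0 z * partial ord_max (P th) z) =
            \int[mu]_z (s ord0 ord_max z * partial ord_max (P th) z).
    by apply: eq_Rintegral => z _; rewrite sS.
  by rewrite (sdiv_max _ tP) (partial_P ord0 tth) P0 !opprK -signr_odd/= expr0 mul1r.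
Qed.

(** The cutoff at [2 * r] leaves a margin to [3 * r], so that the support stays in the open region
    where the vanishing is known. *)
Lemma near_cutoff phi : test_fun phi -> exists th, [/\ test_fun th,
  forall z, th z != 0 -> z.1 <= 2 * r & forall z, closure O z -> {near z, th =1 phi}].
Proof.
move=> tphi; have r20 : 0 < 2 * r by rewrite mulr_gt0.
exists (fun z => phi z * bump (2 * r) 0 z); split.
- by apply: testM; [exact: test_smooth|exact: test_bump].
- move=> z; rewrite mulf_eq0 negb_or => /andP[_ /(bump_neq0 r20)[/= + _]].
  by rewrite sub0r normrN => /ltW; apply: le_trans; exact: ler_norm.
have b1 z : `|z.1| < r -> `|z.2| < r -> bump (2 * r) 0 z = 1.
  move=> z1 z2; rewrite bump_eq1//= sub0r normrN [2 * r]mulrC mulfK ?pnatr_eq0//; exact: ltW.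
move=> z /Or[z1 z2].
have [d d0 dz] : exists2 d, 0 < d & forall x, ball z d x -> `|x.1| < r /\ `|x.2| < r.
  exists (Num.min (r - `|z.1|) (r - `|z.2|)); first by rewrite lt_min !subr_gt0 z1.
  move=> x /ballE[]; rewrite !lt_min => /andP[x1 _] /andP[_ x2].
  have h1 := ler_normB z.1 (z.1 - x.1); have h2 := ler_normB z.2 (z.2 - x.2).
  by move: h1 h2; rewrite !subKr => h1 h2; split; lra.
near=> x; rewrite b1 ?mulr1//.
  by have [] := dz x; first by near: x; exact: nbhsx_ballx.
by have [] := dz x; first by near: x; exact: nbhsx_ballx.
Unshelve. all: by end_near. Qed.

(** * Vanishing off the closure of Omega *)

Section vanishing.
Hypotheses (Od : is_domain O) (Osc : simply_connected O) (Olip : lipschitz_boundary O)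
  (cO : compact (closure O)).

(** Two integrations of [eta e] give [ramp e]. At the far end of the segment the argument
    [a - 4 * r] is below [- e], by the condition on [z0], so the near end alone contributes. *)
Lemma Q_rho (z0 z : R * R) (e : R) : 0 < e -> z0.1 + e <= 3 * r -> O z ->
  Q (fun w => rho e (z0 - w)) z = ramp e (z0.1 - z.1) * eta e (z.2 - z0.2).
Proof.
move=> e0 z0r /subset_closure /Or[]; rewrite ltr_norml => /andP[z1 _] _.
rewrite average_ker1; pose a := z0.1 - z.1.
transitivity (\int[leb]_(t in `[0, 4 * r]) (eta e (z.2 - z0.2) * (t * eta e (a - t)))).
  apply: eq_Rintegral => t _.
  have h1 : (z0 - (z + axis t)).1 = a - t by rewrite /= opprD addrA.
  have h2 : - (z0 - (z + axis t)).2 = z.2 - z0.2 by rewrite /= addr0 opprB.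
  by rewrite /rho h1 h2 mulrA mulrC.
have sq := smooth1_ramp e.
have dr (f : R -> R) (t : R) : smooth1 f ->
    is_derive t 1 (fun t => f (a - t)) (- derive1 f (a - t)).
  move=> sf; have d : is_derive t 1 (fun t => a - t) (-1).
    by have := is_deriveB (is_derive_cst a t 1) (is_derive_id t (1 : R)); rewrite sub0r.
  have := @is_derive1_comp _ f (fun t => a - t) t _ _ (smooth1_is_derive (a - t) sf) d.
  by rewrite mulrN1.
have dG (t : R) : is_derive t 1 (fun t => - (t * derive1 (ramp e) (a - t)) - ramp e (a - t))
    (t * eta e (a - t)).
  have d1 := dr (derive1 (ramp e)) t (smooth1_derive sq).
  have d2 := dr (ramp e) t sq.
  have -> : t * eta e (a - t) = - (t *: - derive1 (derive1 (ramp e)) (a - t) +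
      derive1 (ramp e) (a - t) *: 1) - - derive1 (ramp e) (a - t).
    by rewrite /GRing.scale/= /eta; ring.
  exact: is_deriveB (is_deriveN (is_deriveM (is_derive_id t (1 : R)) d1)) d2.
have cG : continuous (fun t : R => t * eta e (a - t)).
  move=> t; apply: cvgM; first exact: cvg_id.
  apply: continuous_comp; last exact: continuous_eta.
  by apply: cvgB; [exact: cvg_cst|exact: cvg_id].
rewrite RintegralZl//; last first.
  by apply: continuous_compact_integrable; [exact: segment_compact|exact: continuous_subspaceT].
rewrite (Rintegral_derivative L0 dG cG) mulrC; congr (_ * _).
have aL : a - 4 * r < - e by rewrite /a; lra.
by rewrite (derive1_ramp_lt e0 aL) (ramp_le e0 (ltW aL)) [a - 0]subr0 mul0r mulr0; ring.
Qed.

(** Under the integral, equilibrium turns [s_22 d_2 u_2] into [- s_21 d_1 u_2]; the vanishing shear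
    strain turns this into [s_12 d_2 u_1]; equilibrium again turns it into [- s_11 d_1 u_1], which
    is 0. *)
Lemma integral_potential_rho (z0 : R * R) (e : R) : 0 < e -> z0.1 + e <= 3 * r ->
  (forall w, closure O w -> ~ (`|w.1 - z0.1| <= e /\ `|w.2 - z0.2| <= e)) ->
  \int[mu]_w (potential w * rho e (z0 - w)) = 0.
Proof.
move=> e0 z0r avoid; have [tr _] := test_rho_at z0 e0.
rewrite /potential dual_Q//.
have [u [tu uP]] := cut_field Od Osc Olip cO e0 avoid.
rewrite (integral_s _ _ (g := partial ord_max (u ord_max))); last first.
  by move=> z Oz; have [_ _ ->] := uP z Oz; exact: Q_rho.
rewrite sdiv_max//.
have -> : \int[mu]_z (s ord_max ord0 z * partial ord0 (u ord_max) z) =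
    \int[mu]_z (s ord0 ord_max z * - partial ord_max (u ord0) z).
  transitivity (\int[mu]_z (s ord_max ord0 z * - partial ord_max (u ord0) z)).
    apply: integral_s => z Oz; have [_ /eqP + _] := uP z Oz.
    by rewrite addrC addr_eq0 => /eqP.
  by apply: eq_Rintegral => z _; rewrite sS.
rewrite integral_sN; last exact: test_partial.
rewrite opprK sdiv_max// (integral_s _ _ (g := fun=> 0)).
  by rewrite /Rintegral; under eq_integral do rewrite mulr0; rewrite integral0 oppr0.
by move=> z Oz; have [] := uP z Oz.
Qed.

Lemma open_left : open ([set z | z.1 < 3 * r] `&` ~` closure O).
Proof.
apply: openI; last exact/closed_openC/closed_closure.
have c1 : continuous (fst : R * R -> R) by move=> u; apply: cvg_fst.
by apply: (@open_comp _ _ (fst : R * R -> R) [set u | u < 3 * r]) => [x _|]; [exact: c1|exact: open_lt].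
Qed.

Lemma potential_ae0 : {ae mu, forall z, (z.1 < 3 * r /\ ~ closure O z) -> potential z = 0}.
Proof.
apply: (ae_zero_open open_left (integrable_loc integrable_potential)) => z e e0 zU.
apply: integral_potential_rho => //.
  have [|| h _] := zU (z.1 + e, z.2) => /=.
  - by rewrite opprD addNKr normrN gtr0_norm.
  - by rewrite subrr normr0 ltW.
  exact: ltW.
move=> w cw [w1 w2]; have [|| _] := zU w; do ?by rewrite distrC.
exact.
Qed.

(** On this open set the slopes are weak derivatives of a potential that vanishes. *)
Lemma slope_ae0 i : {ae mu, forall z, (z.1 < 3 * r /\ ~ closure O z) -> slope i z = 0}.
Proof.
apply: (dist_zero_ae open_left (integrable_loc (integrable_slope i))) => phi tphi sphi.
have nphi : near_test phi.
  by split=> // z /supp_neq0 /sphi[/ltW].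
rewrite /dist_of -[LHS]opprK -potential_slope//.
have tp := test_partial i tphi.
rewrite -/(dist_of potential _) (dist_of_ae0 (integrable_loc integrable_potential) tp) ?oppr0//.
move: potential_ae0 => /ae_sub; apply => z pz.
have [->|/supp_neq0/supp_partial/sphi[h1 h2]] := eqVneq (partial i phi z) 0; first by rewrite mulr0.
by rewrite pz ?mul0r.
Qed.

(** The restriction creates no boundary term: to the left of [3 * r] both functions already vanish
    off the closure, and the test function can be replaced by one supported there without changing
    it near the closure. *)
Lemma cut_weak i (f g : scalar_field R) :
  mu.-integrable setT (EFin \o f) -> mu.-integrable setT (EFin \o g) ->
  {ae mu, forall z, (z.1 < 3 * r /\ ~ closure O z) -> f z = 0} ->
  {ae mu, forall z, (z.1 < 3 * r /\ ~ closure O z) -> g z = 0} ->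
  (forall th, near_test th ->
    \int[mu]_z (f z * partial i th z) = - \int[mu]_z (g z * th z)) ->
  weak_partial i (f \_ (closure O)) (g \_ (closure O)).
Proof.
move=> jf jg f0 g0 fg phi tphi.
have [th [tth th2 thE]] := near_cutoff tphi.
have r23 : 2 * r < 3 * r by rewrite ltr_pM2r// ltr_nat.
have nth : near_test th.
  by split=> // z /th2 z2; apply: le_trans z2 (ltW r23).
have cut (h k : scalar_field R) : mu.-integrable setT (EFin \o h) -> test_fun k ->
    (forall z, k z != 0 -> z.1 <= 2 * r) ->
    {ae mu, forall z, (z.1 < 3 * r /\ ~ closure O z) -> h z = 0} ->
    \int[mu]_z ((h \_ (closure O)) z * k z) = \int[mu]_z (h z * k z).
  move=> jh tk k2 h0; have mc : measurable (closure O : set (plane R)).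
    by apply: measurable_closed_plane; exact: closed_closure.
  apply: Rintegral_ae.
  - apply: integrable_loc_test tk; apply: integrable_loc.
    by rewrite -restrict_EFin; apply/(integrable_mkcond _ mc); exact: integrableS jh.
  - exact: integrable_loc_test (integrable_loc jh) tk.
  move: h0 => /ae_sub; apply => z hz; rewrite patchE; case: ifPn => //.
  rewrite notin_setE => nz; have [->|/k2 z2] := eqVneq (k z) 0; first by rewrite !mulr0.
  by rewrite hz//; split=> //; exact: le_lt_trans z2 r23.
transitivity (\int[mu]_z ((f \_ (closure O)) z * partial i th z)).
  apply: eq_Rintegral => z _; rewrite patchE; case: ifPn => [/set_mem cz|]; last by rewrite !mul0r.
  by rewrite (partial_near i (thE z cz)).
rewrite cut//; [|exact: test_partial|exact: partial_le1].
rewrite fg// -(cut g th jg tth th2 g0); congr (- _).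
apply: eq_Rintegral => z _; rewrite patchE; case: ifPn => [/set_mem cz|]; last by rewrite !mul0r.
by rewrite (nbhs_singleton (thE z cz)).
Qed.

Definition airy : scalar_field R := potential \_ (closure O).
Definition airy_grad (i : 'I_2) : scalar_field R := slope i \_ (closure O).

Lemma weak_airy i : weak_partial i airy (airy_grad i).
Proof.
apply: cut_weak (integrable_potential) (integrable_slope i) potential_ae0 (slope_ae0 i) _.
exact: potential_slope.
Qed.

Lemma integrable_hess i j : mu.-integrable setT (EFin \o hess i j).
Proof. exact: integrableRZ. Qed.

Lemma weak_airy_grad i j : weak_partial j (airy_grad i) (hess i j).
Proof.
have h0 z : ~ closure O z -> hess i j z = 0.
  by move=> nz; rewrite /hess s0 ?mulr0// => /subset_closure.
have -> : hess i j = hess i j \_ (closure O).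
  apply/funext => z; rewrite patchE; case: ifPn => //; rewrite notin_setE; exact: h0.
apply: cut_weak (integrable_slope i) (integrable_hess i j) (slope_ae0 i) _ _.
  by apply: aeW => z [_]; exact: h0.
exact: slope_hess.
Qed.

End vanishing.
End potential.

(** * Square-integrable functions *)

Section square_integrable.
Context {R : realType}.
Local Notation mu := (mu2 R).

Lemma L2P (f : scalar_field R) :
  L2 f <-> measurable_fun setT (f : plane R -> R) /\ (energy 2 f < +oo)%E.
Proof.
have E2 : ('N[mu]_2%:E [EFin \o f] `^ 2 = energy 2 f)%E.
  rewrite poweR_Lnorm//; apply: eq_integral => z _.
  by rewrite /= powR_mulrn.
rewrite /L2 inE; split=> [/andP[mf nf]|[mf ef]].
  split; first by move: mf; rewrite inE.
  by rewrite -E2 poweR_lty//; move: nf; rewrite inE.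
apply/andP; split; rewrite inE//=.
by rewrite /finite_norm (@lty_poweRy _ _ 2) ?E2.
Qed.

Lemma L2_mul (f g : scalar_field R) : L2 f -> L2 g ->
  mu.-integrable setT (EFin \o (fun z => f z * g z)).
Proof. by move=> lf lg; apply/Lfun1_integrable; exact: Lfun2_mul_Lfun1. Qed.

Lemma L2_indic (A : set (plane R)) : measurable A -> (mu A < +oo)%E -> L2 (\1_A : plane R -> R).
Proof.
move=> mA Afin; apply/L2P; split; first exact: measurable_indic.
rewrite /energy (_ : (fun z => _) = (fun z => (\1_A z)%:E)).
  by rewrite integral_indic// setIT.
apply/funext => z; rewrite indicE; case: (_ \in _); rewrite /= ?normr1 ?normr0 ?expr1n//.
by rewrite expr0n.
Qed.

Lemma L2_loc_integrable (f : scalar_field R) : L2 f -> loc_integrable f.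
Proof.
move=> lf K cK; have [r r0 rP] := compact_bounded_prod cK.
have Kr : (K : set (plane R)) `<=` box r.
  by move=> z /rP[z1 z2]; apply/boxP; split; exact: ltW.
have mK := measurable_compact_plane cK.
apply/(integrable_mkcond _ mK); rewrite restrict_EFin.
have lK : L2 (\1_K : plane R -> R).
  apply: L2_indic => //; apply: le_lt_trans (mu_box_lty r).
  by apply: le_measure; rewrite ?inE//; exact: measurable_boxr.
have := L2_mul lf lK; congr integrable; apply/funext => z /=.
by rewrite patchE indicE; case: ifP; rewrite ?mulr1 ?mulr0.
Qed.

Lemma L2_supported (f : scalar_field R) (r : R) : L2 f -> (forall z, f z != 0 -> box r z) ->
  mu.-integrable setT (EFin \o f).
Proof.
move=> lf fr; have := L2_loc_integrable lf (compact_box (r := r)).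
move=> /(integrable_mkcond _ (measurable_boxr r)); rewrite restrict_EFin; congr integrable.
apply/funext => z; rewrite /= patchE; case: ifPn => //; rewrite notin_setE => nb.
by have [->|/fr//] := eqVneq (f z) 0.
Qed.

Lemma L2D (f g : scalar_field R) : L2 f -> L2 g -> L2 (fun z => f z + g z).
Proof.
move=> /L2P[mf ef] /L2P[mg eg]; apply/L2P; split; first exact: measurable_funD.
apply: le_lt_trans (energyD 2 mf mg) _.
by rewrite lte_mul_pinfty ?lee_fin ?exprn_ge0// lte_add_pinfty.
Qed.

Lemma L2Z (a : R) (f : scalar_field R) : L2 f -> L2 (fun z => a * f z).
Proof.
move=> /L2P[mf ef]; apply/L2P; split; first exact: measurable_funM.
by rewrite energyZ// lte_mul_pinfty ?lee_fin ?exprn_ge0// energy_ge0.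
Qed.

Lemma L2B (f g : scalar_field R) : L2 f -> L2 g -> L2 (fun z => f z - g z).
Proof.
move=> lf /(L2Z (-1)) lg; have := L2D lf lg; congr L2.
by apply/funext => z; rewrite mulN1r.
Qed.

Lemma L2_test (f : scalar_field R) : test_fun f -> L2 f.
Proof.
move=> tf; have [mf [M [r [M0 r0 fM fr]]]] := test_fun_data tf.
have lb : L2 (fun z => M * (\1_(box r) : plane R -> R) z).
  by apply: L2Z; apply: L2_indic; [exact: measurable_boxr|exact: mu_box_lty].
have [mb eb] := (L2P _).1 lb; apply/L2P; split=> //.
apply: le_lt_trans eb; apply: energy_le => // z; rewrite normrM (gtr0_norm M0) indicE.
have [->|/fr zr] := eqVneq (f z) 0; first by rewrite normr0 mulr_ge0// ltW.
by rewrite mem_set//= normr1 mulr1.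
Qed.

End square_integrable.

(** * Mollification of weak derivatives *)

Section approximation.
Context {R : realType}.
Local Notation mu := (mu2 R).

Lemma partial_reflect i (th : scalar_field R) z : smooth th ->
  partial i (fun w => th (z - w)) = fun w => - partial i th (z - w).
Proof.
move=> sth; apply/funext => w; rewrite /partial.
have d1 : is_diff w (cst z - id : R * R -> R * R) (0 - id) by exact: is_diffB.
have d2 : is_diff ((cst z - id : R * R -> R * R) w) th ('d th (z - w)).
  by apply: DiffDef => //; exact: smooth_differentiable.
have d := is_diff_comp d1 d2.
rewrite [LHS](_ : _ = 'D_(basis_vec R i) (th \o (cst z - id : R * R -> R * R)) w)//.
rewrite deriveE; last by case: d.
rewrite (@diff_val _ _ _ _ _ _ _ d) deriveE; last exact: smooth_differentiable.
by rewrite /= !fctE sub0r linearN.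
Qed.

(** The weak equation is tested with [rho e (z - _)]; the sign produced by this reflection cancels
    that of the weak derivative. *)
Lemma weak_moll i (f g : scalar_field R) e : 0 < e -> mu.-integrable setT (EFin \o f) ->
  weak_partial i f g -> partial i (moll e f) = moll e g.
Proof.
move=> e0 jf fg; have tr := test_rho e0.
rewrite /moll partial_average//; last exact: measurable_oppp.
apply/funext => z; rewrite /average.
have [tz _] := test_rho_at z e0.
have E := fg _ tz.
rewrite (partial_reflect i z (test_smooth tr)) in E.
apply: oppr_inj.
rewrite -[RHS]E.
rewrite -RintegralN.
  by apply: eq_Rintegral => w _; rewrite mulrN.
exact: integrable_translate jf measurable_oppp _ z (test_partial i tr).
Qed.

Lemma test_moll (f : plane R -> R) e r : 0 < e -> mu.-integrable setT (EFin \o f) ->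
  (forall z, f z != 0 -> box r z) -> test_fun (moll e f).
Proof.
move=> e0 jf fr; apply: (@test_average _ _ _ _ _ _ jf measurable_oppp (rho e) r).
  exact: test_rho.
by move=> z /fr /boxP; rewrite /= !normrN.
Qed.

Lemma L2_moll_near (f : plane R -> R) r (t : R) : L2 f -> (forall z, ~ ocbox r z -> f z = 0) ->
  mu.-integrable setT (EFin \o f) -> 0 < t ->
  \forall n \near \oo, (energy 2 (fun z => (moll n.+1%:R^-1 f z - f z)%R) <= t%:E)%E.
Proof.
move=> /L2P[mf ef] fr jf t0.
have cf : mean_continuous 2 f by apply: (@mean_continuous_Lp _ 2 _ r).
have [d d0 dP] := @moll_cvg _ 2 f isT jf cf t t0.
near=> n; apply: dP; rewrite invr_gt0 ltr0n/=.
by near: n; exact: (near_infty_natSinv_lt (PosNum d0)).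
Unshelve. all: by end_near. Qed.

Lemma ecvg0 (u : nat -> \bar R) : (forall n, (0 <= u n)%E) ->
  (forall t : R, 0 < t -> \forall n \near \oo, (u n <= t%:E)%E) -> u n @[n --> \oo] --> 0%E.
Proof.
move=> u0 ut; have fin n (t : R) : (u n <= t%:E)%E -> u n \is a fin_num.
  by move=> un; rewrite ge0_fin_numE//; apply: le_lt_trans un _; rewrite ltry.
apply/fine_cvgP; split; first by have := ut 1 ltr01; apply: filterS => n; exact: fin.
apply/pseudometric_normed_Zmodule.cvgrPdist_le => t t0.
near=> n; have un : (u n <= t%:E)%E by near: n; exact: ut.
rewrite sub0r normrN /= ger0_norm ?fine_ge0// -lee_fin fineK//.
exact: fin un.
Unshelve. all: by end_near. Qed.

Lemma sumI2 (V : nmodType) (F : 'I_2 -> V) : \sum_i F i = F ord0 + F ord_max.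
Proof. by rewrite big_ord_recl big_ord1; congr (_ + F _); exact: val_inj. Qed.

End approximation.

(** * Uniqueness of the Helmholtz decomposition *)

Section pairing.
Context {R : realType}.
Local Notation mu := (mu2 R).

Lemma ae_I2 (P : 'I_2 -> R * R -> Prop) : (forall i, {ae mu, forall z, P i z}) ->
  {ae mu, forall z, forall i, P i z}.
Proof.
move=> aeP; have /ae_sub := ae_and (aeP ord0) (aeP ord_max); apply => z [p0 p1] i.
by have [->|->] := ord2E i.
Qed.

Lemma Rintegral_I2 (F : 'I_2 -> plane R -> R) : (forall i, mu.-integrable setT (EFin \o F i)) ->
  mu.-integrable setT (EFin \o (fun z => \sum_i F i z)) /\
  \int[mu]_z (\sum_i F i z) = \sum_i \int[mu]_z F i z.
Proof.
move=> iF; have -> : (fun z => \sum_i F i z) = fun z => F ord0 z + F ord_max z.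
  by apply/funext => z; rewrite sumI2.
by rewrite sumI2 RintegralD//; split=> //; exact: integrableRD.
Qed.

Definition pairing (S D : tensor_field R) : plane R -> R :=
  fun z => \sum_i \sum_j S i j z * D i j z.

Implicit Types S D : tensor_field R.

Lemma pairingE S D z : pairing S D z =
  S ord0 ord0 z * D ord0 ord0 z + S ord0 ord_max z * D ord0 ord_max z +
  (S ord_max ord0 z * D ord_max ord0 z + S ord_max ord_max z * D ord_max ord_max z).
Proof. by rewrite /pairing sumI2 !sumI2. Qed.

Lemma Rintegral_pairing S D : (forall i j, L2 (S i j)) -> (forall i j, L2 (D i j)) ->
  mu.-integrable setT (EFin \o pairing S D) /\
  \int[mu]_z pairing S D z = \sum_i \sum_j \int[mu]_z (S i j z * D i j z).
Proof.
move=> lS lD; have h i := Rintegral_I2 (fun j => L2_mul (lS i j) (lD i j)).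
have [h1 h2] := Rintegral_I2 (fun i => (h i).1); split=> //.
by rewrite [LHS]h2; apply: eq_bigr => i _; have [] := h i.
Qed.

Definition sym_div_free S := [/\ forall i j, L2 (S i j),
  {ae mu, forall z, forall i j, S i j z = S j i z} & div_free S].

Lemma L2_partial i (phi : scalar_field R) : test_fun phi -> L2 (partial i phi).
Proof. by move=> tphi; exact/L2_test/test_partial. Qed.

Lemma L2_sym_grad (phi : vector_field R) i j : (forall i, test_fun (phi i)) ->
  L2 (sym_grad phi i j).
Proof. by move=> tphi; apply: L2Z; apply: L2D; exact: L2_partial. Qed.

(** By symmetry of [S] the symmetric gradient may be replaced by the gradient; row [i] of the
    divergence condition is then tested with [phi i]. *)
Lemma pairing_sym_grad S (phi : vector_field R) : sym_div_free S -> (forall i, test_fun (phi i)) ->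
  \int[mu]_z pairing S (sym_grad phi) z = 0.
Proof.
move=> [lS symS divS] tphi; pose D : tensor_field R := fun i j => partial j (phi i).
have lD i j : L2 (D i j) by exact: L2_partial.
have [i1 E1] := Rintegral_pairing lS lD.
have [i2 _] := Rintegral_pairing lS (fun i j => L2_sym_grad i j tphi).
rewrite (Rintegral_ae i2 i1); last first.
  move: symS => /ae_sub; apply => z /(_ ord_max ord0) Sz; rewrite !pairingE Sz /sym_grad /D.
  move: (S _ _ z) (S _ _ z) (S _ _ z) => s00 s01 s11.
  move: (partial _ _ z) (partial _ _ z) (partial _ _ z) (partial _ _ z) => p00 p01 p10 p11.
  by field.
rewrite E1 big1// => i _; have := divS i _ (tphi i).
rewrite /dist_div /dist_partial /dist_of /dist_zero sumrN => /eqP.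
by rewrite oppr_eq0 => /eqP.
Qed.

(** The weighted arithmetic-geometric inequality plays the part of Cauchy-Schwarz: it can be
    integrated as it stands, and [t] remains free. *)
Lemma pairing_AMGM S D (t : R) z : 0 < t ->
  2 * `|pairing S D z| <= t * pairing S S z + t^-1 * pairing D D z.
Proof.
move=> t0; have aux (a b : R) : 2 * `|a * b| <= t * (a * a) + t^-1 * (b * b).
  have a2 : a * a = `|a| ^+ 2 by rewrite real_normK ?num_real// expr2.
  have b2 : b * b = `|b| ^+ 2 by rewrite real_normK ?num_real// expr2.
  have -> : t * (a * a) + t^-1 * (b * b) = 2 * `|a * b| + t * (`|a| - t^-1 * `|b|) ^+ 2.
    by rewrite a2 b2 normrM; field; exact: lt0r_neq0.
  by rewrite lerDl mulr_ge0 ?sqr_ge0// ltW.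
rewrite /pairing !mulr_sumr; apply: (@le_trans _ _ (\sum_i \sum_j 2 * `|S i j z * D i j z|)).
  apply: (@le_trans _ _ (2 * \sum_i \sum_j `|S i j z * D i j z|)).
    rewrite ler_wpM2l//; apply: le_trans (ler_norm_sum _ _ _) _.
    by apply: ler_sum => i _; exact: ler_norm_sum.
  by rewrite mulr_sumr; apply: ler_sum => i _; rewrite mulr_sumr.
rewrite -big_split; apply: ler_sum => i _ /=; rewrite !mulr_sumr -big_split.
by apply: ler_sum => j _; exact: aux.
Qed.

(** Orthogonality passes to the limit: an approximation of squared error at most [t ^+ 2] leads to
    [2 * |c| <= t * (A + 1)], for every [t > 0]. *)
Lemma pairing_limit S (du : tensor_field R) (phi : nat -> vector_field R) : sym_div_free S ->
  (forall i j, L2 (du i j)) -> (forall n i, test_fun (phi n i)) ->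
  (\int[mu]_x (\sum_i \sum_j (sym_grad (phi n) i j x - du i j x) ^+ 2)%:E)%E
            @[n --> \oo] --> 0%E ->
  \int[mu]_z pairing S du z = 0.
Proof.
move=> divS ldu tphi phidu; have [lS _ _] := divS.
have [i0 _] := Rintegral_pairing lS ldu; have [iS _] := Rintegral_pairing lS lS.
set c := Rintegral _ _ _; set A := \int[mu]_z pairing S S z.
have A0 : 0 <= A.
  apply: Rintegral_ge0 => z _; apply: sumr_ge0 => i _; apply: sumr_ge0 => j _.
  by rewrite -expr2 sqr_ge0.
have main (t : R) : 0 < t -> 2 * `|c| <= t * (A + 1).
  move=> t0; have t20 : 0 < t ^+ 2 by rewrite exprn_gt0.
  have [n nP] : exists n, ((\int[mu]_x (\sum_i \sum_j
      (sym_grad (phi n) i j x - du i j x) ^+ 2)%:E) <= (t ^+ 2)%:E)%E.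
    have [fin /pseudometric_normed_Zmodule.cvgrPdist_le/(_ _ t20) lim] := (fine_cvgP _ _).1 phidu.
    have [n [f1 f2]] := filter_ex (filterI fin lim); exists n.
    rewrite -(fineK f1) lee_fin; apply: le_trans f2; rewrite sub0r normrN.
    exact: ler_norm.
  pose x : tensor_field R := fun i j z => sym_grad (phi n) i j z - du i j z.
  have lg i j := L2_sym_grad i j (tphi n).
  have lx i j : L2 (x i j) by apply: L2B.
  have [ig _] := Rintegral_pairing lS lg.
  have [ix _] := Rintegral_pairing lS lx; have [ixx _] := Rintegral_pairing lx lx.
  have cE : \int[mu]_z pairing S x z = - c.
    rewrite -[RHS]add0r -(pairing_sym_grad divS (tphi n)) -RintegralB//.
    apply: eq_Rintegral => z _; rewrite /pairing -sumrB; apply: eq_bigr => i _.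
    by rewrite -sumrB; apply: eq_bigr => j _; rewrite mulrBr.
  have xxt : \int[mu]_z pairing x x z <= t ^+ 2.
    rewrite -lee_fin; apply: le_trans nP; rewrite /Rintegral fineK; last exact: integrable_fin_num.
    rewrite le_eqVlt; apply/orP; left; apply/eqP; apply: eq_integral => z _; rewrite /= /pairing.
    by congr EFin; apply: eq_bigr => i _; apply: eq_bigr => j _; rewrite expr2.
  have ian : mu.-integrable setT (EFin \o (fun z => `|pairing S x z|)) by have := integrable_norm ix.
  have : 2 * \int[mu]_z `|pairing S x z| <= t * A + t^-1 * \int[mu]_z pairing x x z.
    rewrite -RintegralZl// /A -RintegralZl// -[in leRHS]RintegralZl// -RintegralD//;
      do ?exact: integrableRZ.
    apply: le_Rintegral => //; first exact: integrableRZ.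
      by apply: integrableRD; exact: integrableRZ.
    by move=> z _; exact: pairing_AMGM.
  have cle : `|c| <= \int[mu]_z `|pairing S x z|.
    by rewrite -normrN -cE; exact: le_normr_Rintegral.
  have xx2 : t^-1 * \int[mu]_z pairing x x z <= t.
    by rewrite mulrC ler_pdivrMr// -expr2.
  move: cle xx2; move: (\int[mu]_z `|_|) (t^-1 * _) => a b.
  by rewrite mulrDr mulr1; clear; move: (t * A) => ?; lra.
apply/eqP; rewrite -normr_eq0; apply/negPn/negP => cn0.
have c0 : 0 < `|c| by rewrite lt_def cn0 normr_ge0.
have A1 : 0 < A + 1 by rewrite ltr_wpDl.
(* For this [t] the bound reads [2 * |c| <= |c|]. *)
have := main (`|c| / (A + 1)) (divr_gt0 c0 A1); rewrite mulfVK ?lt0r_neq0//.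
by move: c0; clear; move: `|c| => ? ? ?; lra.
Qed.

Lemma L2sym_setT S : L2sym setT S ->
  (forall i j, L2 (S i j)) /\ {ae mu, forall z, forall i j, S i j z = S j i z}.
Proof.
move=> [lS sS]; split=> [i j|].
  have := lS i j; congr L2; apply/funext => z.
  by rewrite /zero_ext patchE mem_set.
by move: sS => /ae_sub; apply => z; exact.
Qed.

Lemma pairing0_ae S : (forall i j, L2 (S i j)) -> \int[mu]_z pairing S S z = 0 ->
  {ae mu, forall z, forall i j, S i j z = 0}.
Proof.
move=> lS S0; apply: ae_I2 => i; apply: ae_I2 => j.
have [mS _] := (L2P _).1 (lS i j); have iS := L2_mul (lS i j) (lS i j).
have [iSS _] := Rintegral_pairing lS lS.
have : {ae mu, forall z, setT z -> S i j z = 0}.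
  apply: (@energy_set0_ae _ 2) => // t t0; apply: (@le_trans _ _ 0%E); last by rewrite lee_fin ltW.
  have -> : (\int[mu]_z (`|S i j z| ^+ 2)%:E = (\int[mu]_z (S i j z * S i j z))%:E)%E.
    rewrite /Rintegral fineK; last exact: integrable_fin_num.
    by apply: eq_integral => z _; rewrite real_normK ?num_real// expr2.
  rewrite lee_fin -S0; apply: le_Rintegral => // z _; rewrite /pairing.
  have sq k l : 0 <= S k l z * S k l z by rewrite -expr2 sqr_ge0.
  rewrite (bigD1 i)//= (bigD1 j)//= -addrA lerDl addr_ge0// ?sumr_ge0// => k _.
  by apply: sumr_ge0.
by move=> /ae_sub; apply => z; exact.
Qed.

Lemma loc_integrableB (f g : scalar_field R) : loc_integrable f -> loc_integrable g ->
  loc_integrable (fun z => f z - g z).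
Proof.
move=> lf lg K cK.
exact: (integrableB (measurable_compact_plane cK) (lf K cK) (lg K cK)).
Qed.

Lemma dist_ofB (f g : scalar_field R) phi : loc_integrable f -> loc_integrable g ->
  test_fun phi -> dist_of (fun z => f z - g z) phi = dist_of f phi - dist_of g phi.
Proof.
move=> lf lg tphi; rewrite /dist_of -RintegralB//; do ?exact: integrable_loc_test.
by apply: eq_Rintegral => z _; rewrite mulrBl.
Qed.

(** The difference [T] of the divergence-free parts is minus the difference of [du'] and [du], and
    is orthogonal to both of these; so the integral of [T : T] vanishes. *)
Lemma helmholtz_unique f (u u' : vector_field R) S S' :
  helmholtz f u S -> helmholtz f u' S' -> Hdot1_eq u' u /\ tensor_ae_eq S' S.
Proof.
move=> [[_ [du [ldu duE [phi tphi phidu]]]] /L2sym_setT[lS symS] divS fE].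
move=> [[_ [du' [ldu' duE' [phi' tphi' phidu']]]] /L2sym_setT[lS' symS'] divS' fE'].
pose T : tensor_field R := fun i j z => S' i j z - S i j z.
have lT i j : L2 (T i j) by apply: L2B.
have divT : sym_div_free T.
  split=> //.
    by have /ae_sub := ae_and symS symS'; apply => z [h h'] i j; rewrite /T h h'.
  move=> i psi tpsi; rewrite /dist_div /dist_partial /dist_zero.
  transitivity (\sum_j (- dist_of (S' i j) (partial j psi) - - dist_of (S i j) (partial j psi))).
    apply: eq_bigr => j _; rewrite dist_ofB ?opprB ?opprK; do ?exact: L2_loc_integrable.
      by rewrite addrC.
    exact: test_partial.
  by rewrite sumrB [X in X - _](divS' i _ tpsi) [X in _ - X](divS i _ tpsi) subrr.
pose D : tensor_field R := fun i j z => du' i j z - du i j z.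
have lD i j : L2 (D i j) by apply: L2B.
have DT : {ae mu, forall z, forall i j, D i j z = - T i j z}.
  apply: ae_I2 => i; apply: ae_I2 => j.
  have lDT : loc_integrable (fun z => D i j z - (-1) * T i j z).
    by apply: loc_integrableB; [exact/L2_loc_integrable|exact/L2_loc_integrable/L2Z].
  have : {ae mu, forall z, D i j z - (-1) * T i j z = 0}.
    apply: dist_eq0_ae => // psi tpsi.
    have loc (h : scalar_field R) : L2 h -> loc_integrable h by exact: L2_loc_integrable.
    rewrite dist_ofB//; do ?[exact: loc|exact/loc/L2Z].
    have -> : dist_of (fun z => -1 * T i j z) psi = - dist_of (T i j) psi.
      rewrite /dist_of -RintegralN; last exact: integrable_loc_test (loc _ (lT i j)) tpsi.
      by apply: eq_Rintegral => z _; rewrite mulN1r mulNr.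
    rewrite opprK !dist_ofB//; do ?exact: loc.
    rewrite (duE' i j psi tpsi) (duE i j psi tpsi).
    have := fE' i j psi tpsi; rewrite (fE i j psi tpsi) /dist_add => E.
    move: E; move: (dist_sym_grad u i j psi) (dist_sym_grad u' i j psi) => a b.
    by move: (dist_of (S i j) psi) (dist_of (S' i j) psi) => c d E; lra.
  by move=> /ae_sub; apply => z /eqP; rewrite mulN1r subr_eq0 => /eqP.
have p0 := pairing_limit divT ldu tphi phidu.
have p0' := pairing_limit divT ldu' tphi' phidu'.
have [i1 _] := Rintegral_pairing lT ldu; have [i2 _] := Rintegral_pairing lT ldu'.
have [iTT _] := Rintegral_pairing lT lT; have [iTD _] := Rintegral_pairing lT lD.
have TT0 : \int[mu]_z pairing T T z = 0.
  apply: oppr_inj; rewrite oppr0 -RintegralN//.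
  transitivity (\int[mu]_z pairing T D z).
    apply: Rintegral_ae => //.
      by have := integrableRZ (-1) iTT; congr integrable; apply/funext => z /=; rewrite mulN1r.
    move: DT => /ae_sub; apply => z Dz; rewrite /pairing -sumrN; apply: eq_bigr => i _.
    by rewrite -sumrN; apply: eq_bigr => j _; rewrite Dz mulrN.
  rewrite -[RHS](subrr (0 : R)) -{1}p0' -p0 -RintegralB//.
  apply: eq_Rintegral => z _; rewrite /pairing -sumrB; apply: eq_bigr => i _.
  by rewrite -sumrB; apply: eq_bigr => j _; rewrite mulrBr.
have ST : tensor_ae_eq S' S.
  have /ae_sub := pairing0_ae lT TT0; apply => z Tz i j.
  by apply/eqP; rewrite -subr_eq0; apply/eqP; exact: Tz.
split=> // i j psi tpsi.
have SS' : dist_of (S' i j) psi = dist_of (S i j) psi.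
  apply: Rintegral_ae; do ?exact: integrable_loc_test (L2_loc_integrable _) tpsi.
  by move: ST => /ae_sub; apply => z ->.
have := fE' i j psi tpsi; rewrite (fE i j psi tpsi) /dist_add SS'.
by move/addIr.
Qed.

End pairing.

(** * Hooke's law and its inverse *)

Section hooke.
Context {R : realType}.
Variables (pc : plane_condition) (E nu : R).

Definition grad_factor : R :=
  match pc with PlaneStrain => - (nu * (1 + nu) / E) | PlaneStress => - (nu / E) end.

Definition stress_factor : R :=
  match pc with PlaneStrain => (1 - nu ^+ 2) / E | PlaneStress => 1 / E end.

Lemma stressE (eps : tensor_field R) i j z : stress pc E nu eps i j z =
  E / (1 + nu) * (bulk_ratio pc nu * (i == j)%:R * (eps ord0 ord0 z + eps ord_max ord_max z)
                  + 2^-1 * (eps i j z + eps j i z)).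
Proof.
rewrite /stress !sumI2 /elasticity_tensor.
have [->|->] := ord2E i; have [->|->] := ord2E j; rewrite !eqxx /=; ring.
Qed.

Lemma stress_sym (eps : tensor_field R) i j z :
  stress pc E nu eps i j z = stress pc E nu eps j i z.
Proof. by rewrite !stressE eq_sym [eps i j z + _]addrC. Qed.

Lemma stress_zero_ext (O : set (R * R)) (eps : tensor_field R) i j :
  zero_ext O (stress pc E nu eps) i j = stress pc E nu (zero_ext O eps) i j.
Proof.
apply/funext => z; rewrite /zero_ext stressE !patchE; case: ifP => _; first by rewrite stressE.
by rewrite !addr0 !mulr0 addr0 mulr0.
Qed.

Lemma L2_stress (eps : tensor_field R) i j : (forall i j, L2 (eps i j)) ->
  L2 (stress pc E nu eps i j).
Proof.
move=> le; have -> : stress pc E nu eps i j = fun z => E / (1 + nu) *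
    (bulk_ratio pc nu * (i == j)%:R * (eps ord0 ord0 z + eps ord_max ord_max z)
                  + 2^-1 * (eps i j z + eps j i z)).
  by apply/funext => z; exact: stressE.
by apply: L2Z; apply: L2D; apply: L2Z; apply: L2D.
Qed.

Hypothesis constants : admissible_constants pc E nu.

(** The inverse law combines [sigma] and [tr(sigma) I], and the latter is [h + sigma]. The factor of
    [sigma] is thus the sum of two: [(1 + nu) / E - nu * (1 + nu) / E] in plane strain,
    [(1 + nu) / E - nu / E] in plane stress. *)
Lemma hooke_inverse (eps : tensor_field R) i j z : (forall i j, eps i j z = eps j i z) ->
  eps i j z = grad_factor * ((-1) ^+ (i + j) * stress pc E nu eps (rev_ord i) (rev_ord j) z)
    + stress_factor * stress pc E nu eps i j z.
Proof.
move=> sym; have r0E : rev_ord (ord0 : 'I_2) = ord_max by exact: val_inj.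
have r1E : rev_ord (ord_max : 'I_2) = ord0 by exact: val_inj.
have e10 := sym ord_max ord0.
case: constants; rewrite /grad_factor /stress_factor !stressE /bulk_ratio.
have [->|->] := ord2E i; have [->|->] := ord2E j; rewrite ?r0E ?r1E ?eqxx /= ?e10;
  case: pc => E0 nu0 nu1; rewrite ?expr0 ?expr1 ?expr2; field; by rewrite ?nu0 ?nu1 ?E0.
Qed.

End hooke.

(** * Supports, and membership in the homogeneous spaces *)

Section assembly.
Context {R : realType}.
Local Notation mu := (mu2 R).
Implicit Types O : set (R * R).

Lemma bounded_closure_box O : bounded_set O ->
  exists2 r, 0 < r & forall z, closure O z -> `|z.1| < r /\ `|z.2| < r.
Proof.
move=> [M [_ MP]]; have M1 : M < `|M| + 1 by rewrite (le_lt_trans (ler_norm M))// ltrDl.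
have OM : O `<=` (box (`|M| + 1) : set (R * R)).
  move=> z /(MP _ M1) h; apply/boxP; split; apply: le_trans h.
    by rewrite [leRHS]prod_normE le_max lexx.
  by rewrite [leRHS]prod_normE le_max lexx orbT.
exists (`|M| + 2) => [|z]; first by rewrite ltr_wpDl.
have cb : closed (box (`|M| + 1) : set (R * R)).
  by apply: compact_closed (compact_box (r := _)); exact: norm_hausdorff.
move=> /(closure_subset OM); rewrite -((closure_id _).1 cb) => /boxP[z1 z2].
by split; lra.
Qed.

Lemma dist_supp_sub (T : functional R) O :
  (forall phi, test_fun phi -> supp phi `<=` ~` closure O -> T phi = 0) ->
  dist_supp T `<=` closure O.
Proof.
move=> T0 x xT; apply: contrapT => nx.
have [phi [tphi sphi /eqP]] := xT _ (closed_openC (@closed_closure _ O)) nx.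
by apply; exact: T0.
Qed.

Lemma compactly_supported O (T : functional R) : compact (closure O) ->
  dist_supp T `<=` closure O -> compactly_supported_within O T.
Proof.
move=> cO TO; split=> //; apply: subclosed_compact cO TO.
exact: dist_supp_closed.
Qed.

Lemma dist_of_outside O (f phi : scalar_field R) : (forall z, ~ closure O z -> f z = 0) ->
  supp phi `<=` ~` closure O -> dist_of f phi = 0.
Proof.
move=> f0 sphi; rewrite /dist_of (_ : (fun z => _) = cst 0) ?Rintegral_cst ?mul0r//.
apply/funext => z; have [->|/supp_neq0/sphi/f0->] := eqVneq (phi z) 0; first by rewrite mulr0.
by rewrite mul0r.
Qed.

Lemma integral_sum_sqr (x : tensor_field R) :
  (forall i j, measurable_fun setT (x i j : plane R -> R)) ->
  (\int[mu]_z (\sum_i \sum_j x i j z ^+ 2)%:E = \sum_i \sum_j energy 2 (x i j))%E.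
Proof.
move=> mx; have m2 i j : measurable_fun setT (fun z : plane R => (x i j z ^+ 2)%:E).
  by apply/measurable_EFinP; exact: measurable_funX.
transitivity (\int[mu]_z (\sum_i \sum_j (x i j z ^+ 2)%:E))%E.
  apply: eq_integral => z _; rewrite -sumEFin; apply: eq_bigr => i _.
  by rewrite sumEFin.
have ge k l z : (0 <= (x k l z ^+ 2)%:E)%E by rewrite lee_fin sqr_ge0.
rewrite ge0_integral_sum//; last 2 first.
- by move=> i; exact: emeasurable_sum.
- by move=> i z _; exact: sume_ge0.
apply: eq_bigr => i _; rewrite ge0_integral_sum//; apply: eq_bigr => j _.
apply: eq_integral => z _; congr (_%:E).
by rewrite real_normK ?num_real.
Qed.

Section potential_spaces.
Variables (psi : scalar_field R) (g : vector_field R) (h : tensor_field R) (r : R).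
Hypotheses (jpsi : mu.-integrable setT (EFin \o psi))
  (jg : forall i, mu.-integrable setT (EFin \o g i))
  (jh : forall i j, mu.-integrable setT (EFin \o h i j)) (lh : forall i j, L2 (h i j))
  (psiO : forall z, psi z != 0 -> box r z) (gO : forall i z, g i z != 0 -> box r z)
  (hO : forall i j z, ~ ocbox r z -> h i j z = 0) (hS : forall i j, h i j = h j i)
  (wg : forall i, weak_partial i psi (g i)) (wh : forall i j, weak_partial j (g i) (h i j)).

Let eps (n : nat) : R := n.+1%:R^-1.
Let eps0 n : 0 < eps n. Proof. by rewrite invr_gt0 ltr0n. Qed.

Let moll_h_near i j t : 0 < t ->
  \forall n \near \oo, (energy 2 (fun z => (moll (eps n) (h i j) z - h i j z)%R) <= t%:E)%E.
Proof. by move=> t0; apply: (@L2_moll_near _ _ r) => //; exact: hO. Qed.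

Let measurable_diff n i j :
  measurable_fun setT ((fun z => moll (eps n) (h i j) z - h i j z) : plane R -> R).
Proof.
apply: measurable_funB; last exact: integrableR_measurable (jh i j).
exact: measurable_continuous_plane (smooth_continuous (moll_smooth (eps0 n) (jh i j))).
Qed.

(** Mollifications of [psi] are test functions since [psi] is supported in a box; their second
    derivatives are the mollifications of [h], which converge in L^2. *)
Lemma Hdot2_weak : Hdot2_0 psi.
Proof.
split; first exact: integrable_loc.
exists h; split=> // [i j phi tphi|].
  have ti := test_partial i tphi; rewrite /dist_partial opprK /dist_of (wg j ti) (wh j i tphi) opprK.
  by rewrite hS.
exists (fun n => moll (eps n) psi) => [n|]; first exact: test_moll (eps0 n) jpsi psiO.
have lapE n z : laplacian (moll (eps n) psi) z - \sum_i h i i z =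
    (moll (eps n) (h ord0 ord0) z - h ord0 ord0 z) +
    (moll (eps n) (h ord_max ord_max) z - h ord_max ord_max z).
  rewrite /laplacian !sumI2 !(weak_moll (eps0 n) jpsi (wg _)) !(weak_moll (eps0 n) (jg _) (wh _ _)).
  by ring.
apply: ecvg0 => [n|t t0].
  by apply: integral_ge0 => z _; rewrite lee_fin sqr_ge0.
(* Two energies are added, and [energyD] costs a factor [2 ^+ 2]. *)
have t80 : 0 < t / 8 by rewrite divr_gt0.
near=> n.
have -> : (\int[mu]_x ((laplacian (moll (eps n) psi) x - \sum_i h i i x) ^+ 2)%:E =
  energy 2 (fun z => ((moll (eps n) (h ord0 ord0) z - h ord0 ord0 z) +
    (moll (eps n) (h ord_max ord_max) z - h ord_max ord_max z))%R))%E.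
  by apply: eq_integral => z _; rewrite lapE real_normK ?num_real.
apply: le_trans (energyD 2 (measurable_diff n _ _) (measurable_diff n _ _)) _.
have -> : t = 2 ^+ 2 * (t / 8 + t / 8) by rewrite expr2; field.
rewrite [leRHS]EFinM [in leRHS]EFinD; apply: lee_wpmul2l; first by rewrite lee_fin exprn_ge0.
by apply: leeD; near: n; exact: moll_h_near.
Unshelve. all: by end_near. Qed.

Lemma Hdot1_weak (c : R) : Hdot1_0 (fun i z => c * g i z).
Proof.
split=> [i|]; first by apply: integrable_loc; exact: integrableRZ.
exists (fun i j z => c * h i j z); split=> [i j|i j phi tphi|]; first exact: L2Z.
  rewrite /dist_sym_grad /dist_scale /dist_add /dist_partial /dist_of.
  have cE (f th : scalar_field R) : mu.-integrable setT (EFin \o f) -> test_fun th ->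
      \int[mu]_z (c * f z * th z) = c * \int[mu]_z (f z * th z).
    move=> jf tth; rewrite -RintegralZl//; last exact: integrable_loc_test (integrable_loc jf) tth.
    by apply: eq_Rintegral => z _; rewrite mulrA.
  have t1 := test_partial i tphi; have t2 := test_partial j tphi.
  rewrite (cE (g i) _ (jg i) t2) (cE (g j) _ (jg j) t1) (cE (h i j) _ (jh i j) tphi).
  by rewrite (wh i j tphi) (wh j i tphi) (hS j i); field.
exists (fun n i z => c * moll (eps n) (g i) z) => [n i|].
  by apply: testZ; exact: test_moll (eps0 n) (jg i) (gO (i := i)).
have sgE n i j z : sym_grad (fun i z => c * moll (eps n) (g i) z) i j z - c * h i j z =
    c * (moll (eps n) (h i j) z - h i j z).
  have dm k : differentiable (moll (eps n) (g k)) z.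
    exact/smooth_differentiable/(moll_smooth (eps0 n) (jg k)).
  rewrite /sym_grad !partialZ// !(weak_moll (eps0 n) (jg _) (wh _ _)) (hS j i).
  by field.
apply: ecvg0 => [n|t t0].
  by apply: integral_ge0 => z _; rewrite lee_fin sumr_ge0// => i _; rewrite sumr_ge0// => j _; rewrite sqr_ge0.
have c20 : 0 < c ^+ 2 + 1 by rewrite ltr_wpDl// sqr_ge0.
(* A quarter of [t] for each of the four entries; adding 1 to [c ^+ 2] covers the case [c = 0]. *)
pose t' := t / (4 * (c ^+ 2 + 1)); have t'0 : 0 < t' by rewrite divr_gt0// mulr_gt0.
near=> n.
have -> : (\int[mu]_x (\sum_i \sum_j (sym_grad (fun i z => c * moll (eps n) (g i) z)%R i j x -
    c * h i j x) ^+ 2)%:E =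
    \sum_i \sum_j energy 2 (fun z => (c * (moll (eps n) (h i j) z - h i j z))%R))%E.
  rewrite -integral_sum_sqr => [|i j]; last exact: measurable_funM.
  apply: eq_integral => z _; congr (_%:E); apply: eq_bigr => i _; apply: eq_bigr => j _.
  by rewrite sgE.
have le i j : (energy 2 (fun z => (moll (eps n) (h i j) z - h i j z)%R) <= t'%:E)%E ->
    (energy 2 (fun z => (c * (moll (eps n) (h i j) z - h i j z))%R) <= (t / 4)%:E)%E.
  move=> e; rewrite energyZ//; apply: (@le_trans _ _ ((`|c| ^+ 2)%:E * t'%:E)%E).
    by apply: lee_wpmul2l => //; rewrite lee_fin exprn_ge0.
  rewrite -EFinM lee_fin real_normK ?num_real//.
  have -> : c ^+ 2 * t' = t / 4 * (c ^+ 2 / (c ^+ 2 + 1)) by rewrite /t'; field; exact: lt0r_neq0.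
  rewrite ler_piMr ?divr_ge0 ?(ltW t0)// ler_pdivrMr// mul1r lerDl.
  exact: ler01.
have -> : t = (t / 4 + t / 4) + (t / 4 + t / 4) by field.
rewrite !sumI2 !EFinD.
by apply: leeD; apply: leeD; apply: le; near: n; exact: moll_h_near.
Unshelve. all: by end_near. Qed.

End potential_spaces.
End assembly.

(** * Uniqueness of Airy's function *)

Section airy_uniqueness.
Context {R : realType}.
Local Notation mu := (mu2 R).
Variables (O : set (R * R)) (r : R).
Hypotheses (r0 : 0 < r) (Or : forall z, closure O z -> `|z.1| < r /\ `|z.2| < r).

(** The derivative [d_1 d_1] determines a potential supported in the closure: there, each test
    function coincides with [d_1 d_1 q], where [q] is the double integral to the right of its
    cutoff, and off the closure both potentials vanish. *)
Lemma airy_unique (psi psi' : scalar_field R) : loc_integrable psi -> loc_integrable psi' ->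
  dist_supp (dist_of psi) `<=` closure O -> dist_supp (dist_of psi') `<=` closure O ->
  (forall phi, test_fun phi -> dist_of psi' (partial ord0 (partial ord0 phi)) =
     dist_of psi (partial ord0 (partial ord0 phi))) ->
  {ae mu, forall z, psi' z = psi z}.
Proof.
move=> lpsi lpsi' spsi spsi' psiE.
have lg := loc_integrableB lpsi' lpsi.
have cO : closed (closure O) by exact: closed_closure.
have g0 : {ae mu, forall z, ~ closure O z -> psi' z - psi z = 0}.
  have /ae_sub := ae_and (dist_supp_ae lpsi cO spsi) (dist_supp_ae lpsi' cO spsi').
  by apply => z [h h'] nz; rewrite h// h'// subrr.
have : {ae mu, forall z, psi' z - psi z = 0}.
  apply: dist_eq0_ae => // phi tphi.
  have [th [tth th2 thE]] := near_cutoff r0 Or tphi.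
  have nth : near_test r th.
    by split=> // z /th2 z2; apply: le_trans z2 _; rewrite ler_pM2r// ler_nat.
  pose q := average (X := measurableTypeR R) (@lebesgue_measure R) (ker1 (4 * r)) (@axis R) th.
  have tq : test_fun q by exact: test_Q.
  have qE z : closure O z -> partial ord0 (partial ord0 q) z = phi z.
    move=> cz; rewrite /q partial_Q// partial_Q; last exact: test_partial.
    rewrite (Q_partial0 r0 Or (near_test_partial ord0 nth) cz) (P_partial0 r0 Or nth cz) opprK.
    exact: nbhs_singleton (thE z cz).
  have tqq : test_fun (partial ord0 (partial ord0 q)) by do 2 apply: test_partial.
  transitivity (dist_of (fun z => psi' z - psi z) (partial ord0 (partial ord0 q))).
    apply: Rintegral_ae; [exact: integrable_loc_test|exact: integrable_loc_test|].
    move: g0 => /ae_sub; apply => z gz; have [cz|/gz->] := pselect (closure O z).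
      by rewrite qE.
    by rewrite !mul0r.
  by rewrite dist_ofB// psiE// subrr.
by move=> /ae_sub; apply => z /eqP; rewrite subr_eq0 => /eqP.
Qed.

End airy_uniqueness.

(** * Existence, explicit form and uniqueness of the decomposition *)

Theorem mainTheorem4 (R : realType) (pc : plane_condition) (E nu : R)
    (Omega : set (R * R)) (eps : tensor_field R)
    (Omega_domain : is_domain Omega)
    (Omega_bounded : bounded_set Omega)
    (Omega_sc : simply_connected Omega)
    (Omega_lip : lipschitz_boundary Omega)
    (constants : admissible_constants pc E nu)
    (eps_L2 : L2sym Omega eps)
    (equilibrium : traction_free_equilibrium Omega (stress pc E nu eps)) :
  let eps0 := zero_ext Omega eps in
  let sigma0 := zero_ext Omega (stress pc E nu eps) in
  exists (omega : vector_field R) (seps : tensor_field R),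
    [/\ helmholtz eps0 omega seps,
        forall i j, compactly_supported_within Omega (dist_of (seps i j)) /\
                    compactly_supported_within Omega (dist_sym_grad omega i j),
        forall (omega' : vector_field R) (seps' : tensor_field R),
          helmholtz eps0 omega' seps' ->
          Hdot1_eq omega' omega /\ tensor_ae_eq seps' seps,
        exists psi : scalar_field R,
          [/\ airy_potential Omega sigma0 psi,
              forall psi' : scalar_field R,
                airy_potential Omega sigma0 psi' ->
                {ae mu2 R, forall x, psi' x = psi x} &
              match pc with
              | PlaneStrain =>
                  (forall i, dist_eq (dist_of (omega i))
                     (dist_scale (- (nu * (1 + nu) / E)) (dist_grad psi i))) /\
                  (forall i j, dist_eq (dist_of (seps i j))
                     (dist_scale ((1 - nu ^+ 2) / E) (dist_perp2 psi i j)))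
              | PlaneStress =>
                  (forall i, dist_eq (dist_of (omega i))
                     (dist_scale (- (nu / E)) (dist_grad psi i))) /\
                  (forall i j, dist_eq (dist_of (seps i j))
                     (dist_scale (1 / E) (dist_perp2 psi i j)))
              end]
      & exists k : R,
          tensor_ae_eq seps (fun i j x => k * sigma0 i j x)].
Proof.
move=> eps0 sigma0.
have [r r0 Or] := bounded_closure_box Omega_bounded.
have cO : compact (closure Omega).
  apply: (@closed_bounded_compact _ _ r); first exact: closed_closure.
  by move=> z /Or[z1 z2]; split; exact: ltW.
have s0 i j z : ~ Omega z -> sigma0 i j z = 0.
  by move=> nz; rewrite /sigma0 /zero_ext patchE memNset.
have sE i j : sigma0 i j = stress pc E nu eps0 i j by exact: stress_zero_ext.
have [leps symeps] := eps_L2.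
have lS i j : L2 (sigma0 i j) by rewrite sE; exact: L2_stress.
have clbox z : closure Omega z -> box r z.
  by move=> /Or[z1 z2]; apply/boxP; split; exact: ltW.
have out_box z : ~ ocbox r z -> ~ closure Omega z.
  move=> nb /Or[]; rewrite !ltr_norml => /andP[? ?] /andP[? ?]; apply: nb.
  by split; rewrite /= in_itv/=; apply/andP; split=> //; exact: ltW.
have js i j : (mu2 R).-integrable setT (EFin \o sigma0 i j).
  apply: (L2_supported (r := r)) => // z sz; apply/clbox/subset_closure.
  by apply: contrapT => /(s0 i j)/eqP; apply/negP.
have sS i j z : sigma0 i j z = sigma0 j i z by rewrite !sE stress_sym.
have sdiv i th : test_fun th -> \int[mu2 R]_z (sigma0 i ord0 z * partial ord0 th z) +
    \int[mu2 R]_z (sigma0 i ord_max z * partial ord_max th z) = 0.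
  move=> /(equilibrium i); rewrite /dist_div /dist_partial /dist_zero sumI2 => /eqP.
  by rewrite -opprD oppr_eq0 => /eqP.
pose psi := airy Omega sigma0 r; pose g := airy_grad Omega sigma0 r.
pose h := hess sigma0.
have wg i : weak_partial i psi (g i).
  exact: weak_airy r0 Or s0 js sS sdiv Omega_domain Omega_sc Omega_lip cO i.
have wh i j : weak_partial j (g i) (h i j).
  exact: weak_airy_grad r0 Or s0 js sS sdiv Omega_domain Omega_sc Omega_lip cO i j.
have mc : measurable (closure Omega : set (plane R)).
  by apply: measurable_closed_plane; exact: closed_closure.
have jcut (f : scalar_field R) : (mu2 R).-integrable setT (EFin \o f) ->
    (mu2 R).-integrable setT (EFin \o (f \_ (closure Omega))).
  move=> jf; rewrite -restrict_EFin; apply/(integrable_mkcond _ mc).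
  exact: integrableS jf.
have jpsi : (mu2 R).-integrable setT (EFin \o psi).
  by apply: jcut; exact: integrable_potential.
have jg i : (mu2 R).-integrable setT (EFin \o g i).
  by apply: jcut; exact: integrable_slope.
have cut0 (f : scalar_field R) z : ~ closure Omega z -> (f \_ (closure Omega)) z = 0.
  by move=> nz; rewrite patchE memNset.
have cut_box (f : scalar_field R) z : (f \_ (closure Omega)) z != 0 -> box r z.
  by move=> fz; apply: clbox; apply: contrapT => /(cut0 f)/eqP; apply/negP.
have lh i j : L2 (h i j) by apply: L2Z.
have jh i j : (mu2 R).-integrable setT (EFin \o h i j) by exact: integrable_hess.
have hS i j : h i j = h j i.
  by apply/funext => z; rewrite /h /hess addnC sS.
have hO i j z : ~ ocbox r z -> h i j z = 0.
  by move=> /out_box nz; rewrite /h /hess s0 ?mulr0// => /subset_closure.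
pose c := grad_factor pc E nu; pose k := stress_factor pc E nu.
pose omega : vector_field R := fun i z => c * g i z.
pose seps : tensor_field R := fun i j z => k * sigma0 i j z.
have scaleE (a : R) (f phi : scalar_field R) : (mu2 R).-integrable setT (EFin \o f) ->
    test_fun phi -> dist_of (fun z => a * f z) phi = a * dist_of f phi.
  move=> jf tphi; rewrite /dist_of -RintegralZl//; last first.
    exact: integrable_loc_test (integrable_loc jf) tphi.
  by apply: eq_Rintegral => z _; rewrite mulrA.
have perpE i j phi : test_fun phi -> dist_perp2 psi i j phi = dist_of (sigma0 i j) phi.
  move=> tphi; have ti := test_partial (rev_ord i) tphi.
  rewrite /dist_perp2 /dist_scale /dist_partial opprK /dist_of (wg _ _ ti) (wh _ _ _ tphi) opprK.
  rewrite -/(dist_of _ phi) /h /hess scaleE// mulrA !rev_ordK.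
  (* Reversing both indices preserves the parity of their sum, so the signs of [dist_perp2] and
     [hess] cancel. *)
  have -> : (-1) ^+ (i + j) * (-1) ^+ (rev_ord j + rev_ord i) = 1 :> R.
    by have [->|->] := ord2E i; have [->|->] := ord2E j; rewrite /= -exprD -signr_odd.
  by rewrite mul1r; apply: eq_Rintegral => z _; rewrite sS.
have sgE i j phi : test_fun phi -> dist_sym_grad omega i j phi = c * dist_of (h i j) phi.
  move=> tphi; have t1 := test_partial i tphi; have t2 := test_partial j tphi.
  rewrite /dist_sym_grad /dist_scale /dist_add /dist_partial.
  rewrite (scaleE c (g i) _ (jg i) t2) (scaleE c (g j) _ (jg j) t1).
  rewrite [dist_of (g i) _](wh i j _ tphi) [dist_of (g j) _](wh j i _ tphi) (hS j i).
  by rewrite /dist_of; field.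
have helm : helmholtz eps0 omega seps.
  split.
  - exact: (Hdot1_weak jg jh lh (fun i => @cut_box _) hO hS wh).
  - split=> [i j|]; last by apply: aeW => z _ i j; rewrite /seps sS.
    have := L2Z k (lS i j); congr L2; apply/funext => z.
    by rewrite /zero_ext patchE mem_set.
  - move=> i phi tphi; rewrite /dist_div /dist_partial /dist_zero sumI2.
    have t0 := test_partial ord0 tphi; have t1 := test_partial ord_max tphi.
    rewrite (scaleE k (sigma0 i ord0) _ (js _ _) t0) (scaleE k (sigma0 i ord_max) _ (js _ _) t1).
    have -> : dist_of (sigma0 i ord_max) (partial ord_max phi) =
        - dist_of (sigma0 i ord0) (partial ord0 phi).
      by apply/eqP; rewrite -addr_eq0 addrC; apply/eqP; exact: sdiv.
    by rewrite mulrN opprK addNr.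
  - move=> i j phi tphi; rewrite /dist_add sgE// (scaleE k (sigma0 i j) _ (js i j) tphi) /dist_of.
    have jhp := integrable_loc_test (integrable_loc (jh i j)) tphi.
    have jsp := integrable_loc_test (integrable_loc (js i j)) tphi.
    rewrite -!RintegralZl// -RintegralD//; do ?exact: integrableRZ.
    apply: Rintegral_ae.
    + exact: integrable_loc_test (L2_loc_integrable (leps i j)) tphi.
    + by apply: integrableRD; exact: integrableRZ.
    (* Hooke's law is inverted pointwise, where [eps] is symmetric; off Omega the extension is 0,
       hence symmetric as well. *)
    move: symeps => /ae_sub; apply => z symz.
    have sym0 l m : eps0 l m z = eps0 m l z.
      by rewrite /eps0 /zero_ext !patchE; case: ifP => // /set_mem /symz ->.
    rewrite {1}(hooke_inverse constants i j sym0) -!sE /h /hess -/c -/k.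
    by ring.
exists omega, seps; split=> //.
- move=> i j; split; apply: compactly_supported => //; apply: dist_supp_sub => phi tphi sphi.
    apply: dist_of_outside sphi => z nz.
    by rewrite /seps s0 ?mulr0// => /subset_closure.
  rewrite sgE// (dist_of_outside _ sphi) ?mulr0// => z nz.
  by rewrite /h /hess s0 ?mulr0// => /subset_closure.
- by move=> omega' seps'; exact: helmholtz_unique.
- have spsi : dist_supp (dist_of psi) `<=` closure Omega.
    apply: dist_supp_sub => phi tphi sphi.
    by apply: dist_of_outside sphi => z; exact: cut0.
  exists psi; split.
  + split=> //; first exact: (Hdot2_weak jpsi jg jh lh (@cut_box _) hO hS wg wh).
    by move=> i j phi tphi; rewrite perpE.
  + move=> psi' [[lpsi' _] spsi' psiE'].
    apply: (airy_unique r0 Or (integrable_loc jpsi) lpsi' spsi spsi') => phi tphi.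
    (* Entry 22 of [(d^perp)^2] is [d_1 d_1], the derivative by which [airy_unique] compares the two
       potentials. *)
    have r1E : rev_ord (ord_max : 'I_2) = ord0 by exact: val_inj.
    have := psiE' ord_max ord_max phi tphi; rewrite -perpE// /dist_perp2 /dist_scale /dist_partial.
    by rewrite !opprK r1E -signr_odd/= expr0 !mul1r.
  + have h1 i : dist_eq (dist_of (omega i)) (dist_scale c (dist_grad psi i)).
      move=> phi tphi; rewrite scaleE// /dist_scale /dist_grad /dist_partial.
      by rewrite [dist_of psi _](wg i _ tphi) opprK.
    have h2 i j : dist_eq (dist_of (seps i j)) (dist_scale k (dist_perp2 psi i j)).
      by move=> phi tphi; rewrite scaleE// /dist_scale perpE.
    by move: h1 h2; rewrite /c /k; case: (pc).
- by exists k; apply: aeW.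
Qed.
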